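(* Let $f(z)=z+z^2$, let $f^{\log}(\zeta)=-\ln\left(f(e^{-\zeta})\right)$, and let $A(f^{\log})=\ln\circ f^{\log}\circ\exp$. For $\alpha>0$ let $m_\alpha$ denote the map $\zeta\mapsto\alpha\zeta$. Put $$k_1=\left(A(f^{\log})-\mathrm{id}\right)\circ m_{1/2},\qquad k_2=\left(A(f^{\log})-\mathrm{id}\right)\circ m_{1/3}.$$ Then $k_1,k_2\in K_{1,1}$, but $$k_2'k_1-k_1'k_2\notin K_{1,1}.$$ Here $K_{1,1}$ is the set of functions defined in the context.
   Context: Functions are considered as germs at $+\infty$ on the real axis, with analytic extension to the domains indicated. For $a\ge 0$ put $\mathbb{C}_a^+=\{\zeta\in\mathbb{C}:\mathrm{Re}(\zeta)\ge a\}$, and let $\ln(\mathbb{C}_a^+)$ be its image under the principal branch of the logarithm. **The set $FC^0$.** This is the set of analytic functions $\phi$ for which there exist a series $\sum_{q\ge0}b_qe^{-c_q\zeta}$, with $b_q\in\mathbb{R}$, $c_q>0$ and $c_q$ strictly increasing to $+\infty$, and some $a\ge0$, such that for all $\zeta\in\mathbb{C}_a^+$, all $N>0$ and all $\epsilon\in(0,c_{N+1}-c_N)$, $$\left|\phi(\zeta)-\sum_{q=0}^Nb_qe^{-c_q\zeta}\right|\le e^{-(c_N+\epsilon)\mathrm{Re}(\zeta)}.$$ **The set $K_{1,0}$.** This is the set of finite sums of elements of $FC^0$ multiplied by exponentials $e^{\lambda\zeta}$, $\lambda>0$. **The set $E^1$ of exponents.** This is the set of all functions $\mathbf{e}$ which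 on some $\mathbb{C}_a^+$ admit asymptotics of the form $$\mathbf{e}(\zeta)=\nu(\mathbf{e})\,e^{\zeta}+\sum_{q\ge0}b_qe^{(1-c_q)\zeta},$$ with $\nu(\mathbf{e})\in\mathbb{R}$, $b_q\in\mathbb{R}$, $c_q>0$ and $c_q$ strictly increasing to $+\infty$, meaning that for all $\zeta\in\mathbb{C}_a^+$, all $N>0$ and all $\epsilon\in(0,c_{N+1}-c_N)$, $$\left|\mathbf{e}(\zeta)-\nu(\mathbf{e})\,e^{\zeta}-\sum_{q=0}^Nb_qe^{(1-c_q)\zeta}\right|\le e^{(1-c_N-\epsilon)\mathrm{Re}(\zeta)}.$$ The number $\nu(\mathbf{e})$ is called the principal exponent of $\mathbf{e}$. **The set $FC^{1,0}$.** This is the set of all analytic functions $\psi$, exponentially decreasing on the real axis (that is, $\psi(x)=O(e^{-\epsilon x})$ as $x\to+\infty$ for some $\epsilon>0$), such that $\psi\circ\exp$ admits on some $\ln(\mathbb{C}_a^+)$ asymptotics of the form $$\sum_{q\ge0}k_qe^{\mathbf{e}_q},\qquad k_q\in K_{1,0},\ \mathbf{e}_q\in E^1,\qquad \lim_{q\to\infty}\nu(\mathbf{e}_q)=-\infty,$$ where the terms are ordered so that the $\nu(\mathbf{e}_q)$ are (not necessarily strictly) descending. Being asymptotic means that for every $\lambda>0$ there is $N_0$ such that for every $N\ge N_0$ the partial sum $\sum_{q=0}^{N}k_qe^{\mathbf{e}_q}$ approximates $\psi\circ\exp$ with error smaller than $e^{-\lambda\mathrm{Re}(e^\zeta)}$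 on the real axis (near $+\infty$). Several $\mathbf{e}_q$ may have the same principal exponent. A series that is in fact a finite sum is allowed. **The set $K_{1,1}$.** This is the set of all functions of the form $$\phi+\sum_{q=1}^N\psi_q\circ\exp\circ m_{\alpha_q},$$ with $N$ finite, $\phi\in K_{1,0}$, $\psi_q\in FC^{1,0}$ and $0<\alpha_q<1$.
   Formalization: In FC^{1,0} the error bound is required at all real points of one ln(C_a^+) (a fixed before lambda and N), with all k_q, e_q analytic there; if ''near +∞'' could depend on lambda and N, flat functions would enter FC^{1,0} and k_2'k_1-k_1'k_2 would lie in K_{1,1}. *)

(* Defs.v *)
From Stdlib Require Import Reals.
From Coquelicot Require Export Coquelicot.
Open Scope R_scope.

Definition Cexp (z : C) : C := (exp (Re z) * cos (Im z), exp (Re z) * sin (Im z)).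

(* Principal argument, in (-PI, PI]; meaningful for w <> 0. *)
Definition Carg (w : C) : R :=
  if Rle_dec 0 (Im w) then acos (Re w / Cmod w) else - acos (Re w / Cmod w).

Definition Clog (w : C) : C := (ln (Cmod w), Carg w).

Definition halfplane (a : R) (z : C) : Prop := a <= Re z.

(* Image of the half-plane under the principal logarithm; 0 has to be
   removed when a = 0. *)
Definition ln_halfplane (a : R) (z : C) : Prop :=
  exists w : C, halfplane a w /\ w <> RtoC 0 /\ z = Clog w.

(* Functions are total on C, but only their values on the indicated domains
   matter.  Analytic on D means given by a convergent power series near every
   point of D (hence on an open neighbourhood of D). *)
Definition analytic_at (f : C -> C) (z0 : C) : Prop :=
  exists (r : R) (u : nat -> C), 0 < r /\
    forall z : C, Cmod (z - z0)%C < r ->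
      is_pseries (K := C_AbsRing) (V := C_NormedModule) u (z - z0)%C (f z).

Definition analytic_on (D : C -> Prop) (f : C -> C) : Prop :=
  forall z : C, D z -> analytic_at f z.

Definition m (alpha : R) (x : R) : R := alpha * x.

(* c_q > 0, strictly increasing to +oo. *)
Definition exponent_sequence (c : nat -> R) : Prop :=
  (forall q, 0 < c q) /\ (forall q, c q < c (S q)) /\ is_lim_seq c p_infty.

(* Coefficients b_q may vanish, so finite series are included.
   [sum_n u N] is u_0 + ... + u_N. *)
Definition FC0 (phi : C -> C) : Prop :=
  exists (b c : nat -> R) (a : R),
    exponent_sequence c /\ 0 <= a /\ analytic_on (halfplane a) phi /\
    forall (z : C) (N : nat) (eps : R),
      halfplane a z -> (0 < N)%nat -> 0 < eps < c (S N) - c N ->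
      Cmod (phi z - sum_n (fun q => RtoC (b q) * Cexp (RtoC (- c q) * z))%C N)%C
        <= exp (- (c N + eps) * Re z).

(* The equality is one of germs at +oo, hence holds on some half-plane.
   [sum_n_m u 1 n] is u_1 + ... + u_n, and is 0 when n = 0. *)
Definition K10 (k : C -> C) : Prop :=
  exists (n : nat) (phi : nat -> C -> C) (lambda : nat -> R),
    (forall i, (1 <= i <= n)%nat -> FC0 (phi i) /\ 0 < lambda i) /\
    exists a : R, 0 <= a /\
      forall z : C, halfplane a z ->
        k z = sum_n_m (fun i => phi i z * Cexp (RtoC (lambda i) * z))%C 1 n.

(* [E1 e nu]: e is an exponent with principal exponent nu. *)
Definition E1 (e : C -> C) (nu : R) : Prop :=
  exists (b c : nat -> R) (a : R),
    exponent_sequence c /\ 0 <= a /\ analytic_on (halfplane a) e /\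
    forall (z : C) (N : nat) (eps : R),
      halfplane a z -> (0 < N)%nat -> 0 < eps < c (S N) - c N ->
      Cmod (e z - RtoC nu * Cexp z
              - sum_n (fun q => RtoC (b q) * Cexp (RtoC (1 - c q) * z))%C N)%C
        <= exp ((1 - c N - eps) * Re z).

(* [psi o exp] has the asymptotic series sum_q k_q e^{e_q} on ln(C_a^+): the
   terms are analytic there, and the estimate is required at the real points
   of ln(C_a^+), one neighbourhood of +oo that depends neither on lambda nor
   on N (just as a in FC0 and E1 does not depend on N).  If the neighbourhood
   could shrink with N, every psi that is superexponentially flat on the real
   axis would have the zero series as asymptotics.  Each k_q and e_q has its
   own half-plane in K10 and E1; analyticity on ln(C_a^+) is what determines
   its values near the left end of the ray.
   A finite series is one with k_q = 0 from some rank on. *)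
Definition FC10_asymptotics (a : R) (psi : C -> C)
    (k e : nat -> C -> C) (nu : nat -> R) : Prop :=
  (forall q, K10 (k q) /\ analytic_on (ln_halfplane a) (k q)) /\
  (forall q, E1 (e q) (nu q) /\ analytic_on (ln_halfplane a) (e q)) /\
  (forall q, nu (S q) <= nu q) /\ is_lim_seq nu m_infty /\
  forall lambda : R, 0 < lambda ->
    exists N0 : nat, forall N : nat, (N0 <= N)%nat ->
      forall x : R, ln_halfplane a (RtoC x) ->
        Cmod (psi (Cexp (RtoC x))
                - sum_n (fun q => k q (RtoC x) * Cexp (e q (RtoC x)))%C N)%C
          < exp (- lambda * Re (Cexp (RtoC x))).

Definition exp_decreasing (psi : C -> C) : Prop :=
  exists eps M x0 : R, 0 < eps /\
    forall x : R, x0 <= x -> Cmod (psi (RtoC x)) <= M * exp (- eps * x).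

Definition FC10 (psi : C -> C) : Prop :=
  exp_decreasing psi /\
  exists (a : R) (k e : nat -> C -> C) (nu : nat -> R),
    0 <= a /\ analytic_on (halfplane a) psi /\ FC10_asymptotics a psi k e nu.

(* A set of germs at +oo on the real axis: g only matters near +oo. *)
Definition K11 (g : R -> C) : Prop :=
  exists (phi : C -> C) (N : nat) (psi : nat -> C -> C) (alpha : nat -> R),
    K10 phi /\
    (forall q, (1 <= q <= N)%nat -> FC10 (psi q) /\ 0 < alpha q < 1) /\
    exists x0 : R, forall x : R, x0 <= x ->
      g x = (phi (RtoC x)
             + sum_n_m (fun q => psi q (RtoC (exp (m (alpha q) x)))) 1 N)%C.

(* Main.v *)
From Stdlib Require Import Reals Lra Lia Factorial Classical ClassicalEpsilon FunctionalExtensionality.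
Require Import Defs.
From Stdlib Require Import Arith List Sorted.
Open Scope R_scope.

(** With [G y = ln (1 - ln (1 + e^{-y}) / y)] one has [k1 x = G (e^{x/2})] and
    [k2 x = G (e^{x/3})], and [G] is a convergent series of terms
    [P_r (1/y) e^{-r y}] with polynomials [P_r], so that [k1] and [k2] lie in [K11].

    At [x = 2 t], with [y = e^t] and [v = e^{2t/3}], the bracket [k2' k1 - k1' k2]
    is [e^{-y}] times an infinite series of terms [Q_r e^{-r v}], all nonzero, up to
    [O(y e^{-2y})]: infinitely many different exponents [- y - r v] share the
    principal exponent [-1], whereas an element of [FC10] has only finitely many
    terms with a given principal exponent.

    To make this a contradiction, the slower scales [alpha < 1/2] and the [K10]
    part of a putative decomposition are shown to cancel identically, the scales
    [alpha > 1/2] being negligible.  This needs a quasi-analyticity property on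
    the real axis: a sum of products of elements of [FC0] and exponentials that
    is flatter than every [e^{-M x}] vanishes.  The approximating exponential
    sums then have only exponents [<= -M]; being bounded on a vertical line
    uniformly in [M], they are [O(e^{-M x})] uniformly in [M] by a maximum
    principle. *)

(** The asymptotics in [FC10] bound the error on the real ray only, so no maximum principle in the
    complex domain is available for [psi o exp] and uniqueness has to come from real data. The
    substitute is a ray that depends neither on [lambda] nor on [N]: if the partial sum chosen for
    [lambda] cancels near infinity, analyticity of its terms makes it vanish on the whole ray, and
    the error bound becomes a bound by e^{-lambda e^t} at a fixed t, for every [lambda]. To decide
    whether a partial sum cancels, each e^{e_q} is split as K e^p: p collects the exponentials with
    positive exponents occurring in e_q, and K has an exponential expansion. Distinct p differ by at
    least c e^{dx} with c, d > 0, which outweighs every K, so a finite sum of such terms either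
    vanishes near infinity or has a dominant term. The scales 1/2 and 1/3 enter through v = y^{2/3}
    = o(y): all terms e^{-y-rv} lie far above e^{-2y}, the order at which the part of [G y] beyond
    its first term begins. *)

Ltac cparts := unfold Cminus, Cplus, Copp, Cmult, Cconj, Re, Im, RtoC; cbn [fst snd].

Lemma exp_mono (x y : R) : x <= y -> exp x <= exp y.
Proof. intros [H|<-]; [left; apply exp_increasing, H|apply Rle_refl]. Qed.

Lemma exp_mono_inv (x y : R) : exp x <= exp y -> x <= y.
Proof.
  intros H. destruct (Rle_or_lt x y) as [L|L]; [exact L|].
  apply exp_increasing in L. lra.
Qed.

(* Some Coquelicot goals are equations at the carrier of a normed module, where [ring] does not see [R]. *)
Ltac eqR := match goal with |- @eq _ ?a ?b => change (@eq R a b) end.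

(** * The complex exponential and its Taylor remainder *)

Lemma Cexp_plus (z w : C) : Cexp (z + w)%C = (Cexp z * Cexp w)%C.
Proof.
  unfold Cexp, Cmult, Cplus; destruct z as [x y], w as [u v]; simpl.
  rewrite exp_plus, cos_plus, sin_plus; f_equal; ring.
Qed.

Lemma Cexp_0 : Cexp (RtoC 0) = RtoC 1.
Proof. unfold Cexp, RtoC; simpl. rewrite exp_0, cos_0, sin_0; f_equal; ring. Qed.

Lemma Cexp_RtoC (x : R) : Cexp (RtoC x) = RtoC (exp x).
Proof. unfold Cexp, RtoC; simpl. rewrite cos_0, sin_0; f_equal; ring. Qed.

Lemma Cmod_Cexp (z : C) : Cmod (Cexp z) = exp (Re z).
Proof.
  unfold Cmod, Cexp; destruct z as [x y]; simpl.
  replace (_ + _) with (exp x ^ 2 * (Rsqr (sin y) + Rsqr (cos y))) by (unfold Rsqr; ring).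
  rewrite sin2_cos2, Rmult_1_r.
  apply sqrt_pow2. left; apply exp_pos.
Qed.

Lemma Cexp_pow (z : C) (n : nat) : (Cexp z ^ n)%C = Cexp (RtoC (INR n) * z)%C.
Proof.
  induction n as [|n IH].
  - simpl. rewrite Cmult_0_l, Cexp_0. reflexivity.
  - rewrite Cpow_S, IH, S_INR, <- Cexp_plus, RtoC_plus. f_equal. ring.
Qed.

Definition Cder (h h' : R -> C) (t : R) : Prop :=
  is_derive (fun s => Re (h s)) t (Re (h' t)) /\
  is_derive (fun s => Im (h s)) t (Im (h' t)).

(** Project onto the direction w = h 1 - h 0: the real function Re(conj(w) h) - |w| g has derivative
    at most |w| (|h'| - g') <= 0, so the scalar mean value theorem gives |w|^2 <= |w| (g 1 - g
    0). *)
Lemma Cmean_value (h h' : R -> C) (g g' : R -> R) :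
  (forall t, 0 <= t <= 1 -> Cder h h' t) ->
  (forall t, 0 <= t <= 1 -> is_derive g t (g' t)) ->
  (forall t, 0 <= t <= 1 -> Cmod (h' t) <= g' t) ->
  Cmod (h 1 - h 0)%C <= g 1 - g 0.
Proof.
  intros Hh Hg Hb.
  set (w := (h 1 - h 0)%C).
  set (phi := fun t => Re w * Re (h t) + Im w * Im (h t) - Cmod w * g t).
  set (phi' := fun t => Re w * Re (h' t) + Im w * Im (h' t) - Cmod w * g' t).
  assert (D : forall t, 0 <= t <= 1 -> is_derive phi t (phi' t)).
  { intros t Ht. destruct (Hh t Ht) as [D1 D2]. specialize (Hg t Ht).
    unfold phi, phi'.
    apply (is_derive_minus (K := R_AbsRing) (V := R_NormedModule)).
    - apply (is_derive_plus (K := R_AbsRing) (V := R_NormedModule)).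
      + apply (is_derive_scal (fun s => Re (h s)) t (Re w) _ D1).
      + apply (is_derive_scal (fun s => Im (h s)) t (Im w) _ D2).
    - apply (is_derive_scal g t (Cmod w) _ Hg). }
  assert (N : forall t, 0 <= t <= 1 -> phi' t <= 0).
  { intros t Ht. specialize (Hb t Ht). unfold phi'.
    assert (E : Re w * Re (h' t) + Im w * Im (h' t) = Re (Cconj w * h' t)%C).
    { destruct w, (h' t); simpl; ring. }
    rewrite E.
    assert (L := re_le_Cmod (Cconj w * h' t)%C).
    rewrite Cmod_mult, Cmod_conj in L.
    assert (A := Rle_abs (Re (Cconj w * h' t)%C)).
    assert (P := Cmod_ge_0 w). nra. }
  destruct (MVT_gen phi 0 1 phi') as [c [Hc Ec]].
  - intros x Hx. rewrite Rmin_left, Rmax_right in Hx by lra. apply D; lra.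
  - intros x Hx. rewrite Rmin_left, Rmax_right in Hx by lra.
    apply derivable_continuous_pt. exists (phi' x). apply is_derive_Reals, D; lra.
  - rewrite Rmin_left, Rmax_right in Hc by lra.
    specialize (N c Hc).
    assert (E : phi 1 - phi 0 = Cmod w ^ 2 - Cmod w * (g 1 - g 0)).
    { unfold phi. rewrite Cmod2_alt. unfold w. destruct (h 1), (h 0); simpl. ring. }
    destruct (Rle_lt_or_eq_dec 0 (Cmod w) (Cmod_ge_0 w)) as [Hw|Hw].
    + apply Rmult_le_reg_l with (Cmod w); nra.
    (* For w = 0 there is nothing to cancel; g 1 >= g 0 follows from g' >= |h'| >= 0. *)
    + rewrite <- Hw.
      destruct (MVT_gen g 0 1 g') as [d [Hd Ed]].
      * intros x Hx. rewrite Rmin_left, Rmax_right in Hx by lra. apply Hg; lra.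
      * intros x Hx. rewrite Rmin_left, Rmax_right in Hx by lra.
        apply derivable_continuous_pt. exists (g' x). apply is_derive_Reals, Hg; lra.
      * rewrite Rmin_left, Rmax_right in Hd by lra.
        assert (Q := Hb d Hd). assert (Q2 := Cmod_ge_0 (h' d)). lra.
Qed.

(** [N] counts terms, so the degree is below [N] and the remainder is of order z^N. *)
Fixpoint Cexp_taylor (N : nat) (z : C) : C :=
  match N with
  | O => RtoC 0
  | S n => (Cexp_taylor n z + RtoC (/ INR (fact n)) * z ^ n)%C
  end.

Lemma Cder_taylor (z : C) (N : nat) (t : R) :
  Cder (fun s => Cexp_taylor (S N) (RtoC s * z))
       (fun s => z * Cexp_taylor N (RtoC s * z))%C t.
Proof.
  induction N as [|n [IH1 IH2]].
  - split; simpl.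
    + apply is_derive_ext with (fun _ => / 1); [intros; simpl; field|].
      replace (_ - _) with 0 by ring. apply @is_derive_const.
    + apply is_derive_ext with (fun _ => 0); [intros; simpl; field|].
      replace (_ + _) with 0 by ring. apply @is_derive_const.
  - assert (E : forall s, (RtoC (/ INR (fact (S n))) * (RtoC s * z) ^ S n)%C
                 = (RtoC (s ^ S n / INR (fact (S n))) * z ^ S n)%C).
    { intros s. rewrite Cpow_mult_l, <- RtoC_pow. unfold Rdiv. rewrite RtoC_mult. ring. }
    assert (E' : (z * (RtoC (/ INR (fact n)) * (RtoC t * z) ^ n))%C
                 = (RtoC (t ^ n / INR (fact n)) * z ^ S n)%C).
    { rewrite Cpow_mult_l, <- RtoC_pow, Cpow_S. unfold Rdiv. rewrite RtoC_mult. ring. }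
    assert (F : INR (fact (S n)) = (INR n + 1) * INR (fact n)).
    { rewrite fact_simpl, mult_INR, S_INR. reflexivity. }
    assert (F0 := INR_fact_neq_0 n). assert (F1 := pos_INR n).
    assert (D : is_derive (fun s => s ^ S n / INR (fact (S n))) t (t ^ n / INR (fact n))).
    { rewrite F. clear -F0 F1. generalize dependent (INR (fact n)). intros G G0. rewrite <- S_INR.
      assert (INR (S n) <> 0) by (rewrite S_INR; lra).
      auto_derive; auto. cbn [pred]. field. auto. }
    split.
    + apply is_derive_ext with
        (fun s => Re (Cexp_taylor (S n) (RtoC s * z)) + Re (z ^ S n)%C * (s ^ S n / INR (fact (S n)))).
      { intros s. change (Cexp_taylor (S (S n)) (RtoC s * z))
          with (Cexp_taylor (S n) (RtoC s * z) + RtoC (/ INR (fact (S n))) * (RtoC s * z) ^ S n)%C.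
        rewrite E. eqR. destruct (Cexp_taylor (S n) (RtoC s * z)), (z ^ S n)%C; cparts; ring. }
      change (Cexp_taylor (S n) (RtoC t * z))
          with (Cexp_taylor n (RtoC t * z) + RtoC (/ INR (fact n)) * (RtoC t * z) ^ n)%C.
      rewrite Cmult_plus_distr_l, E'.
      match goal with |- is_derive _ _ ?l => replace l with (Re (z * Cexp_taylor n (RtoC t * z))%C + Re (z ^ S n)%C * (t ^ n / INR (fact n)))
        by (destruct (z * Cexp_taylor n (RtoC t * z))%C, (z ^ S n)%C; cparts; ring) end.
      apply (is_derive_plus (K := R_AbsRing) (V := R_NormedModule)); [exact IH1|].
      apply is_derive_scal, D.
    + apply is_derive_ext with
        (fun s => Im (Cexp_taylor (S n) (RtoC s * z)) + Im (z ^ S n)%C * (s ^ S n / INR (fact (S n)))).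
      { intros s. change (Cexp_taylor (S (S n)) (RtoC s * z))
          with (Cexp_taylor (S n) (RtoC s * z) + RtoC (/ INR (fact (S n))) * (RtoC s * z) ^ S n)%C.
        rewrite E. eqR. destruct (Cexp_taylor (S n) (RtoC s * z)), (z ^ S n)%C; cparts; ring. }
      change (Cexp_taylor (S n) (RtoC t * z))
          with (Cexp_taylor n (RtoC t * z) + RtoC (/ INR (fact n)) * (RtoC t * z) ^ n)%C.
      rewrite Cmult_plus_distr_l, E'.
      match goal with |- is_derive _ _ ?l => replace l with (Im (z * Cexp_taylor n (RtoC t * z))%C + Im (z ^ S n)%C * (t ^ n / INR (fact n)))
        by (destruct (z * Cexp_taylor n (RtoC t * z))%C, (z ^ S n)%C; cparts; ring) end.
      apply (is_derive_plus (K := R_AbsRing) (V := R_NormedModule)); [exact IH2|].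
      apply is_derive_scal, D.
Qed.

Lemma Cexp_taylor_0 (N : nat) : Cexp_taylor (S N) (RtoC 0) = RtoC 1.
Proof.
  induction N as [|N IH].
  - simpl. rewrite Rinv_1. ring.
  - change (Cexp_taylor (S N) (RtoC 0) + RtoC (/ INR (fact (S N))) * RtoC 0 ^ S N = RtoC 1)%C.
    rewrite IH, Cpow_S. ring.
Qed.

(** Along the segment t z, the derivative of the remainder of order N+1 is z times the remainder of
    order N. The majorant (t|z|)^{N+1}/(N+1)! e^{t|z|} has as derivative the inductive bound times
    |z|, plus a nonnegative term, so [Cmean_value] applies. *)
Lemma Cexp_taylor_bound (N : nat) (z : C) :
  Cmod (Cexp z - Cexp_taylor N z)%C <= Cmod z ^ N / INR (fact N) * exp (Cmod z).
Proof.
  revert z. induction N as [|N IH]; intros z.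
  - simpl Cexp_taylor. replace (Cexp z - RtoC 0)%C with (Cexp z) by ring.
    rewrite Cmod_Cexp. simpl. replace (1 / 1 * exp (Cmod z)) with (exp (Cmod z)) by field.
    assert (H := re_le_Cmod z). assert (H' := Rle_abs (Re z)).
    destruct (Rle_lt_or_eq_dec (Re z) (Cmod z)) as [H1|H1]; [lra| |].
    + left; apply exp_increasing; lra.
    + rewrite H1; lra.
  - set (h := fun t : R => (Cexp (RtoC t * z) - Cexp_taylor (S N) (RtoC t * z))%C).
    set (h' := fun t : R => (z * (Cexp (RtoC t * z) - Cexp_taylor N (RtoC t * z)))%C).
    set (g := fun t : R => (t * Cmod z) ^ S N / INR (fact (S N)) * exp (t * Cmod z)).
    set (g' := fun t : R => Cmod z * ((t * Cmod z) ^ N / INR (fact N) * exp (t * Cmod z))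
         + Cmod z * ((t * Cmod z) ^ S N / INR (fact (S N)) * exp (t * Cmod z))).
    assert (F : INR (fact (S N)) = (INR N + 1) * INR (fact N)).
    { rewrite fact_simpl, mult_INR, S_INR. reflexivity. }
    assert (F0 := INR_fact_lt_0 N). assert (F1 := pos_INR N). assert (Z0 := Cmod_ge_0 z).
    replace (Cexp z - Cexp_taylor (S N) z)%C with (h 1 - h 0)%C.
    2:{ unfold h. rewrite Cmult_1_l, Cmult_0_l, Cexp_0, Cexp_taylor_0. ring. }
    replace (_ * _) with (g 1 - g 0).
    2:{ unfold g. rewrite Rmult_1_l, Rmult_0_l, pow_i by lia. unfold Rdiv. ring. }
    apply Cmean_value with h' g'.
    + intros t _. destruct (Cder_taylor z N t) as [D1 D2].
      split.
      * apply is_derive_ext with (fun s => exp (s * Re z) * cos (s * Im z) - Re (Cexp_taylor (S N) (RtoC s * z))).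
        { intros s. unfold h. destruct z as [x y]. unfold Cexp, Cminus, Cplus, Copp, Cmult, RtoC, Re, Im; cbn [fst snd].
          rewrite !Rmult_0_l, Rminus_0_r, Rplus_0_r. reflexivity. }
        unfold h'. match goal with |- is_derive _ _ ?l => replace l with
          (Re (z * Cexp (RtoC t * z))%C - Re (z * Cexp_taylor N (RtoC t * z))%C)
          by (destruct z, (Cexp_taylor N (RtoC t * _)), (Cexp (RtoC t * _)); cparts; ring) end.
        apply (is_derive_minus (K := R_AbsRing) (V := R_NormedModule)); [|exact D1].
        destruct z as [x y]; simpl. auto_derive; auto.
        rewrite !Rmult_0_l, Rminus_0_r, Rplus_0_r. ring.
      * apply is_derive_ext with (fun s => exp (s * Re z) * sin (s * Im z) - Im (Cexp_taylor (S N) (RtoC s * z))).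
        { intros s. unfold h. destruct z as [x y]. unfold Cexp, Cminus, Cplus, Copp, Cmult, RtoC, Re, Im; cbn [fst snd].
          rewrite !Rmult_0_l, Rminus_0_r, Rplus_0_r. reflexivity. }
        unfold h'. match goal with |- is_derive _ _ ?l => replace l with
          (Im (z * Cexp (RtoC t * z))%C - Im (z * Cexp_taylor N (RtoC t * z))%C)
          by (destruct z, (Cexp_taylor N (RtoC t * _)), (Cexp (RtoC t * _)); cparts; ring) end.
        apply (is_derive_minus (K := R_AbsRing) (V := R_NormedModule)); [|exact D2].
        destruct z as [x y]; simpl. auto_derive; auto.
        rewrite !Rmult_0_l, Rminus_0_r, Rplus_0_r. ring.
    + intros t _. unfold g, g'. rewrite F. clear -F0 F1. generalize dependent (INR (fact N)).
      intros G G0. rewrite <- S_INR. assert (INR (S N) <> 0) by (rewrite S_INR; lra).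
      auto_derive; auto. cbn [pred pow].
      change (match N with 0%nat => 1 | S _ => INR N + 1 end) with (INR (S N)). field. lra.
    + intros t Ht. unfold h', g'. rewrite Cmod_mult.
      specialize (IH (RtoC t * z)%C). rewrite Cmod_mult, Cmod_R, Rabs_pos_eq in IH by lra.
      assert (0 <= Cmod z * ((t * Cmod z) ^ S N / INR (fact (S N)) * exp (t * Cmod z))).
      { apply Rmult_le_pos; auto. apply Rmult_le_pos; [|left; apply exp_pos].
        apply Rmult_le_pos; [apply pow_le; nra|]. left. apply Rinv_0_lt_compat, INR_fact_lt_0. }
      assert (Cmod z * Cmod (Cexp (RtoC t * z) - Cexp_taylor N (RtoC t * z))%C
        <= Cmod z * ((t * Cmod z) ^ N / INR (fact N) * exp (t * Cmod z))) by (apply Rmult_le_compat_l; auto).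
      lra.
Qed.

Lemma Cexp_minus_1_bound (z : C) : Cmod (Cexp z - RtoC 1)%C <= Cmod z * exp (Cmod z).
Proof.
  assert (H := Cexp_taylor_bound 1 z). simpl in H.
  replace (Cexp z - RtoC 1)%C with (Cexp z - (RtoC 0 + RtoC (/ 1) * RtoC 1))%C.
  2:{ rewrite Rinv_1. ring. }
  replace (Cmod z * exp (Cmod z)) with (Cmod z * 1 / 1 * exp (Cmod z)) by field. exact H.
Qed.

(** Half-open, against the closed [sum_n]; hence the shift [S n] wherever the two are compared. *)
Fixpoint csum (f : nat -> C) (n : nat) : C :=
  match n with O => RtoC 0 | S k => (csum f k + f k)%C end.

Lemma csum_ext (f g : nat -> C) (n : nat) :
  (forall k, (k < n)%nat -> f k = g k) -> csum f n = csum g n.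
Proof.
  induction n as [|n IH]; intros H; [reflexivity|]. simpl. rewrite IH, H; auto.
Qed.

Lemma csum_plus (f g : nat -> C) (n : nat) :
  csum (fun k => f k + g k)%C n = (csum f n + csum g n)%C.
Proof. induction n as [|n IH]; simpl; [ring|]. rewrite IH. ring. Qed.

Lemma csum_scal (a : C) (f : nat -> C) (n : nat) :
  csum (fun k => a * f k)%C n = (a * csum f n)%C.
Proof. induction n as [|n IH]; simpl; [ring|]. rewrite IH. ring. Qed.

Lemma csum_S_l (f : nat -> C) (n : nat) :
  csum f (S n) = (f O + csum (fun k => f (S k)) n)%C.
Proof.
  induction n as [|n IH]; [simpl; ring|].
  change (csum f (S (S n))) with (csum f (S n) + f (S n))%C. rewrite IH. simpl. ring.
Qed.

Lemma csum_bound (f : nat -> C) (B : R) (n : nat) :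
  (forall k, (k < n)%nat -> Cmod (f k) <= B) -> Cmod (csum f n) <= INR n * B.
Proof.
  induction n as [|n IH]; intros H.
  - simpl. rewrite Cmod_0. lra.
  - rewrite S_INR. simpl. eapply Rle_trans; [apply Cmod_triangle|].
    assert (Cmod (csum f n) <= INR n * B) by (apply IH; auto).
    assert (Cmod (f n) <= B) by (apply H; auto). lra.
Qed.

Lemma Cmod_minus_sym (a b : C) : Cmod (a - b)%C = Cmod (b - a)%C.
Proof. rewrite <- Cmod_opp. f_equal. ring. Qed.

Lemma Cmod_minus_triangle (a b : C) : Cmod (a - b)%C <= Cmod a + Cmod b.
Proof.
  unfold Cminus. eapply Rle_trans; [apply Cmod_triangle|]. rewrite Cmod_opp. lra.
Qed.

(** The telescoped sum is x^n - 1, of modulus at most 2: a frequency other than the tested one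
    contributes a bounded amount, which averaging over n points destroys. *)
Lemma csum_geometric_bound (x : C) (n : nat) :
  Cmod x = 1 -> x <> RtoC 1 -> Cmod (csum (fun k => x ^ k)%C n) <= 2 / Cmod (x - RtoC 1)%C.
Proof.
  intros H1 Hx.
  assert (E : ((x - RtoC 1) * csum (fun k => x ^ k) n = x ^ n - RtoC 1)%C).
  { clear. induction n as [|n IH]; [simpl; ring|]. simpl csum.
    rewrite Cmult_plus_distr_l, IH, Cpow_S. ring. }
  assert (P : 0 < Cmod (x - RtoC 1)%C).
  { apply Cmod_gt_0. intros E0. apply Hx. replace x with (x - RtoC 1 + RtoC 1)%C by ring.
    rewrite E0. ring. }
  apply Rmult_le_reg_l with (Cmod (x - RtoC 1)%C); [exact P|].
  rewrite <- Cmod_mult, E.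
  replace (_ * (2 / _)) with 2 by (field; lra).
  eapply Rle_trans; [apply Cmod_minus_triangle|].
  rewrite Cmod_pow, H1, pow1, Cmod_1. lra.
Qed.

(** The coefficients stay anonymous because [esum_pow] counts terms and tracks exponents only. Their
    vanishing beyond n lets Pascal's rule be applied uniformly at the last index. *)
Lemma Cbinomial (n : nat) : exists c : nat -> R,
  (forall k, (n < k)%nat -> c k = 0) /\
  forall A B : C, ((A + B) ^ n = csum (fun k => RtoC (c k) * A ^ k * B ^ (n - k)) (S n))%C.
Proof.
  induction n as [|n [c [Hc IH]]].
  - exists (fun k => match k with O => 1 | _ => 0 end). split.
    + intros [|k] H; [lia|reflexivity].
    + intros A B. simpl. ring.
  - exists (fun k => match k with O => c O | S j => c j + c (S j) end). split.
    + intros [|k] H; [lia|]. rewrite !Hc by lia. ring.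
    + intros A B. rewrite Cpow_S, IH, Cmult_plus_distr_r.
      rewrite (csum_S_l _ (S n)).
      transitivity ((RtoC (c O) * A ^ 0 * B ^ (S n - 0)) +
        (csum (fun k => A * (RtoC (c k) * A ^ k * B ^ (n - k))) (S n) +
         csum (fun k => RtoC (c (S k)) * A ^ (S k) * B ^ (S n - S k)) (S n)))%C.
      2:{ rewrite <- csum_plus. f_equal. apply csum_ext. intros k Hk.
          rewrite RtoC_plus. replace (S n - S k)%nat with (n - k)%nat by lia.
          rewrite Cpow_S. ring. }
      rewrite <- !csum_scal.
      assert (E : csum (fun k => B * (RtoC (c k) * A ^ k * B ^ (n - k)))%C (S n) =
        (RtoC (c O) * A ^ 0 * B ^ (S n - 0) +
         csum (fun k => RtoC (c (S k)) * A ^ (S k) * B ^ (S n - S k)) (S n))%C).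
      { rewrite csum_S_l.
        set (g := (fun k => RtoC (c (S k)) * A ^ (S k) * B ^ (S n - S k))%C).
        change (csum g (S n)) with (csum g n + g n)%C.
        assert (G0 : g n = RtoC 0) by (unfold g; rewrite (Hc (S n)) by lia; ring).
        rewrite G0, <- (csum_ext (fun k => B * (RtoC (c (S k)) * A ^ S k * B ^ (n - S k)))%C g).
        - rewrite !Nat.sub_0_r, Cpow_S. ring.
        - intros k Hk. unfold g. replace (S n - S k)%nat with (S (n - S k)) by lia.
          rewrite (Cpow_S B). ring. }
      rewrite E. ring.
Qed.

(** * Finite exponential sums *)

Definition esum (l : list (C * R)) (z : C) : C :=
  fold_right (fun p acc => fst p * Cexp (RtoC (snd p) * z) + acc)%C (RtoC 0) l.

Lemma esum_cons (p : C * R) (l : list (C * R)) (z : C) :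
  esum (p :: l) z = (fst p * Cexp (RtoC (snd p) * z) + esum l z)%C.
Proof. reflexivity. Qed.

Lemma esum_app (l l' : list (C * R)) (z : C) :
  esum (l ++ l') z = (esum l z + esum l' z)%C.
Proof.
  induction l as [|p l IH]; [simpl; ring|].
  simpl app. rewrite !esum_cons, IH. ring.
Qed.

Definition emul (l l' : list (C * R)) : list (C * R) :=
  flat_map (fun p => map (fun q => ((fst p * fst q)%C, snd p + snd q)) l') l.

Lemma esum_emul (l l' : list (C * R)) (z : C) :
  esum (emul l l') z = (esum l z * esum l' z)%C.
Proof.
  induction l as [|p l IH]; [simpl; ring|].
  unfold emul; simpl flat_map. fold (emul l l'). rewrite esum_app, IH, esum_cons.
  rewrite Cmult_plus_distr_r. f_equal. clear.
  induction l' as [|q l' IH']; [simpl; ring|].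
  simpl map. rewrite !esum_cons, IH'. simpl fst; simpl snd.
  rewrite RtoC_plus, Cmult_plus_distr_r, Cexp_plus. ring.
Qed.

Lemma length_emul (l l' : list (C * R)) : length (emul l l') = (length l * length l')%nat.
Proof.
  induction l as [|p l IH]; [reflexivity|].
  unfold emul; simpl flat_map. fold (emul l l').
  rewrite length_app, length_map, IH. reflexivity.
Qed.

Lemma in_emul (l l' : list (C * R)) (p : C * R) :
  In p (emul l l') -> exists q q', In q l /\ In q' l' /\ snd p = snd q + snd q'.
Proof.
  unfold emul. rewrite in_flat_map. intros [q [Hq H]].
  apply in_map_iff in H. destruct H as [q' [E Hq']].
  exists q, q'. subst p. auto.
Qed.

Definition exponent_gt (p q : C * R) : Prop := snd q < snd p.

(** Insertion by decreasing exponent, merging equal exponents and dropping a merged term whose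
    coefficient vanishes; the head of the result is then a true dominant term. Length and exponents
    are tracked because upper bounds on both must survive normalization. *)
Lemma esum_insert (a : C * R) (l : list (C * R)) :
  StronglySorted exponent_gt l -> Forall (fun p => fst p <> RtoC 0) l ->
  exists l', StronglySorted exponent_gt l' /\ Forall (fun p => fst p <> RtoC 0) l' /\
    (length l' <= S (length l))%nat /\
    (forall p, In p l' -> exists q, In q (a :: l) /\ snd p = snd q) /\
    forall z, esum l' z = esum (a :: l) z.
Proof.
  intros Hs Hn.
  destruct (classic (fst a = RtoC 0)) as [A0|A0].
  { exists l. split; [exact Hs|]. split; [exact Hn|]. split; [lia|]. split.
    - intros p Hp. exists p. simpl; auto.
    - intros z. rewrite esum_cons, A0. ring. }
  induction l as [|b l IH].
  { exists (a :: nil). repeat split.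
    - constructor; constructor.
    - constructor; auto.
    - simpl; lia.
    - intros p Hp. exists p; auto. }
  inversion Hs as [|? ? Hs1 Hs2]; subst. inversion Hn as [|? ? Hn1 Hn2]; subst.
  destruct (Rtotal_order (snd a) (snd b)) as [Hab|[Hab|Hab]].
  - destruct (IH Hs1 Hn2) as [l' [S' [N' [L' [I' E']]]]].
    exists (b :: l'). split; [|split; [|split; [|split]]].
    + constructor; [exact S'|]. apply Forall_forall. intros p Hp.
      destruct (I' p Hp) as [q [[Hq|Hq] E]]; unfold exponent_gt; rewrite E.
      * subst q; exact Hab.
      * rewrite Forall_forall in Hs2. apply Hs2, Hq.
    + constructor; auto.
    + simpl; lia.
    + intros p [Hp|Hp]; [exists p; subst; simpl; auto|].
      destruct (I' p Hp) as [q [[Hq|Hq] E]]; exists q; simpl; auto.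
    + intros z. rewrite esum_cons, E', !esum_cons. ring.
  - destruct (classic ((fst a + fst b)%C = RtoC 0)) as [S0|S0].
    + exists l. split; [exact Hs1|]. split; [exact Hn2|]. split; [simpl; lia|]. split.
      * intros p Hp. exists p; simpl; auto.
      * intros z. rewrite !esum_cons, Hab.
        transitivity ((fst a + fst b) * Cexp (RtoC (snd b) * z) + esum l z)%C; [|ring].
        rewrite S0. ring.
    + exists (((fst a + fst b)%C, snd b) :: l). split; [|split; [|split; [|split]]].
      * constructor; auto.
      * constructor; auto.
      * simpl; lia.
      * intros p [Hp|Hp]; [exists b; subst; simpl; auto|exists p; simpl; auto].
      * intros z. rewrite !esum_cons, Hab. simpl fst; simpl snd. ring.
  - exists (a :: b :: l). split; [|split; [|split; [|split]]].
    + constructor; [exact Hs|]. constructor; [exact Hab|].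
      rewrite Forall_forall in *. intros p Hp. specialize (Hs2 p Hp).
      unfold exponent_gt in *. lra.
    + constructor; auto.
    + simpl; lia.
    + intros p Hp. exists p; auto.
    + reflexivity.
Qed.

Lemma esum_normal_form (l : list (C * R)) :
  exists l', StronglySorted exponent_gt l' /\ Forall (fun p => fst p <> RtoC 0) l' /\
    (length l' <= length l)%nat /\
    (forall p, In p l' -> exists q, In q l /\ snd p = snd q) /\
    forall z, esum l' z = esum l z.
Proof.
  induction l as [|a l [l' [S' [N' [L' [I' E']]]]]].
  { exists nil. repeat split; auto; try constructor. intros p []. }
  destruct (esum_insert a l' S' N') as [l2 [S2 [N2 [L2 [I2 E2]]]]].
  exists l2. split; [exact S2|]. split; [exact N2|]. split; [simpl; lia|]. split.
  - intros p Hp. destruct (I2 p Hp) as [q [[Hq|Hq] E]]; [exists q; simpl; auto|].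
    destruct (I' q Hq) as [q' [Hq' Eq]]. exists q'. rewrite E. simpl; auto.
  - intros z. rewrite E2, !esum_cons, E'. reflexivity.
Qed.

(** Peeling off one term at a time by the binomial formula leaves at most n+1 choices of power per
    term. For a fixed list the count is thus polynomial in n, which is what the argument by n-th
    powers in [esum_decay] can afford. *)
Lemma esum_pow (l : list (C * R)) (n : nat) :
  exists l', (forall z, esum l' z = (esum l z ^ n)%C) /\
    (length l' <= (n + 1) ^ length l)%nat /\
    forall M, (forall p, In p l -> snd p <= - M) ->
      forall p, In p l' -> snd p <= - (INR n * M).
Proof.
  revert n. induction l as [|a l IH]; intros n.
  - destruct n as [|n].
    + exists ((RtoC 1, 0) :: nil). split; [|split].
      * intros z. simpl. rewrite Cmult_0_l, Cexp_0. ring.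
      * simpl; lia.
      * intros M _ p [Hp|[]]. subst p. simpl. lra.
    + exists nil. split; [|split].
      * intros z. simpl. ring.
      * simpl; lia.
      * intros M _ p [].
  - destruct (Cbinomial n) as [c [_ Hc]].
    assert (Hk : forall k, (k <= S n)%nat -> exists l',
      (forall z, esum l' z = csum (fun j => RtoC (c j) * (fst a * Cexp (RtoC (snd a) * z)) ^ j * esum l z ^ (n - j)) k)%C /\
      (length l' <= k * (n + 1) ^ length l)%nat /\
      forall M, (forall p, In p (a :: l) -> snd p <= - M) ->
        forall p, In p l' -> snd p <= - (INR n * M)).
    { induction k as [|k IHk]; intros Hk.
      - exists nil. split; [reflexivity|split; [simpl; lia|intros M _ p []]].
      - destruct IHk as [l1 [E1 [L1 I1]]]; [lia|].
        destruct (IH (n - k)%nat) as [l2 [E2 [L2 I2]]].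
        exists (l1 ++ emul (((RtoC (c k) * fst a ^ k)%C, INR k * snd a) :: nil) l2).
        split; [|split].
        + intros z. rewrite esum_app, esum_emul, E1, E2. simpl csum. f_equal. simpl esum.
          rewrite Cpow_mult_l, Cexp_pow.
          replace (RtoC (INR k * snd a) * z)%C with (RtoC (INR k) * (RtoC (snd a) * z))%C
            by (rewrite RtoC_mult; ring). ring.
        + rewrite length_app, length_emul. simpl length.
          assert ((n - k + 1) ^ length l <= (n + 1) ^ length l)%nat
            by (apply Nat.pow_le_mono_l; lia). simpl. lia.
        + intros M HM p Hp. apply in_app_iff in Hp. destruct Hp as [Hp|Hp]; [apply I1; auto|].
          apply in_emul in Hp. destruct Hp as [q [q' [[Hq|[]] [Hq' E]]]]. subst q. simpl in E.
          assert (H1 : snd a <= - M) by (apply HM; simpl; auto).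
          assert (H2 : snd q' <= - (INR (n - k) * M)).
          { apply I2; auto. intros p' Hp'. apply HM; simpl; auto. }
          rewrite minus_INR in H2 by lia. assert (P := pos_INR k).
          assert (INR k * snd a <= INR k * - M) by (apply Rmult_le_compat_l; auto).
          lra. }
    destruct (Hk (S n)) as [l' [E [L I]]]; [lia|].
    exists l'. split; [|split; [|exact I]].
    + intros z. rewrite E, esum_cons, Hc. reflexivity.
    + simpl. replace (n + 1)%nat with (S n) in * by lia. exact L.
Qed.

Definition coef_at (l : list (C * R)) (theta : R) : C :=
  fold_right (fun p acc => if Req_EM_T (snd p) theta then (fst p + acc)%C else acc) (RtoC 0) l.

Lemma coef_at_above (l : list (C * R)) (theta : R) :
  Forall (fun p => snd p < theta) l -> coef_at l theta = RtoC 0.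
Proof.
  induction 1 as [|p l Hp Hl IH]; [reflexivity|]. simpl.
  destruct (Req_EM_T (snd p) theta); [lra|exact IH].
Qed.

Lemma coef_at_sorted (l : list (C * R)) (p : C * R) :
  StronglySorted exponent_gt l -> In p l -> coef_at l (snd p) = fst p.
Proof.
  induction 1 as [|q l Hs IH Hq]; intros Hp; [destruct Hp|].
  destruct Hp as [<-|Hp]; simpl.
  - destruct (Req_EM_T (snd q) (snd q)); [|lra].
    rewrite coef_at_above; [ring|exact Hq].
  - rewrite Forall_forall in Hq. specialize (Hq p Hp). unfold exponent_gt in Hq.
    destruct (Req_EM_T (snd q) (snd p)); [lra|auto].
Qed.

(** The bound 1 stays below [PI], so the imaginary part sin u does not vanish. *)
Lemma Cexp_imaginary_neq_1 (u : R) : u <> 0 -> Rabs u <= 1 -> Cexp (0, u) <> RtoC 1.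
Proof.
  intros H0 H1 E. apply (f_equal snd) in E. simpl in E. rewrite exp_0, Rmult_1_l in E.
  assert (P := PI2_1). apply Rabs_le_between in H1.
  destruct (Rtotal_order u 0) as [H|[H|H]]; [|lra|].
  - assert (0 < sin (- u)) by (apply sin_gt_0; lra). rewrite sin_neg in *. lra.
  - assert (0 < sin u) by (apply sin_gt_0; lra). lra.
Qed.

(* Averaging over an arithmetic progression on a vertical line isolates one frequency. *)
Lemma esum_mean (l : list (C * R)) (theta t0 h : R) :
  0 < h -> (forall p, In p l -> Rabs ((snd p - theta) * h) <= 1) ->
  exists K, forall n,
    Cmod (csum (fun k => esum l (t0, INR k * h)%R * Cexp (RtoC (- theta) * (t0, INR k * h)%R))%C n
      - RtoC (INR n) * coef_at l theta)%C <= K.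
Proof.
  intros Hh. induction l as [|p l IH]; intros H.
  - exists 0. intros n. simpl. rewrite (csum_ext _ (fun _ => RtoC 0 * RtoC 0)%C).
    + rewrite csum_scal, !Cmult_0_l, Cmult_0_r. unfold Cminus. rewrite Copp_0, Cplus_0_l, Cmod_0. lra.
    + intros; ring.
  - destruct IH as [K HK]; [intros q Hq; apply H; simpl; auto|].
    set (d := snd p - theta). set (a := (fst p * Cexp (RtoC (d * t0)))%C).
    set (x := Cexp (0, d * h)).
    assert (E : forall n, csum (fun k => esum (p :: l) (t0, INR k * h)%R * Cexp (RtoC (- theta) * (t0, INR k * h)%R))%C n
      = (a * csum (fun k => x ^ k) n + csum (fun k => esum l (t0, INR k * h)%R * Cexp (RtoC (- theta) * (t0, INR k * h)%R)) n)%C).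
    { intros n. rewrite <- csum_scal, <- csum_plus. apply csum_ext. intros k _.
      rewrite esum_cons, Cmult_plus_distr_r. f_equal.
      unfold a, x. rewrite Cexp_pow, <- !Cmult_assoc, <- !Cexp_plus. f_equal. f_equal.
      unfold d. cparts. f_equal; ring. }
    destruct (Req_EM_T (snd p) theta) as [T|T].
    + exists K. intros n. rewrite E. simpl coef_at. destruct (Req_EM_T (snd p) theta); [|lra].
      replace (csum (fun k => x ^ k)%C n) with (RtoC (INR n)).
      * unfold a, d. replace ((snd p - theta) * t0) with 0 by (rewrite T; ring).
        rewrite Cexp_0. eapply Rle_trans; [|apply (HK n)]. right. f_equal. ring.
      * unfold x, d. replace ((snd p - theta) * h) with 0 by (rewrite T; ring).
        change (Cexp (0, 0)) with (Cexp (RtoC 0)). rewrite Cexp_0.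
        clear. induction n as [|n IH]; [reflexivity|]. simpl csum. rewrite <- IH, S_INR, RtoC_plus, Cpow_1_l.
        reflexivity.
    + exists (Cmod a * (2 / Cmod (x - RtoC 1)%C) + K). intros n. rewrite E. simpl coef_at.
      destruct (Req_EM_T (snd p) theta); [lra|].
      match goal with |- Cmod (?u + ?v - ?w)%C <= _ =>
        replace (u + v - w)%C with (u + (v - w))%C by ring end.
      eapply Rle_trans; [apply Cmod_triangle|]. rewrite Cmod_mult.
      apply Rplus_le_compat; [|apply HK]. apply Rmult_le_compat_l; [apply Cmod_ge_0|].
      apply csum_geometric_bound.
      * unfold x. rewrite Cmod_Cexp. simpl. apply exp_0.
      * apply Cexp_imaginary_neq_1; [|apply H; simpl; auto].
        unfold d. apply Rmult_integral_contrapositive_currified; lra.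
Qed.

Lemma exponents_bounded (l : list (C * R)) (theta : R) :
  exists D, 0 < D /\ forall p, In p l -> Rabs (snd p - theta) <= D.
Proof.
  induction l as [|p l [D [HD H]]].
  - exists 1. split; [lra|intros p []].
  - exists (D + Rabs (snd p - theta)). assert (P := Rabs_pos (snd p - theta)).
    split; [lra|]. intros q [<-|Hq]; [lra|]. specialize (H q Hq). lra.
Qed.

Lemma Rle_of_scaled_bound (a b K : R) : (forall n, INR n * a <= K + INR n * b) -> a <= b.
Proof.
  intros H. destruct (Rle_or_lt a b) as [L|L]; [exact L|exfalso].
  destruct (INR_unbounded (K / (a - b))) as [n Hn].
  specialize (H n). apply Rmult_gt_compat_l with (r := a - b) in Hn; [|lra].
  replace ((a - b) * (K / (a - b))) with K in Hn by (field; lra). lra.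
Qed.

(** Cauchy's estimate for exponential sums: a coefficient is a mean value of the sum times e^{-theta
    z} on the vertical line. The error K of the sampled sum does not depend on n and disappears
    after division by n. *)
Lemma esum_coef_bound (l : list (C * R)) (theta t0 S : R) :
  (forall s, Cmod (esum l (t0, s)) <= S) ->
  Cmod (coef_at l theta) <= S * exp (- theta * t0).
Proof.
  intros HS. destruct (exponents_bounded l theta) as [D [HD H]].
  (* With step 1/D all frequency differences stay within distance 1 after scaling, so none of them
     aliases with [theta]. *)
  destruct (esum_mean l theta t0 (/ D)) as [K HK].
  - apply Rinv_0_lt_compat, HD.
  - intros p Hp. rewrite Rabs_mult, (Rabs_pos_eq (/ D)) by (left; apply Rinv_0_lt_compat, HD).
    apply Rmult_le_reg_r with D; [exact HD|]. rewrite Rmult_assoc, Rinv_l, !Rmult_1_r, Rmult_1_l by lra. auto.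
  - apply (Rle_of_scaled_bound _ _ K). intros n. specialize (HK n).
    set (U := csum _ n) in HK.
    assert (HU : Cmod U <= INR n * (S * exp (- theta * t0))).
    { apply csum_bound. intros k _. rewrite Cmod_mult, Cmod_Cexp.
      replace (Re _) with (- theta * t0) by (simpl; ring).
      apply Rmult_le_compat_r; [left; apply exp_pos|apply HS]. }
    replace (INR n * Cmod (coef_at l theta)) with (Cmod (RtoC (INR n) * coef_at l theta)%C)
      by (rewrite Cmod_mult, Cmod_R, Rabs_pos_eq; [reflexivity|apply pos_INR]).
    replace (RtoC (INR n) * coef_at l theta)%C with (U - (U - RtoC (INR n) * coef_at l theta))%C by ring.
    eapply Rle_trans; [apply Cmod_minus_triangle|]. lra.
Qed.

(** By [esum_coef_bound] each normalized term at x is at most S e^{theta (x - t0)} with theta <= -M;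
    adding the terms up costs the factor [length l], which [esum_decay] then removes. *)
Lemma esum_decay_count (l : list (C * R)) (M t0 S x : R) :
  (forall p, In p l -> snd p <= - M) -> (forall s, Cmod (esum l (t0, s)) <= S) -> t0 <= x ->
  Cmod (esum l (RtoC x)) <= INR (length l) * (S * exp (- M * (x - t0))).
Proof.
  intros HM HS Hx.
  assert (S0 : 0 <= S) by (eapply Rle_trans; [apply Cmod_ge_0|apply (HS 0)]).
  destruct (esum_normal_form l) as [l' [Hs [_ [L [I E]]]]].
  rewrite <- E.
  assert (B : forall p, In p l' -> Cmod (fst p * Cexp (RtoC (snd p) * RtoC x))%C <= S * exp (- M * (x - t0))).
  { intros p Hp. rewrite <- (coef_at_sorted l' p Hs Hp), Cmod_mult, Cmod_Cexp.
    assert (H := esum_coef_bound l' (snd p) t0 S). destruct (I p Hp) as [q [Hq Eq]].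
    assert (HM' : snd p <= - M) by (rewrite Eq; auto).
    replace (Re _) with (snd p * x) by (simpl; ring).
    apply Rle_trans with (S * exp (- snd p * t0) * exp (snd p * x)).
    - apply Rmult_le_compat_r; [left; apply exp_pos|]. apply H. intros s. rewrite E. apply HS.
    - rewrite Rmult_assoc, <- exp_plus. apply Rmult_le_compat_l; [exact S0|].
      apply exp_mono. nra. }
  apply Rle_trans with (INR (length l') * (S * exp (- M * (x - t0)))).
  - clear - B. induction l' as [|p l' IH].
    + simpl. rewrite Cmod_0. lra.
    + rewrite esum_cons. simpl length. rewrite S_INR.
      eapply Rle_trans; [apply Cmod_triangle|].
      assert (H1 := B p (or_introl eq_refl)).
      assert (H2 : Cmod (esum l' (RtoC x)) <= INR (length l') * (S * exp (- M * (x - t0)))).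
      { apply IH. intros q Hq. apply B; simpl; auto. }
      lra.
  - apply Rmult_le_compat_r; [|apply le_INR, L].
    apply Rmult_le_pos; [exact S0|left; apply exp_pos].
Qed.

Lemma Rle_of_power_bound (a b : R) (J : nat) :
  0 <= b -> (forall n, a ^ n <= INR ((n + 1) ^ J) * b ^ n) -> a <= b.
Proof.
  intros Hb H. destruct (Rle_or_lt a b) as [L|L]; [exact L|exfalso].
  destruct (Rle_lt_or_eq_dec 0 b Hb) as [Hb'|Hb'].
  2:{ specialize (H 1%nat). rewrite !pow_1, <- Hb' in H. lra. }
  set (c := ln (a / b)).
  assert (Hc : 0 < c).
  { unfold c. rewrite <- ln_1. apply ln_increasing; [lra|].
    apply Rmult_lt_reg_r with b; [lra|]. field_simplify; lra. }
  assert (Ea : a = b * exp c).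
  { unfold c. rewrite exp_ln by (apply Rdiv_lt_0_compat; lra). field; lra. }
  destruct (INR_unbounded (2 * INR J / c + 2)) as [m Hm].
  assert (P : 0 <= 2 * INR J / c).
  { apply Rmult_le_pos; [assert (Q := pos_INR J); lra|left; apply Rinv_0_lt_compat, Hc]. }
  assert (Hm1 : (1 <= m)%nat) by (apply INR_le; simpl; lra).
  specialize (H (m * m - 1)%nat).
  replace (m * m - 1 + 1)%nat with (m * m)%nat in H by nia.
  rewrite Ea, Rpow_mult_distr, Rmult_comm in H.
  apply Rmult_le_reg_r in H; [|apply pow_lt, Hb'].
  rewrite pow_INR, mult_INR in H.
  assert (E1 : INR m <= exp (INR m)) by (assert (Q := exp_ineq1_le (INR m)); lra).
  assert (E2 : (INR m * INR m) ^ J <= exp (INR J * (2 * INR m))).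
  { replace (INR J * (2 * INR m)) with (INR m * INR J + INR m * INR J) by ring.
    rewrite exp_plus, Rpow_mult_distr.
    assert (E3 : INR m ^ J <= exp (INR m * INR J)).
    { clear - E1. induction J as [|J IH].
      - simpl. rewrite Rmult_0_r, exp_0. lra.
      - rewrite S_INR, Rmult_plus_distr_l, exp_plus, Rmult_1_r. simpl.
        rewrite Rmult_comm. apply Rmult_le_compat; auto using pos_INR, pow_le. }
    apply Rmult_le_compat; auto using pow_le, pos_INR. }
  assert (E4 : exp c ^ (m * m - 1) = exp (INR (m * m - 1) * c)).
  { clear. generalize (m * m - 1)%nat. induction n as [|n IH].
    - simpl. rewrite Rmult_0_l, exp_0. reflexivity.
    - rewrite S_INR. simpl. rewrite IH, <- exp_plus. f_equal. ring. }
  rewrite E4 in H.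
  assert (E5 : exp (INR (m * m - 1) * c) <= exp (INR J * (2 * INR m))) by lra.
  apply exp_mono_inv in E5. rewrite minus_INR, mult_INR in E5 by nia. simpl INR in E5 at 3.
  assert (E6 : 2 * INR J + 2 * c < INR m * c).
  { apply Rmult_lt_reg_r with (/ c); [apply Rinv_0_lt_compat, Hc|].
    rewrite Rmult_assoc, Rinv_r, Rmult_1_r by lra.
    replace ((2 * INR J + 2 * c) * / c) with (2 * INR J / c + 2) by (field; lra). lra. }
  assert (1 <= INR m) by (apply (le_INR 1), Hm1).
  nra.
Qed.

(* A maximum principle for exponential sums, without complex analysis: the
   bound of [esum_decay_count] applied to [n]-th powers loses only a factor
   polynomial in [n]. *)
Lemma esum_decay (l : list (C * R)) (M t0 S x : R) :
  (forall p, In p l -> snd p <= - M) -> (forall s, Cmod (esum l (t0, s)) <= S) -> t0 <= x ->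
  Cmod (esum l (RtoC x)) <= S * exp (- M * (x - t0)).
Proof.
  intros HM HS Hx.
  assert (S0 : 0 <= S) by (eapply Rle_trans; [apply Cmod_ge_0|apply (HS 0)]).
  assert (SE : 0 <= S * exp (- M * (x - t0))) by (apply Rmult_le_pos; [exact S0|left; apply exp_pos]).
  apply Rle_of_power_bound with (length l); [exact SE|]. intros n.
  destruct (esum_pow l n) as [l' [E [L I]]].
  rewrite <- Cmod_pow, <- E.
  eapply Rle_trans; [apply (esum_decay_count l' (INR n * M) t0 (S ^ n) x); auto|].
  - intros s. rewrite E, Cmod_pow. apply pow_incr. split; [apply Cmod_ge_0|apply HS].
  - replace (S ^ n * exp (- (INR n * M) * (x - t0))) with ((S * exp (- M * (x - t0))) ^ n).
    + apply Rmult_le_compat_r; [apply pow_le, SE|apply le_INR, L].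
    + rewrite Rpow_mult_distr. f_equal. clear. induction n as [|n IH].
      * simpl. replace (- (0 * M) * (x - t0)) with 0 by ring. symmetry. apply exp_0.
      * rewrite S_INR. simpl. rewrite IH, <- exp_plus. f_equal. ring.
Qed.

(** * Properties near infinity and comparison of growth *)

Definition ev (P : R -> Prop) : Prop := exists X, forall x, X <= x -> P x.

Lemma ev_and (P Q : R -> Prop) : ev P -> ev Q -> ev (fun x => P x /\ Q x).
Proof.
  intros [X HX] [Y HY]. exists (Rmax X Y). intros x Hx.
  assert (A := Rmax_l X Y). assert (B := Rmax_r X Y). split; [apply HX|apply HY]; lra.
Qed.

Lemma ev_mono (P Q : R -> Prop) : ev P -> (forall x, P x -> Q x) -> ev Q.
Proof. intros [X HX] H. exists X. intros x Hx. apply H, HX, Hx. Qed.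

Lemma ev_ge (X : R) : ev (fun x => X <= x).
Proof. exists X. auto. Qed.

Lemma ev_scale (P : R -> Prop) (a : R) : 0 < a -> ev P -> ev (fun x => P (a * x)).
Proof.
  intros Ha [X HX]. exists (X / a). intros x Hx. apply HX.
  apply Rmult_le_compat_l with (r := a) in Hx; [|lra].
  replace (a * (X / a)) with X in Hx by (field; lra). exact Hx.
Qed.

Lemma ev_unscale (P : R -> Prop) (a : R) : 0 < a -> ev (fun x => P (a * x)) -> ev P.
Proof.
  intros Ha H. apply (ev_scale _ (/ a)) in H; [|apply Rinv_0_lt_compat, Ha].
  apply (ev_mono _ _ H). intros x Hx. cbv beta in Hx. rewrite <- Rmult_assoc, Rinv_r, Rmult_1_l in Hx; lra || auto.
Qed.

Lemma ev_affine_le_exp (c d a b : R) :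
  0 < c -> 0 < d -> ev (fun x => a * x + b <= c * exp (d * x)).
Proof.
  intros Hc Hd.
  (* Squaring e^{dx/2} >= dx/2 gives the quadratic lower bound k x^2 for c e^{dx}, enough to beat an
     affine function. *)
  set (k := c * (d / 2) ^ 2). assert (Hk : 0 < k) by (apply Rmult_lt_0_compat; [exact Hc|apply pow_lt; lra]).
  exists (1 + (Rabs a + Rabs b) / k). intros x Hx.
  assert (P : 0 <= (Rabs a + Rabs b) / k).
  { apply Rmult_le_pos; [assert (A := Rabs_pos a); assert (B := Rabs_pos b); lra|].
    left; apply Rinv_0_lt_compat, Hk. }
  assert (E : k * x ^ 2 <= c * exp (d * x)).
  { replace (d * x) with (d / 2 * x + d / 2 * x) by field. rewrite exp_plus.
    assert (Q := exp_ineq1_le (d / 2 * x)).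
    assert (0 <= d / 2 * x) by (apply Rmult_le_pos; lra).
    unfold k. rewrite Rmult_assoc. apply Rmult_le_compat_l; [lra|].
    replace ((d / 2) ^ 2 * x ^ 2) with ((d / 2 * x) * (d / 2 * x)) by ring.
    apply Rmult_le_compat; lra. }
  assert (F : Rabs a + Rabs b <= k * x).
  { apply Rmult_le_reg_r with (/ k); [apply Rinv_0_lt_compat, Hk|].
    replace (k * x * / k) with x by (field; lra). unfold Rdiv in Hx. lra. }
  assert (A := Rle_abs a). assert (B := Rle_abs b).
  assert (a * x <= Rabs a * x) by (apply Rmult_le_compat_r; lra).
  assert (Rabs b <= Rabs b * x) by (assert (B' := Rabs_pos b); nra).
  nra.
Qed.

Lemma ev_exp_dominated (e C m1 m2 : R) :
  0 < e -> m1 < m2 -> ev (fun x => C * exp (m1 * x) <= e * exp (m2 * x)).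
Proof.
  intros He Hm. apply (ev_mono _ _ (ev_affine_le_exp e (m2 - m1) 0 C He ltac:(lra))).
  intros x H. replace (m2 * x) with ((m2 - m1) * x + m1 * x) by ring.
  rewrite exp_plus, <- Rmult_assoc. apply Rmult_le_compat_r; [left; apply exp_pos|]. lra.
Qed.

Lemma esum_tail_small (m : R) (l : list (C * R)) (e : R) :
  Forall (fun p => snd p < m) l -> 0 < e ->
  ev (fun x => Cmod (esum l (RtoC x)) <= e * exp (m * x)).
Proof.
  intros H. revert e. induction H as [|p l Hp Hl IH]; intros e He.
  - exists 0. intros x _. simpl. rewrite Cmod_0. apply Rmult_le_pos; [lra|left; apply exp_pos].
  - assert (H1 := ev_exp_dominated (e / 2) (Cmod (fst p)) (snd p) m ltac:(lra) Hp).
    assert (H2 := IH (e / 2) ltac:(lra)).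
    apply (ev_mono _ _ (ev_and _ _ H1 H2)). intros x [A B].
    rewrite esum_cons. eapply Rle_trans; [apply Cmod_triangle|].
    rewrite Cmod_mult, Cmod_Cexp. replace (Re _) with (snd p * x) by (simpl; ring). lra.
Qed.

Lemma Cmod_minus_lower (a b : C) : Cmod a - Cmod b <= Cmod (a - b)%C.
Proof.
  assert (H := Cmod_triangle (a - b)%C b). replace (a - b + b)%C with a in H by ring. lra.
Qed.

Lemma Cmod_plus_lower (a b : C) : Cmod a - Cmod b <= Cmod (a + b)%C.
Proof.
  replace (a + b)%C with (a - - b)%C by ring. rewrite <- (Cmod_opp b). apply Cmod_minus_lower.
Qed.

Lemma esum_bound (l : list (C * R)) :
  exists B L, 0 <= B /\ 0 <= L /\ forall z, 0 <= Re z -> Cmod (esum l z) <= B * exp (L * Re z).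
Proof.
  induction l as [|p l [B [L [HB [HL H]]]]].
  - exists 0, 0. split; [lra|split; [lra|]]. intros z _. simpl. rewrite Cmod_0. lra.
  - exists (Cmod (fst p) + B), (Rmax L (snd p)).
    assert (A1 := Rmax_l L (snd p)). assert (A2 := Rmax_r L (snd p)). assert (A3 := Cmod_ge_0 (fst p)).
    split; [lra|split; [lra|]]. intros z Hz. rewrite esum_cons.
    eapply Rle_trans; [apply Cmod_triangle|]. rewrite Cmod_mult, Cmod_Cexp, Rmult_plus_distr_r.
    replace (Re (RtoC (snd p) * z)%C) with (snd p * Re z) by (destruct z; simpl; ring).
    apply Rplus_le_compat.
    + apply Rmult_le_compat_l; [exact A3|]. apply exp_mono. apply Rmult_le_compat_r; lra.
    + eapply Rle_trans; [apply H, Hz|]. apply Rmult_le_compat_l; [exact HB|].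
      apply exp_mono. apply Rmult_le_compat_r; lra.
Qed.

(** * Functions with an exponential expansion on a half-plane *)

(** [t0] and [B] come before [M]: this uniformity allows [M] to grow at a fixed point in
    [expandable_dichotomy], and every closure lemma has to produce constants free of [M]. *)
Definition expandable (F : C -> C) : Prop :=
  exists t0 B, 0 <= t0 /\ 0 <= B /\ forall M, 0 <= M -> exists l, forall z, t0 <= Re z ->
    Cmod (F z - esum l z)%C <= B * exp (- M * (Re z - t0)).

Definition expandable_with (t0 B : R) (F : C -> C) : Prop :=
  forall M, 0 <= M -> exists l, forall z, t0 <= Re z ->
    Cmod (F z - esum l z)%C <= B * exp (- M * (Re z - t0)).

Lemma expandable_weaken (t0 B t1 B1 : R) (F : C -> C) :
  expandable_with t0 B F -> t0 <= t1 -> B <= B1 -> 0 <= B -> expandable_with t1 B1 F.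
Proof.
  intros H Ht HB HB0 M HM. destruct (H M HM) as [l Hl]. exists l. intros z Hz.
  eapply Rle_trans; [apply Hl; lra|].
  apply Rmult_le_compat; [lra|left; apply exp_pos|exact HB|].
  apply exp_mono. nra.
Qed.

Lemma expandable_bounded (t0 B : R) (F : C -> C) : 0 <= t0 -> 0 <= B -> expandable_with t0 B F ->
  exists B' L, 0 <= B' /\ 0 <= L /\ forall z, t0 <= Re z -> Cmod (F z) <= B' * exp (L * Re z).
Proof.
  intros Ht HB H. destruct (H 0 (Rle_refl 0)) as [l Hl].
  destruct (esum_bound l) as [B1 [L [HB1 [HL H1]]]].
  exists (B + B1), L. split; [lra|split; [exact HL|]]. intros z Hz.
  specialize (Hl z Hz). specialize (H1 z ltac:(lra)).
  assert (T := Cmod_triangle (F z - esum l z)%C (esum l z)).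
  replace (F z - esum l z + esum l z)%C with (F z) in T by ring.
  replace (- 0 * (Re z - t0)) with 0 in Hl by ring. rewrite exp_0 in Hl.
  assert (E : 1 <= exp (L * Re z)).
  { rewrite <- exp_0. apply exp_mono. apply Rmult_le_pos; lra. }
  nra.
Qed.

Lemma expandable_common (F G : C -> C) : expandable F -> expandable G ->
  exists t0 B, 0 <= t0 /\ 0 <= B /\ expandable_with t0 B F /\ expandable_with t0 B G.
Proof.
  intros [t1 [B1 [P1 [Q1 H1]]]] [t2 [B2 [P2 [Q2 H2]]]].
  exists (Rmax t1 t2), (Rmax B1 B2).
  assert (A1 := Rmax_l t1 t2). assert (A2 := Rmax_r t1 t2).
  assert (A3 := Rmax_l B1 B2). assert (A4 := Rmax_r B1 B2).
  split; [lra|split; [lra|split]]; eapply expandable_weaken; eauto.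
Qed.

Lemma expandable_ext (F G : C -> C) (a : R) :
  (forall z, a <= Re z -> F z = G z) -> expandable F -> expandable G.
Proof.
  intros E [t0 [B [P [Q H]]]].
  exists (Rmax t0 a), B. assert (A1 := Rmax_l t0 a). assert (A2 := Rmax_r t0 a).
  split; [lra|split; [exact Q|]]. intros M HM.
  destruct (expandable_weaken t0 B (Rmax t0 a) B F H ltac:(lra) ltac:(lra) Q M HM) as [l Hl].
  exists l. intros z Hz. rewrite <- E by lra. apply Hl, Hz.
Qed.

Lemma expandable_esum (l : list (C * R)) : expandable (esum l).
Proof.
  exists 0, 0. split; [lra|split; [lra|]]. intros M _. exists l. intros z _.
  replace (esum l z - esum l z)%C with (RtoC 0) by ring. rewrite Cmod_0. lra.
Qed.

Lemma expandable_plus (F G : C -> C) : expandable F -> expandable G ->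
  expandable (fun z => F z + G z)%C.
Proof.
  intros HF HG. destruct (expandable_common F G HF HG) as [t0 [B [P [Q [H1 H2]]]]].
  exists t0, (B + B). split; [exact P|split; [lra|]]. intros M HM.
  destruct (H1 M HM) as [l1 E1]. destruct (H2 M HM) as [l2 E2].
  exists (l1 ++ l2). intros z Hz. rewrite esum_app.
  replace (F z + G z - (esum l1 z + esum l2 z))%C
    with ((F z - esum l1 z) + (G z - esum l2 z))%C by ring.
  eapply Rle_trans; [apply Cmod_triangle|]. specialize (E1 z Hz). specialize (E2 z Hz). lra.
Qed.

(** Both factors grow at most like e^{L Re z}, with L fixed by their expansions of accuracy 0.
    Asking accuracy M + L of each factor pays for the growth of the other and leaves a constant that
    does not involve M. *)
Lemma expandable_mult (F G : C -> C) : expandable F -> expandable G ->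
  expandable (fun z => F z * G z)%C.
Proof.
  intros HF HG. destruct (expandable_common F G HF HG) as [t0 [B [P [Q [H1 H2]]]]].
  destruct (expandable_bounded t0 B F P Q H1) as [B1 [L1 [PB1 [PL1 K1]]]].
  destruct (expandable_bounded t0 B G P Q H2) as [B2 [L2 [PB2 [PL2 K2]]]].
  set (L := L1 + L2).
  exists t0, (B * B2 * exp (L2 * t0) + B1 * B * exp (L1 * t0) + B * B).
  assert (X1 := exp_pos (L2 * t0)). assert (X2 := exp_pos (L1 * t0)).
  split; [exact P|split; [|]].
  { assert (0 <= B * B2 * exp (L2 * t0)) by (apply Rmult_le_pos; [apply Rmult_le_pos|]; lra).
    assert (0 <= B1 * B * exp (L1 * t0)) by (apply Rmult_le_pos; [apply Rmult_le_pos|]; lra). nra. }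
  intros M HM.
  destruct (H1 (M + L)) as [l1 E1]; [unfold L; lra|]. destruct (H2 (M + L)) as [l2 E2]; [unfold L; lra|].
  exists (emul l1 l2). intros z Hz. rewrite esum_emul.
  specialize (E1 z Hz). specialize (E2 z Hz). specialize (K1 z Hz). specialize (K2 z Hz).
  replace (F z * G z - esum l1 z * esum l2 z)%C
    with ((F z - esum l1 z) * G z + F z * (G z - esum l2 z)
      - (F z - esum l1 z) * (G z - esum l2 z))%C by ring.
  eapply Rle_trans; [apply Cmod_minus_triangle|].
  eapply Rle_trans; [apply Rplus_le_compat_r, Cmod_triangle|]. rewrite !Cmod_mult.
  set (r := Re z - t0) in *. assert (Hr : 0 <= r) by (unfold r; lra).
  set (D := exp (- M * r)). assert (D0 := exp_pos (- M * r)). fold D in D0.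
  assert (S1 : exp (- (M + L) * r) * exp (L2 * Re z) <= exp (L2 * t0) * D).
  { unfold D. rewrite <- !exp_plus. apply exp_mono. unfold L.
    replace (Re z) with (r + t0) by (unfold r; ring). nra. }
  assert (S2 : exp (- (M + L) * r) * exp (L1 * Re z) <= exp (L1 * t0) * D).
  { unfold D. rewrite <- !exp_plus. apply exp_mono. unfold L.
    replace (Re z) with (r + t0) by (unfold r; ring). nra. }
  assert (S3 : exp (- (M + L) * r) * exp (- (M + L) * r) <= D).
  { unfold D. rewrite <- !exp_plus. apply exp_mono. unfold L. nra. }
  assert (Y := exp_pos (- (M + L) * r)).
  assert (T1 : Cmod (F z - esum l1 z)%C * Cmod (G z) <= B * B2 * (exp (L2 * t0) * D)).
  { eapply Rle_trans; [apply Rmult_le_compat; [apply Cmod_ge_0|apply Cmod_ge_0|exact E1|exact K2]|].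
    replace (B * exp (- (M + L) * r) * (B2 * exp (L2 * Re z)))
      with (B * B2 * (exp (- (M + L) * r) * exp (L2 * Re z))) by ring.
    apply Rmult_le_compat_l; [apply Rmult_le_pos; lra|exact S1]. }
  assert (T2 : Cmod (F z) * Cmod (G z - esum l2 z)%C <= B1 * B * (exp (L1 * t0) * D)).
  { eapply Rle_trans; [apply Rmult_le_compat; [apply Cmod_ge_0|apply Cmod_ge_0|exact K1|exact E2]|].
    replace (B1 * exp (L1 * Re z) * (B * exp (- (M + L) * r)))
      with (B1 * B * (exp (- (M + L) * r) * exp (L1 * Re z))) by ring.
    apply Rmult_le_compat_l; [apply Rmult_le_pos; lra|exact S2]. }
  assert (T3 : Cmod (F z - esum l1 z)%C * Cmod (G z - esum l2 z)%C <= B * B * D).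
  { eapply Rle_trans; [apply Rmult_le_compat; [apply Cmod_ge_0|apply Cmod_ge_0|exact E1|exact E2]|].
    replace (B * exp (- (M + L) * r) * (B * exp (- (M + L) * r)))
      with (B * B * (exp (- (M + L) * r) * exp (- (M + L) * r))) by ring.
    apply Rmult_le_compat_l; [apply Rmult_le_pos; lra|exact S3]. }
  lra.
Qed.

Definition power_like (F : R -> C) : Prop :=
  exists m c1 c2, 0 < c1 /\ 0 < c2 /\
    ev (fun x => c1 * exp (m * x) <= Cmod (F x) /\ Cmod (F x) <= c2 * exp (m * x)).

(* If every expansion has only exponents [<= -M], the exponential sums are
   bounded on the line [Re z = t0] uniformly in [M], and [esum_decay] applies. *)
Lemma expandable_dichotomy (F : C -> C) : expandable F ->
  ev (fun x => F (RtoC x) = RtoC 0) \/ power_like (fun x => F (RtoC x)).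
Proof.
  intros [t0 [B [P [Q H]]]].
  destruct (classic (forall M, 0 <= M -> exists l, (forall p, In p l -> snd p <= - M) /\
    forall z, t0 <= Re z -> Cmod (F z - esum l z)%C <= B * exp (- M * (Re z - t0)))) as [Fl|NF].
  - left. destruct (expandable_bounded t0 B F P Q H) as [B1 [L [PB1 [PL1 K1]]]].
    (* The margin keeps x - t0 positive, so e^{-M(x - t0)} tends to 0 as M grows with x fixed. *)
    exists (t0 + 1). intros x Hx. apply Cmod_eq_0.
    apply Rle_antisym; [|apply Cmod_ge_0].
    set (S := B1 * exp (L * t0) + B).
    assert (HS : 0 <= S) by (unfold S; assert (E := exp_pos (L * t0)); nra).
    assert (G : forall M, 0 <= M -> Cmod (F (RtoC x)) <= (S + B) * exp (- M * (x - t0))).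
    { intros M HM. destruct (Fl M HM) as [l [Hl El]].
      assert (D : Cmod (esum l (RtoC x)) <= S * exp (- M * (x - t0))).
      { apply esum_decay; [exact Hl| |lra]. intros s.
        specialize (El (t0, s) (Rle_refl _)). specialize (K1 (t0, s) (Rle_refl _)). simpl Re in *.
        rewrite Rminus_diag, Rmult_0_r, exp_0, Rmult_1_r in El.
        replace (esum l (t0, s)) with (F (t0, s) - (F (t0, s) - esum l (t0, s)))%C by ring.
        eapply Rle_trans; [apply Cmod_minus_triangle|]. unfold S. lra. }
      specialize (El (RtoC x) ltac:(change (t0 <= x); lra)). simpl Re in El.
      replace (F (RtoC x)) with ((F (RtoC x) - esum l (RtoC x)) + esum l (RtoC x))%C by ring.
      eapply Rle_trans; [apply Cmod_triangle|]. lra. }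
    apply Rnot_lt_le. intros C0.
    assert (C1 : 0 < Cmod (F (RtoC x)) / 2) by lra. assert (C2 : - (x - t0) < 0) by lra.
    destruct (ev_exp_dominated (Cmod (F (RtoC x)) / 2) (S + B) (- (x - t0)) 0 C1 C2)
      as [X HX].
    specialize (HX (Rmax X 0) (Rmax_l _ _)). specialize (G (Rmax X 0) (Rmax_r _ _)).
    rewrite Rmult_0_l, exp_0 in HX.
    replace (- (x - t0) * Rmax X 0) with (- Rmax X 0 * (x - t0)) in HX by ring. lra.
  (* Some accuracy M admits no expansion with all exponents at most -M. The leading exponent of a
     normalized expansion then exceeds -M and dominates both the other terms and the error. *)
  - right. apply not_all_ex_not in NF. destruct NF as [M NF].
    apply imply_to_and in NF. destruct NF as [HM NF].
    destruct (H M HM) as [l0 H0].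
    destruct (esum_normal_form l0) as [l [Hs [Hn [_ [_ E]]]]].
    assert (Hl : forall z, t0 <= Re z -> Cmod (F z - esum l z)%C <= B * exp (- M * (Re z - t0))).
    { intros z Hz. rewrite E. apply H0, Hz. }
    destruct l as [|p l].
    { exfalso. apply NF. exists nil. split; [intros p []|exact Hl]. }
    inversion Hs as [|? ? Hs1 Hs2]; subst. inversion Hn as [|? ? Hn1 Hn2]; subst.
    destruct (Rle_or_lt (snd p) (- M)) as [Hp|Hp].
    { exfalso. apply NF. exists (p :: l). split; [|exact Hl].
      intros q [<-|Hq]; [exact Hp|]. rewrite Forall_forall in Hs2. specialize (Hs2 q Hq).
      unfold exponent_gt in Hs2. lra. }
    assert (C0 : 0 < Cmod (fst p)) by (apply Cmod_gt_0, Hn1).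
    exists (snd p), (Cmod (fst p) / 2), (2 * Cmod (fst p)). split; [lra|split; [lra|]].
    assert (V1 := esum_tail_small (snd p) l (Cmod (fst p) / 4) Hs2 ltac:(lra)).
    assert (V2 := ev_exp_dominated (Cmod (fst p) / 4) (B * exp (M * t0)) (- M) (snd p) ltac:(lra) Hp).
    apply (ev_mono _ _ (ev_and _ _ (ev_ge t0) (ev_and _ _ V1 V2))). intros x [Hx [A1 A2]].
    specialize (Hl (RtoC x) Hx). simpl Re in Hl.
    replace (B * exp (- M * (x - t0))) with (B * exp (M * t0) * exp (- M * x)) in Hl
      by (rewrite Rmult_assoc, <- exp_plus; do 2 f_equal; ring).
    set (R0 := (F (RtoC x) - esum (p :: l) (RtoC x))%C) in *.
    replace (F (RtoC x)) with (fst p * Cexp (RtoC (snd p) * RtoC x) + (esum l (RtoC x) + R0))%C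
      by (unfold R0; rewrite esum_cons; ring).
    assert (Z : Cmod (fst p * Cexp (RtoC (snd p) * RtoC x))%C = Cmod (fst p) * exp (snd p * x)).
    { rewrite Cmod_mult, Cmod_Cexp. do 2 f_equal. simpl; ring. }
    assert (Y := Cmod_triangle (esum l (RtoC x)) R0).
    assert (W : 0 < Cmod (fst p) * exp (snd p * x)) by (apply Rmult_lt_0_compat; [exact C0|apply exp_pos]).
    split.
    + eapply Rle_trans; [|apply Cmod_plus_lower]. rewrite Z. lra.
    + eapply Rle_trans; [apply Cmod_triangle|]. rewrite Z. lra.
Qed.

Lemma pow_div_fact_le_exp (x : R) (n : nat) : 0 <= x -> x ^ n / INR (fact n) <= exp x.
Proof.
  intros Hx. eapply Rle_trans; [|apply (exp_ge_taylor x n Hx)].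
  destruct n as [|n]; [simpl; lra|]. rewrite tech5.
  assert (0 <= sum_f_R0 (fun k => x ^ k / INR (fact k)) n); [|lra].
  apply cond_pos_sum. intros k. apply Rmult_le_pos; [apply pow_le, Hx|].
  left. apply Rinv_0_lt_compat, INR_fact_lt_0.
Qed.

Lemma esum_taylor (l : list (C * R)) (n : nat) :
  exists l', forall z, esum l' z = Cexp_taylor n (esum l z).
Proof.
  induction n as [|n [l1 E1]]; [exists nil; reflexivity|].
  destruct (esum_pow l n) as [l2 [E2 _]].
  exists (l1 ++ emul ((RtoC (/ INR (fact n)), 0) :: nil) l2). intros z.
  rewrite esum_app, esum_emul, E1, E2. simpl. rewrite Cmult_0_l, Cexp_0. ring.
Qed.

(** Since F decays at rate d, its n-th power decays at rate nd, and Taylor polynomials with n >= M/d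
    reach accuracy M. The constant stays free of M because (2B)^n/n! <= e^{2B} for every n. *)
Lemma expandable_Cexp (F : C -> C) (t0 B d : R) :
  0 <= t0 -> 0 <= B -> 0 < d -> expandable_with t0 B F ->
  (forall z, t0 <= Re z -> Cmod (F z) <= B * exp (- d * (Re z - t0))) ->
  expandable (fun z => Cexp (F z)).
Proof.
  intros Ht HB Hd HF Hs.
  exists t0, (exp (2 * B) * exp (2 * B) + exp (2 * B) * (B * exp B)).
  assert (X1 := exp_pos (2 * B)). assert (X2 := exp_pos B).
  assert (X3 : 0 <= B * exp B) by (apply Rmult_le_pos; lra).
  split; [exact Ht|split; [nra|]]. intros M HM.
  (* Accuracy M + d puts the error below e^{-Mr} and below e^{-dr}, so the approximating sum
     inherits the decay of F. *)
  destruct (HF (M + d)) as [l Hl]; [lra|].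
  destruct (INR_unbounded (M / d)) as [n Hn].
  assert (Hn' : M <= INR n * d).
  { apply Rmult_gt_compat_r with (r := d) in Hn; [|exact Hd].
    unfold Rdiv in Hn. rewrite Rmult_assoc, Rinv_l, Rmult_1_r in Hn; lra. }
  destruct (esum_taylor l n) as [l' El']. exists l'. intros z Hz. rewrite El'.
  specialize (Hl z Hz). specialize (Hs z Hz).
  set (r := Re z - t0) in *. assert (Hr : 0 <= r) by (unfold r; lra).
  set (w := esum l z) in *.
  assert (D0 : exp (- d * r) <= 1) by (rewrite <- exp_0; apply exp_mono; nra).
  assert (D1 : exp (- (M + d) * r) <= exp (- M * r)) by (apply exp_mono; nra).
  assert (D2 : exp (- (M + d) * r) <= exp (- d * r)) by (apply exp_mono; nra).
  assert (D3 : exp (- M * r) <= 1) by (rewrite <- exp_0; apply exp_mono; nra).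
  assert (D4 := exp_pos (- M * r)). assert (D5 := exp_pos (- d * r)).
  assert (W : Cmod w <= 2 * B * exp (- d * r)).
  { replace w with (F z - (F z - w))%C by ring.
    eapply Rle_trans; [apply Cmod_minus_triangle|]. nra. }
  assert (W2 : Cmod w <= 2 * B) by nra.
  assert (G : Cmod (F z - w)%C <= B * exp (- M * r)) by nra.
  assert (G2 : Cmod (F z - w)%C <= B) by nra.
  replace (Cexp (F z) - Cexp_taylor n w)%C
    with ((Cexp w - Cexp_taylor n w) + Cexp w * (Cexp (F z - w) - RtoC 1))%C.
  2:{ replace (Cexp (F z)) with (Cexp w * Cexp (F z - w))%C; [ring|].
      rewrite <- Cexp_plus. f_equal. ring. }
  eapply Rle_trans; [apply Cmod_triangle|]. rewrite Cmod_mult, Rmult_plus_distr_r.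
  apply Rplus_le_compat.
  - eapply Rle_trans; [apply Cexp_taylor_bound|].
    rewrite Rmult_assoc, (Rmult_comm (exp (2 * B)) (exp _)), <- Rmult_assoc.
    apply Rmult_le_compat; [| |  |apply exp_mono, W2].
    + apply Rmult_le_pos; [apply pow_le, Cmod_ge_0|]. left. apply Rinv_0_lt_compat, INR_fact_lt_0.
    + left; apply exp_pos.
    + apply Rle_trans with ((2 * B) ^ n / INR (fact n) * exp (- (INR n * d) * r)).
      * replace (exp (- (INR n * d) * r)) with (exp (- d * r) ^ n).
        -- unfold Rdiv. rewrite Rmult_assoc, (Rmult_comm (/ _)), <- Rmult_assoc, <- Rpow_mult_distr.
           apply Rmult_le_compat_r; [left; apply Rinv_0_lt_compat, INR_fact_lt_0|].
           apply pow_incr. split; [apply Cmod_ge_0|exact W].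
        -- clear. induction n as [|n IH].
           ++ simpl. replace (- (0 * d) * r) with 0 by ring. symmetry; apply exp_0.
           ++ rewrite S_INR. simpl. rewrite IH, <- exp_plus. f_equal. ring.
      * apply Rmult_le_compat; [|left; apply exp_pos|apply pow_div_fact_le_exp; lra|apply exp_mono; nra].
        apply Rmult_le_pos; [apply pow_le; lra|]. left. apply Rinv_0_lt_compat, INR_fact_lt_0.
  - rewrite Rmult_assoc. apply Rmult_le_compat; [apply Cmod_ge_0|apply Cmod_ge_0| |].
    + rewrite Cmod_Cexp. apply exp_mono.
      assert (A := Rle_abs (Re w)). assert (A2 := re_le_Cmod w). lra.
    + eapply Rle_trans; [apply Cexp_minus_1_bound|].
      replace (B * exp B * exp (- M * r)) with (B * exp (- M * r) * exp B) by ring.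
      apply Rmult_le_compat; [apply Cmod_ge_0|left; apply exp_pos|exact G|apply exp_mono, G2].
Qed.

Definition esum_of (b mu : nat -> R) (l : list nat) : list (C * R) :=
  map (fun q => (RtoC (b q), mu q)) l.

Lemma sum_n_esum (b mu : nat -> R) (N : nat) (z : C) :
  sum_n (fun q => RtoC (b q) * Cexp (RtoC (mu q) * z))%C N = esum (esum_of b mu (seq 0 (S N))) z.
Proof.
  induction N as [|N IH].
  - rewrite sum_O. simpl. ring.
  - rewrite sum_Sn, IH. rewrite (seq_S (S N)). unfold esum_of. rewrite map_app, esum_app.
    change (plus ?a ?b) with (Cplus a b). simpl. ring.
Qed.

Lemma exponent_sequence_above (c : nat -> R) (K : R) :
  exponent_sequence c -> exists N, (0 < N)%nat /\ forall n, (N <= n)%nat -> K < c n.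
Proof.
  intros [_ [_ H]]. apply is_lim_seq_spec in H. destruct (H K) as [N HN].
  exists (S N). split; [lia|]. intros n Hn. apply HN. lia.
Qed.

Lemma FC0_expandable (phi : C -> C) : FC0 phi -> expandable phi.
Proof.
  intros [b [c [a [Hc [Ha [_ H]]]]]].
  exists a, 1. split; [exact Ha|split; [lra|]]. intros M HM.
  destruct (exponent_sequence_above c M Hc) as [N [HN0 HN]].
  exists (esum_of b (fun q => - c q) (seq 0 (S N))). intros z Hz.
  rewrite <- sum_n_esum, Rmult_1_l.
  set (e := (c (S N) - c N) / 2).
  assert (Hg : c N < c (S N)) by apply Hc.
  eapply Rle_trans; [apply (H z N e Hz HN0); unfold e; lra|].
  apply exp_mono. specialize (HN N (le_n _)). unfold e. nra.
Qed.

Lemma K10_expandable (k : C -> C) : K10 k -> expandable k.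
Proof.
  intros [n [phi [lam [H [a [_ E]]]]]].
  apply (expandable_ext (fun z => sum_n_m (fun i => phi i z * Cexp (RtoC (lam i) * z))%C 1 n) k a).
  { intros z Hz. symmetry. apply E, Hz. }
  clear E. induction n as [|n IH].
  - apply (expandable_ext (esum nil) _ 0); [|apply expandable_esum].
    intros z _. rewrite sum_n_m_zero by lia. reflexivity.
  - apply (expandable_ext (fun z =>
      sum_n_m (fun i => phi i z * Cexp (RtoC (lam i) * z))%C 1 n
      + phi (S n) z * esum ((RtoC 1, lam (S n)) :: nil) z)%C _ 0).
    + intros z _. rewrite sum_n_Sm by lia. change (plus ?a ?b) with (Cplus a b).
      simpl esum. f_equal. ring.
    + apply expandable_plus; [apply IH; intros i Hi; apply H; lia|].
      apply expandable_mult; [apply FC0_expandable, H; lia|apply expandable_esum].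
Qed.

Lemma esum_filter (f : C * R -> bool) (l : list (C * R)) (z : C) :
  esum l z = (esum (filter f l) z + esum (filter (fun p => negb (f p)) l) z)%C.
Proof.
  induction l as [|p l IH]; [simpl; ring|].
  simpl filter. destruct (f p); simpl negb; cbv iota; rewrite !esum_cons, IH; ring.
Qed.

Lemma negative_exponents_gap (l : list (C * R)) :
  (forall p, In p l -> snd p < 0) -> exists d, 0 < d /\ forall p, In p l -> snd p <= - d.
Proof.
  induction l as [|p l IH]; intros H.
  - exists 1. split; [lra|intros p []].
  - destruct IH as [d [Hd Hl]]; [intros q Hq; apply H; simpl; auto|].
    assert (Hp := H p (or_introl eq_refl)).
    exists (Rmin d (- snd p)). assert (A := Rmin_l d (- snd p)). assert (B := Rmin_r d (- snd p)).
    split; [apply Rmin_pos; lra|]. intros q [<-|Hq]; [lra|]. specialize (Hl q Hq). lra.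
Qed.

Lemma esum_bound_negative (l : list (C * R)) (d : R) :
  (forall p, In p l -> snd p <= - d) ->
  exists B, 0 <= B /\ forall z, 0 <= Re z -> Cmod (esum l z) <= B * exp (- d * Re z).
Proof.
  induction l as [|p l IH]; intros H.
  - exists 0. split; [lra|]. intros z _. simpl. rewrite Cmod_0. lra.
  - destruct IH as [B [HB Hl]]; [intros q Hq; apply H; simpl; auto|].
    assert (Hp := H p (or_introl eq_refl)). assert (P := Cmod_ge_0 (fst p)).
    exists (Cmod (fst p) + B). split; [lra|]. intros z Hz. rewrite esum_cons.
    eapply Rle_trans; [apply Cmod_triangle|]. rewrite Cmod_mult, Cmod_Cexp, Rmult_plus_distr_r.
    replace (Re (RtoC (snd p) * z)%C) with (snd p * Re z) by (destruct z; simpl; ring).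
    apply Rplus_le_compat; [|auto].
    apply Rmult_le_compat_l; [exact P|]. apply exp_mono. apply Rmult_le_compat_r; lra.
Qed.

(** * Real exponential sums with positive exponents *)

Definition rsum (l : list (R * R)) (x : R) : R :=
  fold_right (fun p acc => fst p * exp (snd p * x) + acc) 0 l.

Definition complexify (l : list (R * R)) : list (C * R) :=
  map (fun p => (RtoC (fst p), snd p)) l.

Lemma esum_complexify (l : list (R * R)) (x : R) :
  esum (complexify l) (RtoC x) = RtoC (rsum l x).
Proof.
  induction l as [|p l IH]; [reflexivity|].
  unfold complexify; simpl map. fold (complexify l). rewrite esum_cons, IH. simpl fst; simpl snd.
  rewrite <- RtoC_mult, Cexp_RtoC, <- RtoC_mult, <- RtoC_plus. reflexivity.
Qed.

(** As c_q exceeds 1 from some rank on, only finitely many exponents 1 - c_q are positive. They stay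
    in the real exponent; the constant term and the decaying rest are exponentiated into K by
    [expandable_Cexp]. *)
Lemma E1_factorization (e : C -> C) (nu : R) : E1 e nu ->
  exists l K, (forall p, In p l -> 0 < snd p < 1) /\ expandable K /\
    ev (fun x => Cexp (e (RtoC x)) = (K (RtoC x) * RtoC (exp (nu * exp x + rsum l x)))%C).
Proof.
  intros [b [c [a [Hc [Ha [_ H]]]]]].
  destruct (exponent_sequence_above c 1 Hc) as [N0 [HN0 HN]].
  set (mu := fun q => 1 - c q).
  set (L := esum_of b mu (seq 0 (S N0))).
  set (fpos := fun p : C * R => if Rlt_dec 0 (snd p) then true else false).
  set (fneg := fun p : C * R => if Rlt_dec (snd p) 0 then true else false).
  set (fp2 := fun p : C * R => negb (fpos p)).
  set (lneg := filter fneg (filter fp2 L)).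
  set (lzero := filter (fun p => negb (fneg p)) (filter fp2 L)).
  set (lp := map (fun q => (b q, mu q)) (filter (fun q => if Rlt_dec 0 (mu q) then true else false) (seq 0 (S N0)))).
  assert (EL : forall z, esum L z = (esum (complexify lp) z + (esum lneg z + esum lzero z))%C).
  { intros z. rewrite (esum_filter fpos L z). change (fun p => negb (fpos p)) with fp2.
    rewrite (esum_filter fneg (filter fp2 L) z). f_equal. unfold lp, complexify, L, esum_of. rewrite map_map. clear. generalize (seq 0 (S N0)).
    intros l. induction l as [|q l IH]; [reflexivity|]. simpl. unfold fpos at 1. simpl.
    destruct (Rlt_dec 0 (mu q)); simpl; rewrite IH; reflexivity. }
  assert (Ez : forall z, esum lzero z = esum lzero (RtoC 0)).
  { assert (Z : forall p, In p lzero -> snd p = 0).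
    { intros p Hp. apply filter_In in Hp. destruct Hp as [Hp1 Hp2].
      apply filter_In in Hp1. destruct Hp1 as [_ Hp1].
      unfold fneg in Hp2. unfold fp2, fpos in Hp1.
      destruct (Rlt_dec (snd p) 0); [discriminate|]. destruct (Rlt_dec 0 (snd p)); [discriminate|]. lra. }
    intros z. revert Z. clear. generalize lzero. intros l Z. induction l as [|p l IH]; [reflexivity|].
    rewrite !esum_cons, IH by (intros q Hq; apply Z; simpl; auto).
    rewrite (Z p (or_introl eq_refl)), !Cmult_0_l. reflexivity. }
  (* The part of the exponent that tends to 0: the listed terms with negative exponent and the whole
     tail. *)
  set (d1 := fun z => (e z - RtoC nu * Cexp z - (esum (complexify lp) z + esum lzero z))%C).
  assert (HX : expandable_with a 1 d1).
  { intros M HM. destruct (exponent_sequence_above c (1 + M) Hc) as [N1 [_ HN1]].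
    set (N := Nat.max N0 N1).
    exists (lneg ++ esum_of b mu (seq (S N0) (N - N0))). intros z Hz.
    set (ep := (c (S N) - c N) / 2). assert (Hg : c N < c (S N)) by apply Hc.
    assert (HNN : 1 + M < c N) by (apply HN1; unfold N; lia).
    assert (Q := H z N ep Hz ltac:(unfold N; lia) ltac:(unfold ep; lra)).
    change (sum_n _ N) with (sum_n (fun q => RtoC (b q) * Cexp (RtoC (mu q) * z))%C N) in Q.
    rewrite (sum_n_esum b mu N z) in Q.
    replace (seq 0 (S N)) with (seq 0 (S N0) ++ seq (S N0) (N - N0)) in Q.
    2:{ symmetry. change (S N0) with (0 + S N0)%nat at 2. rewrite <- seq_app. f_equal. unfold N. lia. }
    unfold esum_of in Q. rewrite map_app, esum_app in Q. fold (esum_of b mu (seq 0 (S N0))) in Q.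
    fold L in Q. fold (esum_of b mu (seq (S N0) (N - N0))) in Q. rewrite EL in Q.
    rewrite esum_app. unfold d1.
    match type of Q with Cmod ?u <= _ => match goal with |- Cmod ?v <= _ => replace v with u by ring end end.
    eapply Rle_trans; [exact Q|]. rewrite Rmult_1_l. apply exp_mono. unfold halfplane in Hz.
    unfold ep. nra. }
  destruct (negative_exponents_gap lneg) as [d [Hd Hl]].
  { intros p Hp. apply filter_In in Hp. destruct Hp as [_ Hp]. unfold fneg in Hp.
    destruct (Rlt_dec (snd p) 0); [assumption|discriminate]. }
  destruct (esum_bound_negative lneg d Hl) as [B [HB Bl]].
  assert (HS : forall z, a <= Re z -> Cmod (d1 z) <= (1 + B) * exp (- Rmin d (c N0 - 1) * (Re z - a))).
  { intros z Hz. set (ep := (c (S N0) - c N0) / 2). assert (Hg : c N0 < c (S N0)) by apply Hc.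
    assert (Q := H z N0 ep Hz HN0 ltac:(unfold ep; lra)).
    change (sum_n _ N0) with (sum_n (fun q => RtoC (b q) * Cexp (RtoC (mu q) * z))%C N0) in Q.
    rewrite (sum_n_esum b mu N0 z) in Q. fold L in Q. rewrite EL in Q.
    replace (d1 z) with ((d1 z - esum lneg z) + esum lneg z)%C by ring.
    eapply Rle_trans; [apply Cmod_triangle|]. rewrite Rmult_plus_distr_r.
    assert (A1 := Rmin_l d (c N0 - 1)). assert (A2 := Rmin_r d (c N0 - 1)).
    assert (A3 : 0 < Rmin d (c N0 - 1)) by (apply Rmin_pos; [exact Hd|specialize (HN N0 (le_n _)); lra]).
    apply Rplus_le_compat.
    - unfold d1. match type of Q with Cmod ?u <= _ => match goal with |- Cmod ?v <= _ => replace v with u by ring end end.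
      eapply Rle_trans; [exact Q|]. rewrite Rmult_1_l. apply exp_mono. unfold ep. nra.
    - eapply Rle_trans; [apply Bl; lra|]. apply Rmult_le_compat_l; [exact HB|]. apply exp_mono. nra. }
  exists lp, (fun z => esum ((Cexp (esum lzero (RtoC 0)), 0) :: nil) z * Cexp (d1 z))%C.
  split; [|split].
  - intros p Hp. apply in_map_iff in Hp. destruct Hp as [q [<- Hq]]. apply filter_In in Hq.
    destruct Hq as [_ Hq]. simpl. destruct (Rlt_dec 0 (mu q)); [|discriminate].
    assert (0 < c q) by apply Hc. unfold mu in *. lra.
  - apply expandable_mult; [apply expandable_esum|].
    apply (expandable_Cexp d1 a (1 + B) (Rmin d (c N0 - 1))); auto; try lra.
    + apply Rmin_pos; [exact Hd|]. specialize (HN N0 (le_n _)). lra.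
    + apply (expandable_weaken a 1); auto; lra.
  - exists a. intros x Hx. unfold d1. rewrite (Ez (RtoC x)), esum_complexify, Cexp_RtoC.
    rewrite <- (Cexp_RtoC (nu * exp x + rsum lp x)). simpl esum. rewrite Cmult_0_l, Cexp_0, Cmult_1_r, Cplus_0_r, <- !Cexp_plus.
    f_equal. rewrite RtoC_plus, RtoC_mult. ring.
Qed.

Lemma rsum_small (m : R) (l : list (R * R)) (e : R) :
  (forall p, In p l -> snd p < m) -> 0 < e -> ev (fun x => Rabs (rsum l x) <= e * exp (m * x)).
Proof.
  intros H He.
  assert (F : Forall (fun p : C * R => snd p < m) (complexify l)).
  { apply Forall_forall. intros p Hp. apply in_map_iff in Hp. destruct Hp as [q [<- Hq]]. simpl. auto. }
  apply (ev_mono _ _ (esum_tail_small m _ e F He)). intros x Hx.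
  rewrite esum_complexify, Cmod_R in Hx. exact Hx.
Qed.

(** Exponents are positive, so a bounded change of p is no label and belongs to the coefficient.
    This makes the gap between distinct labels exponentially large. *)
Definition label (p : R -> R) : Prop :=
  exists l, (forall q, In q l -> 0 < snd q) /\ forall x, p x = rsum l x.

Definition label_gt (p q : R -> R) : Prop :=
  exists c d, 0 < c /\ 0 < d /\ ev (fun x => c * exp (d * x) <= p x - q x).

Lemma label_gt_trans (p q r : R -> R) : label_gt p q -> label_gt q r -> label_gt p r.
Proof.
  intros [c [d [Hc [Hd H]]]] [c' [d' [Hc' [Hd' H']]]].
  exists c, d. split; [exact Hc|split; [exact Hd|]].
  apply (ev_mono _ _ (ev_and _ _ H H')). intros x [A B].
  assert (0 <= c' * exp (d' * x)) by (apply Rmult_le_pos; [lra|left; apply exp_pos]). lra.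
Qed.

Lemma rsum_app (l l' : list (R * R)) (x : R) : rsum (l ++ l') x = rsum l x + rsum l' x.
Proof. induction l as [|p l IH]; simpl; [ring|]. rewrite IH. ring. Qed.

Lemma rsum_opp (l : list (R * R)) (x : R) :
  rsum (map (fun p => (- fst p, snd p)) l) x = - rsum l x.
Proof. induction l as [|p l IH]; simpl; [ring|]. rewrite IH. ring. Qed.

(** The normal form of p - q is empty or has a leading term c e^{dx} with d > 0, and the sign of its
    coefficient decides. *)
Lemma label_trichotomy (p q : R -> R) :
  label p -> label q -> p = q \/ label_gt p q \/ label_gt q p.
Proof.
  intros [lp [Hp Ep]] [lq [Hq Eq]].
  set (l := lp ++ map (fun p => (- fst p, snd p)) lq).
  assert (E : forall x, p x - q x = rsum l x).
  { intros x. unfold l. rewrite rsum_app, rsum_opp, Ep, Eq. ring. }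
  assert (Hl : forall a, In a l -> 0 < snd a).
  { intros a Ha. apply in_app_iff in Ha. destruct Ha as [Ha|Ha]; [auto|].
    apply in_map_iff in Ha. destruct Ha as [b [<- Hb]]. simpl. auto. }
  destruct (esum_normal_form (complexify l)) as [l' [Hs [Hn [_ [HI E']]]]].
  destruct l' as [|a l'].
  { left. apply functional_extensionality. intros x.
    specialize (E' (RtoC x)). rewrite esum_complexify in E'.
    apply (f_equal fst) in E'. simpl in E'. specialize (E x). lra. }
  right.
  inversion Hs as [|? ? Hs1 Hs2]; subst. inversion Hn as [|? ? Hn1 Hn2]; subst.
  assert (Ha : 0 < snd a).
  { destruct (HI a (or_introl eq_refl)) as [b [Hb ->]].
    apply in_map_iff in Hb. destruct Hb as [b' [<- Hb']]. simpl. auto. }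
  assert (C0 : 0 < Cmod (fst a)) by (apply Cmod_gt_0, Hn1).
  set (c := Cmod (fst a)) in *. set (r := Re (fst a)).
  assert (V := esum_tail_small (snd a) l' (c / 8) Hs2 ltac:(lra)).
  assert (V2 : ev (fun x => Rabs (rsum l x - r * exp (snd a * x)) <= c / 8 * exp (snd a * x) /\
     7 / 8 * c * exp (snd a * x) <= Rabs (rsum l x))).
  { apply (ev_mono _ _ V). intros x Hx.
    assert (E1 : RtoC (rsum l x) = (fst a * RtoC (exp (snd a * x)) + esum l' (RtoC x))%C).
    { rewrite <- esum_complexify, <- E', esum_cons, <- RtoC_mult, Cexp_RtoC. reflexivity. }
    split.
    - assert (E2 : rsum l x - r * exp (snd a * x) = Re (esum l' (RtoC x))).
      { apply (f_equal Re) in E1. unfold r. destruct (fst a), (esum l' (RtoC x)).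
        simpl in *. lra. }
      rewrite E2. eapply Rle_trans; [apply re_le_Cmod|exact Hx].
    - rewrite <- Cmod_R, E1. eapply Rle_trans; [|apply Cmod_plus_lower].
      rewrite Cmod_mult, Cmod_R, (Rabs_pos_eq (exp _)) by (left; apply exp_pos). fold c. lra. }
  assert (Hr : 3 / 4 * c <= Rabs r).
  { destruct V2 as [X HX]. destruct (HX X (Rle_refl _)) as [A B].
    assert (T := Rabs_triang (rsum l X - r * exp (snd a * X)) (r * exp (snd a * X))).
    replace (rsum l X - r * exp (snd a * X) + r * exp (snd a * X)) with (rsum l X) in T by ring.
    rewrite (Rabs_mult r), (Rabs_pos_eq (exp _)) in T by (left; apply exp_pos).
    apply Rmult_le_reg_r with (exp (snd a * X)); [apply exp_pos|]. lra. }
  destruct (Rle_or_lt 0 r) as [Sr|Sr].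
  - left. rewrite Rabs_pos_eq in Hr by exact Sr.
    exists (c / 2), (snd a). split; [lra|split; [exact Ha|]].
    apply (ev_mono _ _ V2). intros x [A _]. rewrite E. apply Rabs_le_between in A.
    assert (P := exp_pos (snd a * x)).
    assert (3 / 4 * c * exp (snd a * x) <= r * exp (snd a * x)) by (apply Rmult_le_compat_r; lra).
    lra.
  - right. rewrite Rabs_left in Hr by exact Sr.
    exists (c / 2), (snd a). split; [lra|split; [exact Ha|]].
    apply (ev_mono _ _ V2). intros x [A _].
    replace (q x - p x) with (- rsum l x) by (rewrite <- E; ring). apply Rabs_le_between in A.
    assert (P := exp_pos (snd a * x)).
    assert (3 / 4 * c * exp (snd a * x) <= - r * exp (snd a * x)) by (apply Rmult_le_compat_r; lra).
    lra.
Qed.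

(** * Sums of terms [K e^p] *)

Definition item : Type := ((R -> R) * (C -> C))%type.

Definition ival (it : item) (x : R) : C := (snd it (RtoC x) * RtoC (exp (fst it x)))%C.

Definition isum (l : list item) (x : R) : C :=
  fold_right (fun it acc => ival it x + acc)%C (RtoC 0) l.

Definition valid (it : item) : Prop := label (fst it) /\ expandable (snd it).

(** For a valid item the alternative, by [expandable_dichotomy], is a coefficient that vanishes near
    infinity. *)
Definition nonzero (it : item) : Prop := power_like (fun x => snd it (RtoC x)).

Definition item_gt (a b : item) : Prop := label_gt (fst a) (fst b).

Lemma Cmod_ival (it : item) (x : R) : Cmod (ival it x) = Cmod (snd it (RtoC x)) * exp (fst it x).
Proof.
  unfold ival. rewrite Cmod_mult, Cmod_R, Rabs_pos_eq; [reflexivity|left; apply exp_pos].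
Qed.

Lemma isum_app (l l' : list item) (x : R) : isum (l ++ l') x = (isum l x + isum l' x)%C.
Proof. induction l as [|a l IH]; simpl; [ring|]. rewrite IH. ring. Qed.

Lemma expandable_ev_bound (F : C -> C) : expandable F ->
  exists B L, ev (fun x => Cmod (F (RtoC x)) <= exp (L * x + B)).
Proof.
  intros [t0 [B [P [Q H]]]].
  destruct (expandable_bounded t0 B F P Q H) as [B' [L [HB' [HL K]]]].
  exists B', L. exists t0. intros x Hx. eapply Rle_trans; [apply (K (RtoC x)), Hx|].
  rewrite exp_plus, Rmult_comm. simpl Re. apply Rmult_le_compat_l; [left; apply exp_pos|].
  assert (E := exp_ineq1_le B'). lra.
Qed.

(** The quotient of the coefficients is at most exponential of an affine function, whereas the gap
    of the labels is at least c e^{dx}. *)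
Lemma item_dominated (a b : item) (e : R) :
  item_gt a b -> nonzero a -> valid b -> 0 < e ->
  ev (fun x => Cmod (ival b x) <= e * Cmod (ival a x)).
Proof.
  intros [c [d [Hc [Hd Hg]]]] [m [c1 [c2 [Hc1 [_ Hn]]]]] [_ Hb] He.
  destruct (expandable_ev_bound _ Hb) as [B [L HB]].
  assert (V := ev_affine_le_exp c d (L - m) (B - ln (e * c1)) Hc Hd).
  apply (ev_mono _ _ (ev_and _ _ Hg (ev_and _ _ Hn (ev_and _ _ HB V)))).
  intros x [A1 [[A2 _] [A3 A4]]]. rewrite !Cmod_ival.
  apply Rle_trans with (exp (L * x + B) * exp (fst b x)).
  - apply Rmult_le_compat_r; [left; apply exp_pos|exact A3].
  - apply Rle_trans with (e * (c1 * exp (m * x) * exp (fst a x))).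
    + replace (e * (c1 * exp (m * x) * exp (fst a x))) with (e * c1 * (exp (m * x) * exp (fst a x))) by ring.
      assert (P : 0 < e * c1) by (apply Rmult_lt_0_compat; lra).
      rewrite <- (exp_ln (e * c1)) at 1 by exact P. rewrite <- !exp_plus.
      apply exp_mono. lra.
    + apply Rmult_le_compat_l; [lra|]. apply Rmult_le_compat_r; [left; apply exp_pos|exact A2].
Qed.

Lemma isum_tail_small (a : item) (l : list item) (e : R) :
  Forall (item_gt a) l -> Forall valid l -> nonzero a -> 0 < e ->
  ev (fun x => Cmod (isum l x) <= e * Cmod (ival a x)).
Proof.
  intros Hg Hv Hn. revert e. induction l as [|b l IH]; intros e He.
  - exists 0. intros x _. simpl. rewrite Cmod_0. apply Rmult_le_pos; [lra|apply Cmod_ge_0].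
  - inversion Hg; subst. inversion Hv; subst.
    assert (V1 := item_dominated a b (e / 2) ltac:(assumption) Hn ltac:(assumption) ltac:(lra)).
    assert (V2 := IH ltac:(assumption) ltac:(assumption) (e / 2) ltac:(lra)).
    apply (ev_mono _ _ (ev_and _ _ V1 V2)). intros x [A B]. simpl.
    eapply Rle_trans; [apply Cmod_triangle|]. lra.
Qed.

Definition normal (l : list item) : Prop :=
  StronglySorted item_gt l /\ Forall valid l /\ Forall nonzero l.

(** As in [esum_insert], with labels for exponents. Equal labels have their coefficients added, and
    [expandable_dichotomy] decides whether the sum is dropped or kept as a nonzero item. *)
Lemma item_insert (a : item) (l : list item) :
  valid a -> normal l ->
  exists l', normal l' /\ (forall b, In b l' -> exists b', In b' (a :: l) /\ fst b = fst b') /\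
    ev (fun x => isum l' x = isum (a :: l) x).
Proof.
  intros Ha Hl. destruct (expandable_dichotomy (snd a) (proj2 Ha)) as [Z|Z].
  { exists l. split; [exact Hl|split].
    - intros b Hb. exists b; simpl; auto.
    - apply (ev_mono _ _ Z). intros x Hx. simpl. unfold ival. rewrite Hx. ring. }
  induction l as [|b l IH].
  { exists (a :: nil). split; [|split].
    - split; [|split]; repeat constructor; auto; apply Ha.
    - intros b Hb; exists b; auto.
    - exists 0; auto. }
  destruct Hl as [Hs [Hv Hn]].
  inversion Hs as [|? ? Hs1 Hs2]; subst. inversion Hv as [|? ? Hv1 Hv2]; subst.
  inversion Hn as [|? ? Hn1 Hn2]; subst.
  destruct (label_trichotomy (fst a) (fst b) (proj1 Ha) (proj1 Hv1)) as [E|[G|G]].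
  - set (K := fun z => (snd a z + snd b z)%C).
    assert (HK : expandable K) by (apply expandable_plus; [apply Ha|apply Hv1]).
    assert (ES : forall x, isum (a :: b :: l) x = (ival (fst b, K) x + isum l x)%C).
    { intros x. simpl. unfold ival, K. rewrite E. simpl. ring. }
    destruct (expandable_dichotomy K HK) as [ZK|ZK].
    + exists l. split; [split; auto|split].
      * intros b' Hb'. exists b'; simpl; auto.
      * apply (ev_mono _ _ ZK). intros x Hx. rewrite ES. unfold ival. simpl snd. rewrite Hx. ring.
    + exists ((fst b, K) :: l). split; [split; [|split]|split].
      * constructor; [exact Hs1|]. exact Hs2.
      * constructor; [|exact Hv2]. split; [apply Hv1|exact HK].
      * constructor; [exact ZK|exact Hn2].
      * intros b' [<-|Hb']; [exists b; simpl; auto|exists b'; simpl; auto].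
      * exists 0. intros x _. rewrite ES. reflexivity.
  - exists (a :: b :: l). split; [split; [|split]|split].
    + constructor; [exact Hs|]. constructor; [exact G|].
      rewrite Forall_forall in *. intros b' Hb'. eapply label_gt_trans; [exact G|apply Hs2, Hb'].
    + constructor; auto.
    + constructor; auto.
    + intros b' Hb'; exists b'; auto.
    + exists 0; auto.
  - destruct IH as [l' [[Hs' [Hv' Hn']] [HI HE]]]; [split; auto|].
    exists (b :: l'). split; [split; [|split]|split].
    + constructor; [exact Hs'|]. apply Forall_forall. intros b' Hb'.
      destruct (HI b' Hb') as [b2 [[<-|Hb2] E2]]; unfold item_gt; rewrite E2; [exact G|].
      rewrite Forall_forall in Hs2. apply Hs2, Hb2.
    + constructor; auto.
    + constructor; auto.
    + intros b' [<-|Hb']; [exists b; simpl; auto|].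
      destruct (HI b' Hb') as [b2 [[<-|Hb2] E2]]; [exists a|exists b2]; simpl; auto.
    + apply (ev_mono _ _ HE). intros x Hx. simpl in *. rewrite Hx. ring.
Qed.

Lemma item_normal_form (l : list item) :
  Forall valid l ->
  exists l', normal l' /\ (forall b, In b l' -> exists b', In b' l /\ fst b = fst b') /\
    ev (fun x => isum l' x = isum l x).
Proof.
  induction 1 as [|a l Ha Hl [l' [N' [I' E']]]].
  - exists nil. split; [|split].
    + split; [|split]; constructor.
    + intros b [].
    + exists 0; auto.
  - destruct (item_insert a l' Ha N') as [l2 [N2 [I2 E2]]].
    exists l2. split; [exact N2|split].
    + intros b Hb. destruct (I2 b Hb) as [b' [[<-|Hb'] Eb]]; [exists a; simpl; auto|].
      destruct (I' b' Hb') as [b2 [Hb2 Eb2]]. exists b2. rewrite Eb. simpl; auto.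
    + apply (ev_mono _ _ (ev_and _ _ E' E2)). intros x [A B]. rewrite B. simpl. rewrite A. reflexivity.
Qed.

(** * Analyticity as local uniform approximation by polynomials *)

Definition peval (l : list C) (h : C) : C := fold_right (fun a acc => a + h * acc)%C (RtoC 0) l.

Fixpoint padd (l l' : list C) : list C :=
  match l, l' with
  | nil, _ => l'
  | _, nil => l
  | a :: k, b :: k' => (a + b)%C :: padd k k'
  end.

Lemma peval_padd (l l' : list C) (h : C) : peval (padd l l') h = (peval l h + peval l' h)%C.
Proof.
  revert l'. induction l as [|a l IH]; intros [|b l']; simpl; try ring. rewrite IH. ring.
Qed.

Lemma nth_padd (l l' : list C) (j : nat) :
  nth j (padd l l') (RtoC 0) = (nth j l (RtoC 0) + nth j l' (RtoC 0))%C.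
Proof.
  revert l l'. induction j as [|j IH]; intros [|a l] [|b l']; simpl; try ring. apply IH.
Qed.

Definition pscal (c : C) (l : list C) : list C := map (Cmult c) l.

Lemma peval_pscal (c : C) (l : list C) (h : C) : peval (pscal c l) h = (c * peval l h)%C.
Proof. induction l as [|a l IH]; simpl; [ring|]. rewrite IH. ring. Qed.

Lemma nth_pscal (c : C) (l : list C) (j : nat) :
  nth j (pscal c l) (RtoC 0) = (c * nth j l (RtoC 0))%C.
Proof. revert l. induction j as [|j IH]; intros [|a l]; simpl; try ring. apply IH. Qed.

Fixpoint pmul (l l' : list C) : list C :=
  match l with
  | nil => nil
  | a :: k => padd (pscal a l') (RtoC 0 :: pmul k l')
  end.

Lemma peval_pmul (l l' : list C) (h : C) : peval (pmul l l') h = (peval l h * peval l' h)%C.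
Proof.
  induction l as [|a l IH]; [simpl; ring|].
  simpl pmul. rewrite peval_padd, peval_pscal. simpl peval. rewrite IH. ring.
Qed.

Lemma peval_csum (l : list C) (N : nat) (h : C) : (length l <= N)%nat ->
  peval l h = csum (fun j => nth j l (RtoC 0) * h ^ j)%C N.
Proof.
  revert N. induction l as [|a l IH]; intros N HN.
  - simpl. rewrite (csum_ext _ (fun _ => RtoC 0 * RtoC 0)%C); [rewrite csum_scal; ring|].
    intros [|k] _; simpl; ring.
  - destruct N as [|N]; [simpl in HN; lia|]. rewrite csum_S_l. simpl in *.
    rewrite (IH N) by lia. rewrite <- csum_scal. f_equal; [ring|]. apply csum_ext. intros k _. ring.
Qed.

(** A stand-in for power series that is closed under sums, products, [Cexp] and uniform limits by
    elementary estimates. [analytic_uapprox] and [uapprox_analytic] translate from and to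
    [analytic_at]. *)
Definition uapprox (f : C -> C) (z0 : C) (r : R) : Prop :=
  forall e, 0 < e -> exists l, forall h, Cmod h < r -> Cmod (f (z0 + h) - peval l h)%C <= e.

Lemma peval_bounded (l : list C) (r : R) : 0 <= r ->
  exists B, 0 <= B /\ forall h, Cmod h < r -> Cmod (peval l h) <= B.
Proof.
  intros Hr. induction l as [|a l [B [HB H]]].
  - exists 0. split; [lra|]. intros h _. simpl. rewrite Cmod_0. lra.
  - assert (A := Cmod_ge_0 a). exists (Cmod a + r * B). split; [nra|].
    intros h Hh. simpl. eapply Rle_trans; [apply Cmod_triangle|]. rewrite Cmod_mult.
    apply Rplus_le_compat_l. apply Rmult_le_compat; auto using Cmod_ge_0. lra.
Qed.

Lemma uapprox_bounded (f : C -> C) (z0 : C) (r : R) : 0 <= r -> uapprox f z0 r ->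
  exists B, 0 <= B /\ forall h, Cmod h < r -> Cmod (f (z0 + h)%C) <= B.
Proof.
  intros Hr H. destruct (H 1 Rlt_0_1) as [l Hl]. destruct (peval_bounded l r Hr) as [B [HB Bl]].
  exists (1 + B). split; [lra|]. intros h Hh. specialize (Hl h Hh). specialize (Bl h Hh).
  replace (f (z0 + h)%C) with ((f (z0 + h) - peval l h) + peval l h)%C by ring.
  eapply Rle_trans; [apply Cmod_triangle|]. lra.
Qed.

Lemma uapprox_limit (f : C -> C) (z0 : C) (r : R) :
  (forall e, 0 < e -> exists g, uapprox g z0 r /\
    forall h, Cmod h < r -> Cmod (f (z0 + h) - g (z0 + h))%C <= e) -> uapprox f z0 r.
Proof.
  intros H e He. destruct (H (e / 2) ltac:(lra)) as [g [Hg Hf]].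
  destruct (Hg (e / 2) ltac:(lra)) as [l Hl]. exists l. intros h Hh.
  specialize (Hf h Hh). specialize (Hl h Hh).
  replace (f (z0 + h) - peval l h)%C
    with ((f (z0 + h) - g (z0 + h)) + (g (z0 + h) - peval l h))%C by ring.
  eapply Rle_trans; [apply Cmod_triangle|]. lra.
Qed.

Lemma uapprox_peval (f : C -> C) (l : list C) (z0 : C) (r : R) :
  (forall h, f (z0 + h)%C = peval l h) -> uapprox f z0 r.
Proof.
  intros E e He. exists l. intros h _. rewrite E.
  replace (peval l h - peval l h)%C with (RtoC 0) by ring. rewrite Cmod_0. lra.
Qed.

Lemma uapprox_const (c z0 : C) (r : R) : uapprox (fun _ => c) z0 r.
Proof. apply uapprox_peval with (c :: nil). intros h. simpl. ring. Qed.

Lemma uapprox_id (z0 : C) (r : R) : uapprox (fun z => z) z0 r.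
Proof. apply uapprox_peval with (z0 :: RtoC 1 :: nil). intros h. simpl. ring. Qed.

Lemma uapprox_weaken (f : C -> C) (z0 : C) (r r' : R) : r' <= r -> uapprox f z0 r -> uapprox f z0 r'.
Proof.
  intros L H e He. destruct (H e He) as [l Hl]. exists l. intros h Hh. apply Hl. lra.
Qed.

Lemma uapprox_plus (f g : C -> C) (z0 : C) (r : R) :
  uapprox f z0 r -> uapprox g z0 r -> uapprox (fun z => f z + g z)%C z0 r.
Proof.
  intros Hf Hg e He. destruct (Hf (e / 2) ltac:(lra)) as [l Hl].
  destruct (Hg (e / 2) ltac:(lra)) as [l' Hl']. exists (padd l l'). intros h Hh.
  specialize (Hl h Hh). specialize (Hl' h Hh). rewrite peval_padd.
  replace (f (z0 + h) + g (z0 + h) - (peval l h + peval l' h))%C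
    with ((f (z0 + h) - peval l h) + (g (z0 + h) - peval l' h))%C by ring.
  eapply Rle_trans; [apply Cmod_triangle|]. lra.
Qed.

Lemma uapprox_mult (f g : C -> C) (z0 : C) (r : R) : 0 <= r ->
  uapprox f z0 r -> uapprox g z0 r -> uapprox (fun z => f z * g z)%C z0 r.
Proof.
  intros Hr Hf Hg.
  destruct (uapprox_bounded g z0 r Hr Hg) as [Bg [HBg Bg']].
  intros e He.
  destruct (Hf (e / 2 / (Bg + 1))) as [l Hl].
  { apply Rdiv_lt_0_compat; lra. }
  destruct (peval_bounded l r Hr) as [Bl [HBl Bl']].
  destruct (Hg (e / 2 / (Bl + 1))) as [l' Hl'].
  { apply Rdiv_lt_0_compat; lra. }
  exists (pmul l l'). intros h Hh.
  specialize (Hl h Hh). specialize (Hl' h Hh). specialize (Bg' h Hh). specialize (Bl' h Hh).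
  rewrite peval_pmul.
  replace (f (z0 + h) * g (z0 + h) - peval l h * peval l' h)%C
    with ((f (z0 + h) - peval l h) * g (z0 + h) + peval l h * (g (z0 + h) - peval l' h))%C by ring.
  eapply Rle_trans; [apply Cmod_triangle|]. rewrite !Cmod_mult.
  assert (T : forall b x, 0 <= b -> 0 <= x -> x <= b -> e / 2 / (b + 1) * x <= e / 2).
  { intros b x Hb Hx L. apply Rle_trans with (e / 2 / (b + 1) * (b + 1)).
    - apply Rmult_le_compat_l; [|lra]. left; apply Rdiv_lt_0_compat; lra.
    - right; field; lra. }
  assert (T1 := T Bg _ HBg (Cmod_ge_0 _) Bg'). assert (T2 := T Bl _ HBl (Cmod_ge_0 _) Bl').
  assert (U1 : Cmod (f (z0 + h) - peval l h)%C * Cmod (g (z0 + h)%C) <= e / 2 / (Bg + 1) * Cmod (g (z0 + h)%C))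
    by (apply Rmult_le_compat_r; [apply Cmod_ge_0|exact Hl]).
  assert (U2 : Cmod (peval l h) * Cmod (g (z0 + h) - peval l' h)%C <= Cmod (peval l h) * (e / 2 / (Bl + 1)))
    by (apply Rmult_le_compat_l; [apply Cmod_ge_0|exact Hl']).
  lra.
Qed.

Lemma uapprox_pow (f : C -> C) (z0 : C) (r : R) (n : nat) : 0 <= r ->
  uapprox f z0 r -> uapprox (fun z => f z ^ n)%C z0 r.
Proof.
  intros Hr Hf. induction n as [|n IH]; [exact (uapprox_const (RtoC 1) z0 r)|].
  apply (uapprox_mult f (fun z => f z ^ n)%C); auto.
Qed.

Lemma uapprox_taylor (f : C -> C) (z0 : C) (r : R) (n : nat) : 0 <= r ->
  uapprox f z0 r -> uapprox (fun z => Cexp_taylor n (f z)) z0 r.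
Proof.
  intros Hr Hf. induction n as [|n IH]; [exact (uapprox_const (RtoC 0) z0 r)|]. simpl.
  apply uapprox_plus; [exact IH|]. apply uapprox_mult; [exact Hr|apply uapprox_const|].
  apply (uapprox_pow f); auto.
Qed.

Lemma uapprox_Cexp (f : C -> C) (z0 : C) (r : R) : 0 <= r ->
  uapprox f z0 r -> uapprox (fun z => Cexp (f z)) z0 r.
Proof.
  intros Hr Hf. apply uapprox_limit. intros e He.
  destruct (uapprox_bounded f z0 r Hr Hf) as [B [HB B']].
  assert (L : is_lim_seq (fun n => B ^ n / INR (fact n)) 0).
  { apply is_lim_seq_Reals. intros e' He'. destruct (cv_speed_pow_fact B e' He') as [N HN]. exists N. exact HN. }
  apply is_lim_seq_spec in L.
  assert (Pe : 0 < e / exp B) by (apply Rdiv_lt_0_compat; [exact He|apply exp_pos]).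
  destruct (L (mkposreal _ Pe)) as [n Hn]. specialize (Hn n (le_n _)). simpl in Hn.
  exists (fun z => Cexp_taylor n (f z)). split; [apply uapprox_taylor; auto|].
  intros h Hh. specialize (B' h Hh). eapply Rle_trans; [apply Cexp_taylor_bound|].
  rewrite Rminus_0_r in Hn. apply Rabs_lt_between in Hn.
  assert (P := exp_pos B).
  replace e with (e / exp B * exp B) by (field; lra).
  apply Rmult_le_compat; [|left; apply exp_pos| |apply exp_mono, B'].
  - apply Rmult_le_pos; [apply pow_le, Cmod_ge_0|]. left; apply Rinv_0_lt_compat, INR_fact_lt_0.
  - apply Rle_trans with (B ^ n / INR (fact n)); [|lra].
    apply Rmult_le_compat_r; [left; apply Rinv_0_lt_compat, INR_fact_lt_0|].
    apply pow_incr. split; [apply Cmod_ge_0|exact B'].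
Qed.

Lemma half_pow_small (K e : R) : 0 < e -> exists n, K * (1 / 2) ^ n <= e.
Proof.
  intros He. assert (P := Rabs_pos K).
  destruct (pow_lt_1_zero (1 / 2) ltac:(rewrite Rabs_pos_eq; lra) (e / (Rabs K + 1))) as [n Hn].
  { apply Rdiv_lt_0_compat; lra. }
  exists n. specialize (Hn n (le_n _)). rewrite Rabs_pos_eq in Hn by (apply pow_le; lra).
  assert (Q : 0 <= (1 / 2) ^ n) by (apply pow_le; lra).
  apply Rle_trans with ((Rabs K + 1) * (1 / 2) ^ n).
  - apply Rmult_le_compat_r; [exact Q|]. assert (A := Rle_abs K). lra.
  - apply Rmult_le_reg_l with (/ (Rabs K + 1)); [apply Rinv_0_lt_compat; lra|].
    rewrite <- Rmult_assoc, Rinv_l, Rmult_1_l by lra. unfold Rdiv in Hn. lra.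
Qed.

(** Truncated geometric series in -h/z0, built by p(n+1) = 1/z0 - (h/z0) p(n), with exact error
    (-h/z0)^n/(z0+h). On half the radius the ratio is at most 1/2 and |z0+h| >= |z0|/2. *)
Lemma uapprox_inv (z0 : C) : z0 <> RtoC 0 -> uapprox Cinv z0 (Cmod z0 / 2).
Proof.
  intros H0. assert (P := proj1 (Cmod_gt_0 z0) H0).
  set (p := fix p n := match n with O => RtoC 0 :: nil | S n => padd (/ z0 :: nil)%C (pscal (- / z0) (RtoC 0 :: p n)) end).
  intros e He. destruct (half_pow_small (2 / Cmod z0) e He) as [n Hn].
  exists (p n). intros h Hh.
  assert (Hz : (z0 + h)%C <> RtoC 0).
  { intros E. assert (Cmod z0 = Cmod h) by (rewrite <- (Cmod_opp h); f_equal; replace z0 with (z0 + h - h)%C by ring; rewrite E; ring). lra. }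
  assert (E : (/ (z0 + h) - peval (p n) h = (- h / z0) ^ n / (z0 + h))%C).
  { clear Hn. induction n as [|n IH].
    - simpl. field. exact Hz.
    - replace (peval (p (S n)) h) with (/ z0 - h / z0 * peval (p n) h)%C.
      + replace (peval (p n) h) with (/ (z0 + h) - (- h / z0) ^ n / (z0 + h))%C by (rewrite <- IH; ring).
        rewrite Cpow_S. field. split; auto.
      + change (p (S n)) with (padd (/ z0 :: nil)%C (pscal (- / z0) (RtoC 0 :: p n))).
        rewrite peval_padd, peval_pscal. change (peval (RtoC 0 :: p n) h) with (RtoC 0 + h * peval (p n) h)%C.
        change (peval (/ z0 :: nil)%C h) with (/ z0 + h * RtoC 0)%C. field. exact H0. }
  rewrite E, Cmod_div, Cmod_pow, Cmod_div, Cmod_opp by auto.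
  eapply Rle_trans; [|exact Hn].
  assert (Q : Cmod z0 / 2 <= Cmod (z0 + h)%C).
  { assert (T := Cmod_plus_lower z0 h). lra. }
  unfold Rdiv at 1. rewrite Rmult_comm. apply Rmult_le_compat.
  - left; apply Rinv_0_lt_compat; lra.
  - apply pow_le. apply Rmult_le_pos; [apply Cmod_ge_0|left; apply Rinv_0_lt_compat, P].
  - replace (2 / Cmod z0) with (/ (Cmod z0 / 2)) by (field; lra). apply Rinv_le_contravar; lra.
  - apply pow_incr. split; [apply Rmult_le_pos; [apply Cmod_ge_0|left; apply Rinv_0_lt_compat, P]|].
    apply Rmult_le_reg_r with (Cmod z0); [exact P|]. unfold Rdiv. rewrite Rmult_assoc, Rinv_l; lra.
Qed.

(* [esum_coef_bound] on the vertical line which the exponential maps to the circle of radius [rho]. *)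
Lemma peval_coef_bound (l : list C) (rho e : R) (j : nat) :
  0 < rho -> (forall h, Cmod h = rho -> Cmod (peval l h) <= e) ->
  Cmod (nth j l (RtoC 0)) * rho ^ j <= e.
Proof.
  intros Hr H.
  set (pe := fix pe k (l : list C) : list (C * R) := match l with nil => nil | a :: l' => (a, INR k) :: pe (S k) l' end).
  assert (E1 : forall l k z, esum (pe k l) z = (Cexp z ^ k * peval l (Cexp z))%C).
  { clear. induction l as [|a l IH]; intros k z; [simpl; ring|].
    simpl pe. rewrite esum_cons, IH, Cpow_S. simpl fst; simpl snd. rewrite <- Cexp_pow. simpl. ring. }
  assert (E0 : forall l k n, (n < k)%nat -> coef_at (pe k l) (INR n) = RtoC 0).
  { clear. induction l as [|a l IH]; intros k n Hn; [reflexivity|]. simpl.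
    destruct (Req_EM_T (INR k) (INR n)) as [E|_]; [apply INR_eq in E; lia|]. apply IH. lia. }
  assert (E2 : forall l k j, coef_at (pe k l) (INR (k + j)) = nth j l (RtoC 0)).
  { clear - E0. induction l as [|a l IH]; intros k j; [destruct j; reflexivity|]. simpl.
    destruct (Req_EM_T (INR k) (INR (k + j))) as [E|N].
    - apply INR_eq in E. assert (j = 0)%nat by lia. subst j. rewrite E0 by lia. simpl. ring.
    - destruct j as [|j]; [rewrite Nat.add_0_r in N; lra|].
      replace (k + S j)%nat with (S k + j)%nat by lia. apply IH. }
  assert (B := esum_coef_bound (pe O l) (INR j) (ln rho) e).
  change (INR j) with (INR (0 + j)) in B at 1. rewrite E2 in B.
  assert (Q : exp (- INR j * ln rho) * rho ^ j = 1).
  { rewrite <- (exp_ln rho) at 2 by exact Hr. clear. induction j as [|j IH].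
    - simpl. rewrite Ropp_0, Rmult_0_l, exp_0. ring.
    - rewrite S_INR. simpl. replace (- (INR j + 1) * ln rho) with (- INR j * ln rho + - ln rho) by ring.
      rewrite exp_plus. rewrite <- IH. rewrite exp_Ropp. field.
      assert (P := exp_pos (ln rho)). lra. }
  replace e with (e * exp (- INR j * ln rho) * rho ^ j) by (rewrite Rmult_assoc, Q; ring).
  apply Rmult_le_compat_r; [apply pow_le; lra|]. apply B. intros s.
  rewrite E1. simpl Cpow. rewrite Cmult_1_l. apply H. rewrite Cmod_Cexp. simpl. apply exp_ln, Hr.
Qed.

(** Completeness is applied to real and imaginary parts separately, whence the factor 2. *)
Lemma C_limit_of_cauchy (a : nat -> C) (e : nat -> R) :
  is_lim_seq e 0 -> (forall n m, (n <= m)%nat -> Cmod (a n - a m)%C <= e n) ->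
  exists u, forall n, Cmod (u - a n)%C <= 2 * e n.
Proof.
  intros He H.
  assert (G : forall c : nat -> R, (forall n m, (n <= m)%nat -> Rabs (c n - c m) <= e n) ->
    exists u, forall n, Rabs (u - c n) <= e n).
  { intros c Hc.
    assert (X : ex_finite_lim_seq c).
    { apply ex_lim_seq_cauchy_corr. intros eps. apply is_lim_seq_spec in He.
      destruct (He (mkposreal (eps / 2) ltac:(destruct eps; simpl; lra))) as [N HN]. simpl in HN.
      exists N. intros n m Hn Hm. specialize (HN N (le_n _)). rewrite Rminus_0_r in HN.
      apply Rabs_lt_between in HN.
      assert (A1 := Hc N n Hn). assert (A2 := Hc N m Hm).
      apply Rabs_le_between in A1. apply Rabs_le_between in A2.
      apply Rabs_lt_between. lra. }
    destruct X as [u Hu]. exists u. intros n.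
    assert (L : is_lim_seq (fun m => Rabs (c (m + n)%nat - c n)) (Rabs (u - c n))).
    { apply (is_lim_seq_abs _ (u - c n)). apply is_lim_seq_minus'; [|apply is_lim_seq_const].
      apply is_lim_seq_incr_n with (N := n) in Hu. exact Hu. }
    apply (is_lim_seq_le _ (fun _ => e n) (Rabs (u - c n)) (e n)) in L; [exact L| |apply is_lim_seq_const].
    intros m. rewrite Rabs_minus_sym. apply Hc. lia. }
  destruct (G (fun n => Re (a n))) as [x Hx].
  { intros n m L. eapply Rle_trans; [|apply (H n m L)].
    replace (Re (a n) - Re (a m)) with (Re (a n - a m)%C) by (destruct (a n), (a m); simpl; ring).
    apply re_le_Cmod. }
  destruct (G (fun n => Im (a n))) as [y Hy].
  { intros n m L. eapply Rle_trans; [|apply (H n m L)].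
    replace (Im (a n) - Im (a m)) with (Im (a n - a m)%C) by (destruct (a n), (a m); simpl; ring).
    eapply Rle_trans; [apply Rmax_r|apply Rmax_Cmod]. }
  exists (x, y). intros n. specialize (Hx n). specialize (Hy n).
  assert (T : Cmod ((x, y) - a n)%C <= Cmod (RtoC (x - Re (a n))) + Cmod (0, y - Im (a n))).
  { eapply Rle_trans; [|apply Cmod_triangle]. right. f_equal. destruct (a n).
    cparts. f_equal; ring. }
  rewrite Cmod_R in T.
  assert (T2 : Cmod (0, y - Im (a n)) = Rabs (y - Im (a n))).
  { unfold Cmod. simpl. rewrite Rmult_0_l, Rplus_0_l, Rmult_1_r. apply sqrt_Rsqr_abs. }
  lra.
Qed.

Lemma C_is_series (a : nat -> C) (s : C) :
  (forall e, 0 < e -> exists N, forall n, (N <= n)%nat -> Cmod (csum a (S n) - s)%C < e) <->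
  is_series (K := C_AbsRing) (V := C_NormedModule) a s.
Proof.
  assert (E : forall n, sum_n (G := C_AbelianMonoid) a n = csum a (S n)).
  { induction n as [|n IH]; [rewrite sum_O; simpl; ring|]. rewrite sum_Sn, IH. reflexivity. }
  split.
  - intros H. apply filterlim_locally. intros eps.
    destruct (H eps (cond_pos eps)) as [N HN]. exists N. intros n Hn.
    apply C_NormedModule_mixin_compat1. specialize (HN n Hn). rewrite <- E in HN. exact HN.
  - intros H e He. assert (H' := proj1 (filterlim_locally _ _) H).
    (* Balls of the uniform structure on [C] compare with the modulus only up to a factor sqrt 2. *)
    assert (Pe : 0 < e / 2) by lra.
    destruct (H' (mkposreal _ Pe)) as [N HN]. exists N. intros n Hn. specialize (HN n Hn).
    apply C_NormedModule_mixin_compat2 in HN. simpl in HN.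
    rewrite <- E. eapply Rlt_le_trans; [exact HN|].
    assert (S2 : sqrt 2 <= 2). { replace 2 with (sqrt 4) at 2; [apply sqrt_le_1; lra|]. replace 4 with (2 * 2) by ring. apply sqrt_square; lra. }
    nra.
Qed.

Lemma csum_geometric_tail (f : nat -> C) (B q : R) (N n : nat) :
  0 <= B -> 0 <= q <= 1 / 2 -> (forall k, Cmod (f k) <= B * q ^ k) ->
  Cmod (csum f (N + n) - csum f N)%C <= 2 * B * q ^ N.
Proof.
  intros HB Hq H.
  (* The subtracted last term strengthens the bound so that the induction closes; this is where q <=
     1/2 is used. *)
  assert (G : Cmod (csum f (N + n) - csum f N)%C <= 2 * B * q ^ N - 2 * B * q ^ (N + n)).
  { induction n as [|n IH].
    - rewrite Nat.add_0_r. unfold Cminus. rewrite Cplus_opp_r, Cmod_0. lra.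
    - rewrite <- plus_n_Sm. simpl csum.
      replace (csum f (N + n) + f (N + n)%nat - csum f N)%C
        with ((csum f (N + n) - csum f N) + f (N + n)%nat)%C by ring.
      eapply Rle_trans; [apply Cmod_triangle|]. specialize (H (N + n)%nat).
      assert (P : 0 <= B * q ^ (N + n)) by (apply Rmult_le_pos; [lra|apply pow_le; lra]).
      assert (P2 : q * (B * q ^ (N + n)) <= 1 / 2 * (B * q ^ (N + n))) by (apply Rmult_le_compat_r; lra).
      replace (2 * B * q ^ S (N + n)) with (2 * (q * (B * q ^ (N + n)))) by (simpl; ring). lra. }
  assert (0 <= 2 * B * q ^ (N + n)) by (apply Rmult_le_pos; [lra|apply pow_le; lra]). lra.
Qed.

Lemma C_pow_n (z : C) (n : nat) : pow_n (K := C_Ring) z n = (z ^ n)%C.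
Proof. induction n as [|n IH]; [reflexivity|]. simpl. rewrite IH. reflexivity. Qed.

(** Weierstrass' theorem. By the Cauchy estimate on the circle of radius rho = r/2, the j-th
    coefficients of the approximating polynomials form a Cauchy sequence at rate e_n/rho^j. Their
    limits are the coefficients of a series that converges to f on radius rho/2. *)
Lemma uapprox_analytic (f : C -> C) (z0 : C) (r : R) : 0 < r -> uapprox f z0 r -> analytic_at f z0.
Proof.
  intros Hr Hf. set (rho := r / 2). assert (Hrho : 0 < rho) by (unfold rho; lra).
  set (e := fun n => / (INR n + 1)).
  assert (Pe : forall n, 0 < e n) by (intros n; apply RinvN_pos).
  assert (Le : is_lim_seq e 0).
  { apply is_lim_seq_Reals. intros x Hx. destruct (RinvN_cv Hx) as [N HN]. exists N. exact HN. }
  assert (Me : forall n m, (n <= m)%nat -> e m <= e n).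
  { intros n m L. unfold e. apply Rinv_le_contravar; [assert (P := pos_INR n); lra|]. apply le_INR in L. lra. }
  set (l := fun n => proj1_sig (constructive_indefinite_description _ (Hf (e n) (Pe n)))).
  assert (Hl : forall n h, Cmod h < r -> Cmod (f (z0 + h) - peval (l n) h)%C <= e n).
  { intros n. exact (proj2_sig (constructive_indefinite_description _ (Hf (e n) (Pe n)))). }
  assert (HC : forall j n m, (n <= m)%nat ->
    Cmod (nth j (l n) (RtoC 0) - nth j (l m) (RtoC 0))%C <= 2 * / rho ^ j * e n).
  { intros j n m L. assert (Pj : 0 < rho ^ j) by (apply pow_lt, Hrho).
    apply Rmult_le_reg_r with (rho ^ j); [exact Pj|].
    replace (2 * / rho ^ j * e n * rho ^ j) with (2 * e n) by (field; lra).
    replace (nth j (l n) (RtoC 0) - nth j (l m) (RtoC 0))%C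
      with (nth j (padd (l n) (pscal (- RtoC 1) (l m))) (RtoC 0))
      by (rewrite nth_padd, nth_pscal; ring).
    apply peval_coef_bound; [exact Hrho|]. intros h Hh. rewrite peval_padd, peval_pscal.
    assert (Hhr : Cmod h < r) by (unfold rho in Hh; lra).
    replace (peval (l n) h + - RtoC 1 * peval (l m) h)%C
      with ((f (z0 + h) - peval (l m) h) - (f (z0 + h) - peval (l n) h))%C by ring.
    eapply Rle_trans; [apply Cmod_minus_triangle|].
    assert (A1 := Hl n h Hhr). assert (A2 := Hl m h Hhr). assert (A3 := Me n m L). lra. }
  assert (HU : forall j, exists u, forall n, Cmod (u - nth j (l n) (RtoC 0))%C <= 2 * (2 * / rho ^ j * e n)).
  { intros j. apply (C_limit_of_cauchy (fun n => nth j (l n) (RtoC 0)) (fun n => 2 * / rho ^ j * e n)).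
    - replace (Finite 0) with (Rbar_mult (2 * / rho ^ j) 0) by (simpl; f_equal; ring).
      apply is_lim_seq_scal_l, Le.
    - apply HC. }
  set (u := fun j => proj1_sig (constructive_indefinite_description _ (HU j))).
  assert (Hu : forall j n, Cmod (u j - nth j (l n) (RtoC 0))%C <= 2 * (2 * / rho ^ j * e n)).
  { intros j. exact (proj2_sig (constructive_indefinite_description _ (HU j))). }
  exists (rho / 2), u. split; [lra|]. intros z Hz. set (h := (z - z0)%C) in *.
  replace z with (z0 + h)%C by (unfold h; ring).
  apply (proj1 (C_is_series _ _)). intros d Hd.
  apply is_lim_seq_spec in Le. destruct (Le (mkposreal (d / 10) ltac:(lra))) as [n Hn].
  specialize (Hn n (le_n _)). simpl in Hn. rewrite Rminus_0_r in Hn. apply Rabs_lt_between in Hn.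
  exists (length (l n)). intros N HN.
  rewrite (csum_ext _ (fun k => u k * h ^ k)%C).
  2:{ intros k _. change (scal ?a ?b) with (Cmult a b). rewrite C_pow_n. ring. }
  assert (Hhr : Cmod h < r) by (unfold rho in Hz; lra).
  assert (A1 := Hl n h Hhr). rewrite (peval_csum (l n) (S N) h ltac:(lia)) in A1.
  set (q := Cmod h / rho).
  assert (Hq : 0 <= q <= 1 / 2).
  { unfold q. split; [apply Rmult_le_pos; [apply Cmod_ge_0|left; apply Rinv_0_lt_compat, Hrho]|].
    apply Rmult_le_reg_r with rho; [exact Hrho|]. unfold Rdiv. rewrite Rmult_assoc, Rinv_l; lra. }
  assert (A2 := csum_geometric_tail (fun k => (u k - nth k (l n) (RtoC 0)) * h ^ k)%C (4 * e n) q 0 (S N)).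
  assert (A3 : Cmod (csum (fun k => (u k - nth k (l n) (RtoC 0)) * h ^ k)%C (S N)) <= 8 * e n).
  { replace (csum (fun k => (u k - nth k (l n) (RtoC 0)) * h ^ k)%C (S N)) with
      (csum (fun k => (u k - nth k (l n) (RtoC 0)) * h ^ k)%C (0 + S N) - csum (fun k => (u k - nth k (l n) (RtoC 0)) * h ^ k)%C 0)%C
      by (simpl; ring).
    eapply Rle_trans; [apply A2|simpl; lra]; auto.
    - assert (Q := Pe n). lra.
    - intros k. rewrite Cmod_mult, Cmod_pow.
      eapply Rle_trans; [apply Rmult_le_compat_r; [apply pow_le, Cmod_ge_0|apply Hu]|].
      right. unfold q, Rdiv. rewrite Rpow_mult_distr, pow_inv. field. apply pow_nonzero. lra. }
  assert (E : csum (fun k => (u k - nth k (l n) (RtoC 0)) * h ^ k)%C (S N)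
    = (csum (fun k => u k * h ^ k) (S N) - csum (fun k => nth k (l n) (RtoC 0) * h ^ k) (S N))%C).
  { clear. induction (S N) as [|k IH]; [simpl; ring|]. simpl. rewrite IH. ring. }
  rewrite E in A3.
  replace (csum (fun k => u k * h ^ k) (S N) - f (z0 + h))%C
    with ((csum (fun k => u k * h ^ k) (S N) - csum (fun k => nth k (l n) (RtoC 0) * h ^ k) (S N))
      - (f (z0 + h) - csum (fun k => nth k (l n) (RtoC 0) * h ^ k) (S N)))%C by ring.
  eapply Rle_lt_trans; [apply Cmod_minus_triangle|]. lra.
Qed.

Lemma ev_bounded_seq (a : nat -> R) (B : R) (N : nat) :
  (forall n, (N <= n)%nat -> a n <= B) -> exists B', 0 <= B' /\ forall n, a n <= B'.
Proof.
  revert B. induction N as [|N IH]; intros B H.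
  - exists (Rabs B). split; [apply Rabs_pos|]. intros n. eapply Rle_trans; [apply H; lia|apply Rle_abs].
  - apply (IH (Rmax B (a N))). intros n Hn. destruct (Nat.eq_dec n N) as [->|Hne]; [apply Rmax_r|].
    eapply Rle_trans; [apply H; lia|apply Rmax_l].
Qed.

(** Convergence at h = rho bounds u_k rho^k, so on half that radius the series is dominated by a
    geometric one of ratio at most 1/2. *)
Lemma analytic_at_tail (f : C -> C) (z0 : C) : analytic_at f z0 ->
  exists (u : nat -> C) B rho, 0 <= B /\ 0 < rho /\
    forall h N, Cmod h <= rho / 2 ->
      Cmod (f (z0 + h) - csum (fun k => u k * h ^ k) N)%C <= 2 * B * (Cmod h / rho) ^ N.
Proof.
  intros [r [u [Hr H]]]. set (rho := r / 2). assert (Hrho : 0 < rho) by (unfold rho; lra).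
  assert (HS : forall h, Cmod h < r -> forall e, 0 < e -> exists N, forall n, (N <= n)%nat ->
    Cmod (csum (fun k => u k * h ^ k)%C (S n) - f (z0 + h)%C)%C < e).
  { intros h Hh. specialize (H (z0 + h)%C). replace (z0 + h - z0)%C with h in H by ring.
    specialize (H Hh). pose proof (proj2 (C_is_series _ _) H) as H'. intros e He.
    destruct (H' e He) as [N HN]. exists N. intros n Hn. specialize (HN n Hn).
    rewrite (csum_ext _ (fun k => u k * h ^ k)%C) in HN; [exact HN|].
    intros k _. change (scal ?a ?b) with (Cmult a b). rewrite C_pow_n. ring. }
  assert (HB : exists B, 0 <= B /\ forall k, Cmod (u k * RtoC rho ^ k)%C <= B).
  { destruct (HS (RtoC rho)) with (e := 1) as [N HN]; [|lra|].
    { rewrite Cmod_R, Rabs_pos_eq; unfold rho; lra. }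
    apply (ev_bounded_seq (fun k => Cmod (u k * RtoC rho ^ k)%C) 2 (S N)). intros n Hn. destruct n as [|n]; [lia|].
    assert (A1 := HN (S n) ltac:(lia)). assert (A2 := HN n ltac:(lia)).
    set (g := fun k => (u k * RtoC rho ^ k)%C) in *.
    change (csum g (S (S n))) with (csum g (S n) + g (S n))%C in A1.
    change (Cmod (g (S n)) <= 2).
    replace (g (S n)) with ((csum g (S n) + g (S n) - f (z0 + RtoC rho)) - (csum g (S n) - f (z0 + RtoC rho)))%C by ring.
    eapply Rle_trans; [apply Cmod_minus_triangle|]. lra. }
  destruct HB as [B [HB Bu]]. exists u, B, rho. split; [exact HB|split; [exact Hrho|]].
  intros h N Hh. set (q := Cmod h / rho).
  assert (Hq : 0 <= q <= 1 / 2).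
  { unfold q. split; [apply Rmult_le_pos; [apply Cmod_ge_0|left; apply Rinv_0_lt_compat, Hrho]|].
    apply Rmult_le_reg_r with rho; [exact Hrho|]. unfold Rdiv. rewrite Rmult_assoc, Rinv_l; lra. }
  assert (Hk : forall k, Cmod (u k * h ^ k)%C <= B * q ^ k).
  { intros k. specialize (Bu k). rewrite Cmod_mult, Cmod_pow, Cmod_R, Rabs_pos_eq in Bu by lra.
    rewrite Cmod_mult, Cmod_pow. unfold q, Rdiv. rewrite Rpow_mult_distr, pow_inv.
    replace (Cmod (u k) * Cmod h ^ k) with (Cmod (u k) * rho ^ k * (Cmod h ^ k * / rho ^ k))
      by (field; apply pow_nonzero; lra).
    apply Rmult_le_compat_r; [|exact Bu].
    apply Rmult_le_pos; [apply pow_le, Cmod_ge_0|left; apply Rinv_0_lt_compat, pow_lt, Hrho]. }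
  apply le_epsilon. intros e He.
  destruct (HS h) with (e := e) as [N1 HN1]; [unfold rho in Hh; lra|exact He|].
  specialize (HN1 (N + N1)%nat ltac:(lia)).
  assert (T := csum_geometric_tail (fun k => u k * h ^ k)%C B q N (S N1) HB Hq Hk).
  replace (N + S N1)%nat with (S (N + N1)) in T by lia.
  replace (f (z0 + h) - csum (fun k => u k * h ^ k) N)%C
    with ((csum (fun k => u k * h ^ k) (S (N + N1)) - csum (fun k => u k * h ^ k) N)
      - (csum (fun k => u k * h ^ k) (S (N + N1)) - f (z0 + h)))%C by ring.
  eapply Rle_trans; [apply Cmod_minus_triangle|]. lra.
Qed.

Lemma analytic_uapprox (f : C -> C) (z0 : C) : analytic_at f z0 -> exists r, 0 < r /\ uapprox f z0 r.
Proof.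
  intros H. destruct (analytic_at_tail f z0 H) as [u [B [rho [HB [Hrho T]]]]].
  exists (rho / 2). split; [lra|]. intros e He.
  destruct (half_pow_small (2 * B) e He) as [N HN].
  exists (map u (seq 0 N)). intros h Hh.
  rewrite (peval_csum _ N) by (rewrite length_map, length_seq; lia).
  rewrite (csum_ext _ (fun k => u k * h ^ k)%C).
  2:{ intros k Hk. f_equal. rewrite nth_indep with (d' := u 0%nat) by (rewrite length_map, length_seq; lia).
      rewrite map_nth, seq_nth by lia. reflexivity. }
  eapply Rle_trans; [apply T; lra|]. eapply Rle_trans; [|exact HN].
  apply Rmult_le_compat_l; [lra|]. apply pow_incr. split.
  - apply Rmult_le_pos; [apply Cmod_ge_0|left; apply Rinv_0_lt_compat, Hrho].
  - apply Rmult_le_reg_r with rho; [exact Hrho|]. unfold Rdiv. rewrite Rmult_assoc, Rinv_l; lra.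
Qed.

Lemma analytic_at_combine (f g : C -> C) (z0 : C) :
  analytic_at f z0 -> analytic_at g z0 ->
  exists r, 0 < r /\ uapprox f z0 r /\ uapprox g z0 r.
Proof.
  intros Hf Hg. destruct (analytic_uapprox f z0 Hf) as [r1 [P1 H1]].
  destruct (analytic_uapprox g z0 Hg) as [r2 [P2 H2]].
  exists (Rmin r1 r2). split; [apply Rmin_pos; assumption|].
  split; eapply uapprox_weaken; eauto; [apply Rmin_l|apply Rmin_r].
Qed.

Lemma analytic_at_plus (f g : C -> C) (z0 : C) :
  analytic_at f z0 -> analytic_at g z0 -> analytic_at (fun z => f z + g z)%C z0.
Proof.
  intros Hf Hg. destruct (analytic_at_combine f g z0 Hf Hg) as [r [P [H1 H2]]].
  apply uapprox_analytic with r; [exact P|]. apply uapprox_plus; assumption.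
Qed.

Lemma analytic_at_mult_Cexp (f g : C -> C) (z0 : C) :
  analytic_at f z0 -> analytic_at g z0 -> analytic_at (fun z => f z * Cexp (g z))%C z0.
Proof.
  intros Hf Hg. destruct (analytic_at_combine f g z0 Hf Hg) as [r [P [H1 H2]]].
  apply uapprox_analytic with r; [exact P|].
  apply uapprox_mult; [lra|exact H1|]. apply uapprox_Cexp; [lra|exact H2].
Qed.

(** Vanishing on the right of s suffices: once the lower coefficients are 0, |u_n| h^n <= 2B
    (h/rho)^{n+1} for small h > 0, and dividing by h^n and letting h tend to 0 gives u_n = 0. The
    series then vanishes to the left of s as well. *)
Lemma analytic_at_zero (f : C -> C) (s : R) : analytic_at f (RtoC s) ->
  (forall t, s < t -> f (RtoC t) = RtoC 0) ->
  exists d, 0 < d /\ forall t, s - d <= t -> f (RtoC t) = RtoC 0.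
Proof.
  intros H Z. destruct (analytic_at_tail f _ H) as [u [B [rho [HB [Hrho T]]]]].
  assert (U : forall n m, (m < n)%nat -> u m = RtoC 0).
  { induction n as [|n IH]; intros m Hm; [lia|].
    destruct (Nat.eq_dec m n) as [->|Hne]; [|apply IH; lia].
    assert (G : forall h, 0 < h <= rho / 2 -> Cmod (u n) <= 2 * B / rho ^ S n * h).
    { intros h Hh. specialize (T (RtoC h) (S n)).
      rewrite Cmod_R, Rabs_pos_eq in T by lra. specialize (T ltac:(lra)).
      rewrite <- RtoC_plus, Z in T by lra. simpl csum in T.
      rewrite (csum_ext _ (fun _ => RtoC 0 * RtoC 0)%C) in T by (intros k Hk; rewrite (IH k Hk); ring).
      rewrite csum_scal, Cmult_0_l, Cplus_0_l in T. unfold Cminus in T. rewrite Cplus_0_l, Cmod_opp in T.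
      rewrite Cmod_mult, Cmod_pow, Cmod_R, Rabs_pos_eq in T by lra.
      assert (Ph : 0 < h ^ n) by (apply pow_lt; lra).
      apply Rmult_le_reg_r with (h ^ n); [exact Ph|]. eapply Rle_trans; [exact T|]. right.
      unfold Rdiv. rewrite Rpow_mult_distr, pow_inv. simpl. field. split; [apply pow_nonzero|]; lra. }
    apply Cmod_eq_0. apply Rle_antisym; [|apply Cmod_ge_0]. apply le_epsilon. intros e He.
    set (K := 2 * B / rho ^ S n).
    assert (HK : 0 <= K) by (apply Rmult_le_pos; [lra|left; apply Rinv_0_lt_compat, pow_lt, Hrho]).
    set (h := Rmin (rho / 2) (e / (K + 1))).
    assert (Hh : 0 < h) by (apply Rmin_pos; [lra|apply Rdiv_lt_0_compat; lra]).
    assert (Hh1 : h <= rho / 2) by apply Rmin_l. assert (Hh2 : h <= e / (K + 1)) by apply Rmin_r.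
    specialize (G h ltac:(lra)). fold K in G.
    assert (K * h <= (K + 1) * (e / (K + 1))) by (apply Rmult_le_compat; lra).
    replace ((K + 1) * (e / (K + 1))) with e in * by (field; lra). lra. }
  exists (rho / 4). split; [lra|]. intros t Ht.
  destruct (Rlt_or_le s t) as [L|L]; [apply Z, L|].
  set (h := t - s). assert (Hh : Cmod (RtoC h) <= rho / 4).
  { rewrite Cmod_R. unfold h. rewrite Rabs_left1 by lra. lra. }
  replace t with (s + h) by (unfold h; ring). rewrite RtoC_plus.
  apply Cmod_eq_0. apply Rle_antisym; [|apply Cmod_ge_0]. apply le_epsilon. intros e He.
  destruct (half_pow_small (2 * B) e He) as [N HN].
  specialize (T (RtoC h) N ltac:(lra)).
  rewrite (csum_ext _ (fun _ => RtoC 0 * RtoC 0)%C) in T by (intros k Hk; rewrite (U N k Hk); ring).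
  rewrite csum_scal, Cmult_0_l in T. unfold Cminus in T. rewrite Copp_0, Cplus_0_r in T.
  rewrite Rplus_0_l. eapply Rle_trans; [exact T|]. eapply Rle_trans; [|exact HN].
  apply Rmult_le_compat_l; [lra|]. apply pow_incr. split.
  - apply Rmult_le_pos; [apply Cmod_ge_0|left; apply Rinv_0_lt_compat, Hrho].
  - apply Rmult_le_reg_r with rho; [exact Hrho|]. unfold Rdiv. rewrite Rmult_assoc, Rinv_l; lra.
Qed.

Lemma analytic_ray_identity (f : C -> C) (t1 : R) :
  (forall t, t1 <= t -> analytic_at f (RtoC t)) ->
  ev (fun t => f (RtoC t) = RtoC 0) -> forall t, t1 <= t -> f (RtoC t) = RtoC 0.
Proof.
  intros HA [X HX].
  (* The left end of the zero ray is an infimum; it is reflected because [completeness] provides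
     suprema. *)
  set (E := fun y => y <= - t1 /\ forall t, - y <= t -> f (RtoC t) = RtoC 0).
  destruct (completeness E) as [y [Hub Hlub]].
  { exists (- t1). intros y [Hy _]. exact Hy. }
  { exists (- Rmax X t1). assert (A := Rmax_l X t1). assert (B := Rmax_r X t1).
    split; [lra|]. intros t Ht. apply HX. lra. }
  assert (Hy : y <= - t1) by (apply Hlub; intros x [Hx _]; exact Hx).
  assert (Z : forall t, - y < t -> f (RtoC t) = RtoC 0).
  { intros t Ht. destruct (classic (exists x, E x /\ - t < x)) as [[x [[_ Hx] Hxt]]|N].
    - apply Hx. lra.
    - exfalso. assert (y <= - t); [|lra]. apply Hlub. intros x Hx.
      apply Rnot_lt_le. intros L. apply N. exists x. auto. }
  destruct (analytic_at_zero f (- y) (HA (- y) ltac:(lra)) Z) as [d [Hd HZ]].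
  destruct (Rle_or_lt (- t1) (y + d)) as [L|L].
  - intros t Ht. apply HZ. lra.
  - exfalso. assert (Q : y + d <= y); [|lra]. apply Hub. split; [lra|].
    intros t Ht. apply HZ. lra.
Qed.

(** * Expansions on the scale exp (- lambda exp t) *)

Lemma ev_exp_scale (P : R -> Prop) : ev P -> ev (fun t => P (exp t)).
Proof.
  intros [X HX]. exists X. intros t Ht. apply HX. assert (E := exp_ineq1_le t). lra.
Qed.

Lemma ev_dexp (a b k k' : R) : k < k' ->
  ev (fun t => exp (a * t + b) * exp (k * exp t) <= exp (k' * exp t)).
Proof.
  intros Hk. apply (ev_mono _ _ (ev_affine_le_exp (k' - k) 1 a b ltac:(lra) Rlt_0_1)).
  intros t Ht. rewrite <- exp_plus. apply exp_mono. rewrite Rmult_1_l in Ht. lra.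
Qed.

Lemma ev_dexp_const (C k k' : R) : k < k' ->
  ev (fun t => C * exp (k * exp t) <= exp (k' * exp t)).
Proof.
  intros Hk. apply (ev_mono _ _ (ev_dexp 0 C k k' Hk)). intros t Ht.
  eapply Rle_trans; [|exact Ht]. apply Rmult_le_compat_r; [left; apply exp_pos|].
  rewrite Rmult_0_l, Rplus_0_l. assert (E := exp_ineq1_le C). lra.
Qed.

(* Abstract form of [psi o exp] for [psi] in [FC10]; unlike the definition of
   [FC10] it is visibly closed under addition. *)
Definition graded (S : R -> C) : Prop :=
  exists a B, 0 <= B /\
  forall lambda, 0 < lambda -> exists mu0, forall mu, mu0 <= mu -> 0 < mu ->
    exists (F : C -> C) (l : list item) (eta : R),
      0 < eta /\ Forall valid l /\
      (forall it, In it l -> ev (fun t => - (mu - eta) * exp t <= fst it t)) /\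
      (forall t, a <= t -> analytic_at F (RtoC t)) /\
      ev (fun t => F (RtoC t) = isum l t) /\
      (forall t, a <= t -> Cmod (S t - F (RtoC t))%C <= B * exp (- lambda * exp t)) /\
      (forall d, 0 < d -> ev (fun t => Cmod (S t - F (RtoC t))%C <= exp (- (mu - d) * exp t))).

(** Both expansions have to be cut at the same level [mu]; this is possible because [graded] offers
    a cut at every sufficiently large [mu], not at one depending on the function. *)
Lemma graded_plus (S1 S2 : R -> C) : graded S1 -> graded S2 -> graded (fun t => S1 t + S2 t)%C.
Proof.
  intros [a1 [C1 [HC1 H1]]] [a2 [C2 [HC2 H2]]].
  exists (Rmax a1 a2), (C1 + C2). split; [lra|]. intros lam Hlam.
  destruct (H1 lam Hlam) as [m1 K1]. destruct (H2 lam Hlam) as [m2 K2].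
  exists (Rmax m1 m2). intros mu Hmu Hmu0.
  assert (A1 := Rmax_l m1 m2). assert (A2 := Rmax_r m1 m2).
  assert (B1 := Rmax_l a1 a2). assert (B2 := Rmax_r a1 a2).
  destruct (K1 mu ltac:(lra) Hmu0) as [F1 [l1 [e1 [He1 [V1 [L1 [An1 [E1 [U1 W1]]]]]]]]].
  destruct (K2 mu ltac:(lra) Hmu0) as [F2 [l2 [e2 [He2 [V2 [L2 [An2 [E2 [U2 W2]]]]]]]]].
  exists (fun z => F1 z + F2 z)%C, (l1 ++ l2), (Rmin e1 e2).
  assert (D1 := Rmin_l e1 e2). assert (D2 := Rmin_r e1 e2).
  assert (EQ : forall t, (S1 t + S2 t - (F1 (RtoC t) + F2 (RtoC t)))%C
     = ((S1 t - F1 (RtoC t)) + (S2 t - F2 (RtoC t)))%C) by (intros; ring).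
  repeat split.
  - apply Rmin_pos; assumption.
  - apply Forall_app; auto.
  - intros it Hit. apply in_app_iff in Hit. destruct Hit as [Hit|Hit].
    + apply (ev_mono _ _ (L1 it Hit)). intros t Ht. assert (P := exp_pos t). nra.
    + apply (ev_mono _ _ (L2 it Hit)). intros t Ht. assert (P := exp_pos t). nra.
  - intros t Ht. apply analytic_at_plus; [apply An1|apply An2]; lra.
  - apply (ev_mono _ _ (ev_and _ _ E1 E2)). intros t [X Y]. rewrite isum_app, X, Y. reflexivity.
  - intros t Ht. rewrite EQ. eapply Rle_trans; [apply Cmod_triangle|].
    assert (X := U1 t ltac:(lra)). assert (Y := U2 t ltac:(lra)). lra.
  - intros d Hd.
    assert (Z := ev_dexp_const 2 (- (mu - d / 2)) (- (mu - d)) ltac:(lra)).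
    apply (ev_mono _ _ (ev_and _ _ Z (ev_and _ _ (W1 (d / 2) ltac:(lra)) (W2 (d / 2) ltac:(lra))))).
    intros t [X [Y Y']]. rewrite EQ. eapply Rle_trans; [apply Cmod_triangle|]. lra.
Qed.

Lemma graded_zero : graded (fun _ => RtoC 0).
Proof.
  exists 0, 0. split; [lra|]. intros lam _. exists 0. intros mu _ Hmu.
  assert (Z : Cmod (RtoC 0 - RtoC 0)%C = 0) by (unfold Cminus; rewrite Cplus_opp_r; apply Cmod_0).
  exists (fun _ => RtoC 0), nil, 1. repeat split; auto; try lra.
  - intros it [].
  - intros t _. apply uapprox_analytic with 1; [lra|apply uapprox_const].
  - exists 0; auto.
  - intros t _. rewrite Z. lra.
  - intros d _. exists 0. intros t _. rewrite Z. left; apply exp_pos.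
Qed.

Lemma normal_lower_bound (a : item) (l : list item) :
  normal (a :: l) -> ev (fun x => Cmod (ival a x) <= 2 * Cmod (isum (a :: l) x)).
Proof.
  intros [Hs [Hv Hn]]. inversion Hs; subst. inversion Hv; subst. inversion Hn; subst.
  apply (ev_mono _ _ (isum_tail_small a l (1 / 2) ltac:(assumption) ltac:(assumption) ltac:(assumption) ltac:(lra))).
  intros x Hx. simpl. assert (T := Cmod_plus_lower (ival a x) (isum l x)). lra.
Qed.

(** If the normal form of a cut has a leading item, that item exceeds the error of the cut and
    yields the lower bound with K = mu. Otherwise F vanishes near infinity, hence on the whole ray
    by analyticity. If this happens for every lambda, then |S t| <= C e^{-lambda e^t} at a fixed t
    for all lambda > 0, and S t = 0. *)
Lemma graded_dichotomy (S : R -> C) : graded S ->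
  ev (fun t => S t = RtoC 0) \/ exists K, ev (fun t => exp (- K * exp t) <= Cmod (S t)).
Proof.
  intros [a [C [HC H]]].
  destruct (classic (exists K, ev (fun t => exp (- K * exp t) <= Cmod (S t)))) as [Y|N]; [right; exact Y|left].
  exists a. intros t Ht. apply Cmod_eq_0. apply Rle_antisym; [|apply Cmod_ge_0].
  assert (G : forall lam, 0 < lam -> Cmod (S t) <= C * exp (- lam * exp t)).
  { intros lam Hlam. destruct (H lam Hlam) as [mu0 Hmu].
    set (mu := Rmax mu0 1). assert (M1 := Rmax_l mu0 1). assert (M2 := Rmax_r mu0 1). fold mu in M1, M2.
    destruct (Hmu mu M1 ltac:(lra)) as [F [l [eta [He [V [L [An [E [U W]]]]]]]]].
    destruct (item_normal_form l V) as [l' [Nf [I' E']]].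
    destruct l' as [|b l'].
    - assert (Z : ev (fun t => F (RtoC t) = RtoC 0)).
      { apply (ev_mono _ _ (ev_and _ _ E E')). intros x [X1 X2]. rewrite X1, <- X2. reflexivity. }
      assert (Z' := analytic_ray_identity F a An Z t Ht).
      specialize (U t Ht). rewrite Z' in U. unfold Cminus in U. rewrite Copp_0, Cplus_0_r in U. exact U.
    - exfalso. apply N. exists mu.
      assert (LB := normal_lower_bound b l' Nf).
      destruct Nf as [_ [_ Hn]]. inversion Hn as [|? ? Hn1 _]; subst.
      destruct Hn1 as [m [c1 [c2 [Hc1 [_ Hp]]]]].
      destruct (I' b (or_introl eq_refl)) as [b' [Hb' Eb]].
      assert (Lb := L b' Hb'). rewrite <- Eb in Lb.
      (* The rates mu - eta < mu - eta/2 < mu - eta/4 < mu separate the leading item from the error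
         and from the claimed lower bound; the gaps absorb e^{mx} and the constants. *)
      assert (Q1 := W (eta / 4) ltac:(lra)).
      assert (Q2 := ev_dexp (- m) (ln (2 / c1)) (- (mu - eta / 2)) (- (mu - eta)) ltac:(lra)).
      assert (Q3 := ev_dexp_const 2 (- (mu - eta / 4)) (- (mu - eta / 2)) ltac:(lra)).
      assert (Q4 := ev_dexp_const 2 (- mu) (- (mu - eta / 2)) ltac:(lra)).
      apply (ev_mono _ _ (ev_and _ _ E (ev_and _ _ E' (ev_and _ _ LB (ev_and _ _ Hp
        (ev_and _ _ Lb (ev_and _ _ Q1 (ev_and _ _ Q2 (ev_and _ _ Q3 Q4))))))))).
      intros x [X1 [X2 [X3 [[X4 _] [X5 [X6 [X7 [X8 X9]]]]]]]].
      rewrite Cmod_ival, X2, <- X1 in X3.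
      assert (Y1 : c1 * exp (m * x) * exp (- (mu - eta) * exp x) <= 2 * Cmod (F (RtoC x))).
      { eapply Rle_trans; [|exact X3]. apply Rmult_le_compat; [|left; apply exp_pos|exact X4|apply exp_mono, X5].
        apply Rmult_le_pos; [lra|left; apply exp_pos]. }
      assert (Y2 : 2 * exp (- (mu - eta / 2) * exp x) <= c1 * exp (m * x) * exp (- (mu - eta) * exp x)).
      { rewrite exp_plus, exp_ln in X7 by (apply Rdiv_lt_0_compat; lra).
        replace (2 * exp (- (mu - eta / 2) * exp x)) with
          (c1 * exp (m * x) * (exp (- m * x) * (2 / c1) * exp (- (mu - eta / 2) * exp x))).
        - apply Rmult_le_compat_l; [|exact X7]. apply Rmult_le_pos; [lra|left; apply exp_pos].
        - assert (P : exp (m * x) * exp (- m * x) = 1).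
          { rewrite <- exp_plus. replace (m * x + - m * x) with 0 by ring. apply exp_0. }
          transitivity (exp (m * x) * exp (- m * x) * (2 * exp (- (mu - eta / 2) * exp x))); [field; lra|].
          rewrite P. ring. }
      assert (T := Cmod_triangle (F (RtoC x) - S x)%C (S x)).
      replace (F (RtoC x) - S x + S x)%C with (F (RtoC x)) in T by ring.
      rewrite (Cmod_minus_sym (F (RtoC x))) in T. lra. }
  apply Rnot_lt_le. intros C0.
  assert (Pt := exp_pos t).
  destruct (ev_exp_dominated (Cmod (S t) / 2) C (- exp t) 0 ltac:(lra) ltac:(lra)) as [X HX].
  specialize (HX (Rmax X 1) (Rmax_l _ _)). assert (M := Rmax_r X 1).
  specialize (G (Rmax X 1) ltac:(lra)).
  rewrite Rmult_0_l, exp_0 in HX.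
  replace (- exp t * Rmax X 1) with (- Rmax X 1 * exp t) in HX by ring. lra.
Qed.

Lemma ln_halfplane_real (a x : R) : a <= exp x -> ln_halfplane a (RtoC x).
Proof.
  intros H. exists (RtoC (exp x)). assert (P := exp_pos x). split; [exact H|split].
  - intros E. apply (f_equal fst) in E. simpl in E. lra.
  - unfold Clog, Carg. rewrite Cmod_R, Rabs_pos_eq by lra. simpl.
    destruct (Rle_dec 0 0); [|lra].
    replace (exp x / exp x) with 1 by (field; lra). rewrite acos_1, ln_exp. reflexivity.
Qed.

(** Since [nu] may repeat values, the cut is placed at a strict crossing of K. This leaves a
    positive gap between K and the principal exponents that are kept. *)
Lemma first_below (nu : nat -> R) (K : R) (n0 : nat) :
  (forall q, nu (S q) <= nu q) -> is_lim_seq nu m_infty -> K < nu n0 ->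
  exists N, (n0 <= N)%nat /\ K < nu N /\ nu (S N) <= K.
Proof.
  intros Hd Hl H0. apply is_lim_seq_spec in Hl. destruct (Hl K) as [n1 Hn1].
  assert (G : forall j, (exists N, (n0 <= N)%nat /\ K < nu N /\ nu (S N) <= K) \/ K < nu (n0 + j)%nat).
  { induction j as [|j [IH|IH]]; [right; rewrite Nat.add_0_r; exact H0|left; exact IH|].
    destruct (Rlt_or_le K (nu (n0 + S j)%nat)) as [L|L]; [right; exact L|left].
    exists (n0 + j)%nat. rewrite <- plus_n_Sm in L. split; [lia|auto]. }
  destruct (G n1) as [Y|Y]; [exact Y|]. specialize (Hn1 (n0 + n1)%nat ltac:(lia)). lra.
Qed.

Lemma antitone_le (nu : nat -> R) (p q : nat) :
  (forall q, nu (S q) <= nu q) -> (p <= q)%nat -> nu q <= nu p.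
Proof. intros H L. induction L as [|q L IH]; [lra|]. specialize (H q). lra. Qed.

(** The exponents of the label other than 1 lie in (0, 1), so the label stays within d e^t of nu e^t
    for any d > 0. *)
Lemma term_factorization (k e : C -> C) (nu : R) : K10 k -> E1 e nu ->
  exists it, valid it /\
    (forall d, 0 < d -> ev (fun t => (nu - d) * exp t <= fst it t <= (nu + d) * exp t)) /\
    ev (fun t => (k (RtoC t) * Cexp (e (RtoC t)))%C = ival it t).
Proof.
  intros Hk He. destruct (E1_factorization e nu He) as [l [K [Hl [HK HE]]]].
  exists (fun x => nu * exp x + rsum l x, fun z => (k z * K z)%C). split; [|split].
  - split.
    + exists ((nu, 1) :: l). split.
      * intros q [<-|Hq]; [simpl; lra|]. apply Hl, Hq.
      * intros x. simpl. rewrite Rmult_1_l. reflexivity.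
    + apply expandable_mult; [apply K10_expandable, Hk|exact HK].
  - intros d Hd. assert (V := rsum_small 1 l d (fun p Hp => proj2 (Hl p Hp)) Hd).
    apply (ev_mono _ _ V). intros t Ht. rewrite Rmult_1_l in Ht. apply Rabs_le_between in Ht. simpl. lra.
  - apply (ev_mono _ _ HE). intros t Ht. rewrite Ht. unfold ival. simpl fst; simpl snd. ring.
Qed.

Lemma term_bound (k e : C -> C) (nu d : R) : K10 k -> E1 e nu -> 0 < d ->
  ev (fun t => Cmod (k (RtoC t) * Cexp (e (RtoC t)))%C <= exp ((nu + d) * exp t)).
Proof.
  intros Hk He Hd. destruct (term_factorization k e nu Hk He) as [it [[_ V] [B E]]].
  destruct (expandable_ev_bound _ V) as [B' [L HB]].
  assert (Q := ev_dexp L B' (nu + d / 2) (nu + d) ltac:(lra)).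
  apply (ev_mono _ _ (ev_and _ _ (B (d / 2) ltac:(lra)) (ev_and _ _ E (ev_and _ _ HB Q)))).
  intros t [[_ X1] [X2 [X3 X4]]]. rewrite X2, Cmod_ival.
  eapply Rle_trans; [|exact X4]. apply Rmult_le_compat; [apply Cmod_ge_0|left; apply exp_pos|exact X3|].
  apply exp_mono, X1.
Qed.

(** F is the partial sum up to the last rank with nu > -mu. Only finitely many terms have a given
    principal exponent, so the cut is finite even though exponents may be shared. *)
Lemma FC10_graded (psi : C -> C) : FC10 psi -> graded (fun t => psi (Cexp (RtoC t))).
Proof.
  intros [_ [a [k [e [nu [Ha [_ [Hk [He [Hd [Hl HA]]]]]]]]]]].
  set (T := fun N z => sum_n (fun q => k q z * Cexp (e q z))%C N).
  (* [ln (a + 1)] rather than [ln a], as a may be 0. *)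
  exists (ln (a + 1)), 1. split; [lra|]. intros lam Hlam.
  assert (Hray : forall t, ln (a + 1) <= t -> ln_halfplane a (RtoC t)).
  { intros t Ht. apply ln_halfplane_real. apply exp_mono in Ht. rewrite exp_ln in Ht; lra. }
  destruct (HA lam Hlam) as [N0 HN0].
  (* For such mu the level -mu lies below [nu N0], so the cut has rank at least N0 and the estimate
     for lambda holds for it on the whole ray. *)
  exists (1 - nu N0). intros mu Hmu Hmu0.
  destruct (first_below nu (- mu) N0 Hd Hl ltac:(lra)) as [N [HN [HN1 HN2]]].
  assert (Items : forall n, exists l, Forall valid l /\
     (forall it, In it l -> exists q, (q <= n)%nat /\ forall d, 0 < d -> ev (fun t => (nu q - d) * exp t <= fst it t)) /\
     ev (fun t => T n (RtoC t) = isum l t)).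
  { induction n as [|n [l [V [L E]]]].
    - destruct (term_factorization (k O) (e O) (nu O) (proj1 (Hk O)) (proj1 (He O))) as [it [V1 [L1 E1]]].
      exists (it :: nil). split; [|split].
      + constructor; auto.
      + intros it' [<-|[]]. exists O. split; [lia|]. intros d Hd'.
        apply (ev_mono _ _ (L1 d Hd')). intros t Ht. apply Ht.
      + apply (ev_mono _ _ E1). intros t Ht. unfold T. rewrite sum_O, Ht. simpl. ring.
    - destruct (term_factorization (k (S n)) (e (S n)) (nu (S n)) (proj1 (Hk (S n))) (proj1 (He (S n)))) as [it [V1 [L1 E1]]].
      exists (it :: l). split; [|split].
      + constructor; auto.
      + intros it' [<-|Hit].
        * exists (S n). split; [lia|]. intros d Hd'.
          apply (ev_mono _ _ (L1 d Hd')). intros t Ht. apply Ht.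
        * destruct (L it' Hit) as [q [Hq Hq']]. exists q. split; [lia|exact Hq'].
      + apply (ev_mono _ _ (ev_and _ _ E E1)). intros t [Ht Ht']. unfold T in *. rewrite sum_Sn, Ht, Ht'.
        change (plus ?u ?v) with (Cplus u v). simpl. ring. }
  assert (Tails : forall j d, 0 < d -> ev (fun t => Cmod (T (N + j)%nat (RtoC t) - T N (RtoC t))%C <= exp (- (mu - d) * exp t))).
  { induction j as [|j IH]; intros d Hd'.
    - exists 0. intros t _. rewrite Nat.add_0_r. unfold Cminus. rewrite Cplus_opp_r, Cmod_0. left; apply exp_pos.
    - assert (B := term_bound _ _ (nu (N + S j)%nat) (d / 2) (proj1 (Hk (N + S j)%nat)) (proj1 (He (N + S j)%nat)) ltac:(lra)).
      assert (Z := ev_dexp_const 2 (- (mu - d / 2)) (- (mu - d)) ltac:(lra)).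
      apply (ev_mono _ _ (ev_and _ _ (IH (d / 2) ltac:(lra)) (ev_and _ _ B Z))).
      intros t [X1 [X2 X3]]. rewrite <- plus_n_Sm in *. unfold T in *. rewrite sum_Sn.
      change (plus ?u ?v) with (Cplus u v).
      match goal with |- Cmod (?u + ?v - ?w)%C <= _ => replace (u + v - w)%C with ((u - w) + v)%C by ring end.
      eapply Rle_trans; [apply Cmod_triangle|].
      assert (M := antitone_le nu (S N) (S (N + j)) Hd ltac:(lia)).
      assert (Y : exp ((nu (S (N + j)) + d / 2) * exp t) <= exp (- (mu - d / 2) * exp t)).
      { apply exp_mono. apply Rmult_le_compat_r; [left; apply exp_pos|]. lra. }
      lra. }
  destruct (Items N) as [l [V [L E]]].
  (* Half the gap between [nu N] and -mu: the other half covers the lower-order part of each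
     label. *)
  exists (T N), l, ((nu N + mu) / 2). repeat split.
  - lra.
  - exact V.
  - intros it Hit. destruct (L it Hit) as [q [Hq Hq']].
    apply (ev_mono _ _ (Hq' ((nu N + mu) / 2) ltac:(lra))). intros t Ht.
    eapply Rle_trans; [|exact Ht]. apply Rmult_le_compat_r; [left; apply exp_pos|].
    assert (M := antitone_le nu q N Hd Hq). lra.
  - intros t Ht. unfold T. specialize (Hray t Ht). clear - Hk He Hray.
    assert (G : forall q, analytic_at (fun z => k q z * Cexp (e q z))%C (RtoC t)).
    { intros q. apply analytic_at_mult_Cexp; [apply (proj2 (Hk q))|apply (proj2 (He q))]; exact Hray. }
    assert (X : forall n, exists r, 0 < r /\ uapprox (fun z => sum_n (fun q => k q z * Cexp (e q z))%C n) (RtoC t) r).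
    { intros n. apply analytic_uapprox. induction n as [|n IH].
      - destruct (analytic_uapprox _ _ (G O)) as [r [Hr U]]. apply uapprox_analytic with r; [exact Hr|].
        intros d Hd. destruct (U d Hd) as [p Hp]. exists p. intros h Hh. rewrite sum_O. apply Hp, Hh.
      - destruct (analytic_uapprox _ _ (analytic_at_plus _ _ _ IH (G (S n)))) as [r [Hr U]].
        apply uapprox_analytic with r; [exact Hr|].
        intros d Hd. destruct (U d Hd) as [p Hp]. exists p. intros h Hh. rewrite sum_Sn. apply Hp, Hh. }
    destruct (X N) as [r [Hr U]]. apply uapprox_analytic with r; assumption.
  - exact E.
  - intros t Ht. rewrite Rmult_1_l. left. specialize (HN0 N HN t (Hray t Ht)).
    rewrite Cexp_RtoC in *. exact HN0.
  (* A longer partial sum is accurate to rate mu; the finitely many terms in between have nu <= -mu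
     and cost only an arbitrarily small loss d in the rate. *)
  - intros d Hd'. destruct (HA mu Hmu0) as [N1 HN1'].
    set (j := (N1 - N)%nat). specialize (HN1' (N + j)%nat ltac:(unfold j; lia)).
    assert (Z := ev_dexp_const 2 (- (mu - d / 2)) (- (mu - d)) ltac:(lra)).
    apply (ev_mono _ _ (ev_and _ _ (ev_ge (ln (a + 1))) (ev_and _ _ (Tails j (d / 2) ltac:(lra)) Z))).
    intros t [X1 [X2 X3]]. specialize (HN1' t (Hray t X1)).
    replace (psi (Cexp (RtoC t)) - T N (RtoC t))%C
      with ((psi (Cexp (RtoC t)) - T (N + j)%nat (RtoC t)) + (T (N + j)%nat (RtoC t) - T N (RtoC t)))%C by ring.
    eapply Rle_trans; [apply Cmod_triangle|].
    assert (Y : exp (- mu * Re (Cexp (RtoC t))) <= exp (- (mu - d / 2) * exp t)).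
    { rewrite Cexp_RtoC. apply exp_mono. simpl Re. assert (P := exp_pos t). nra. }
    unfold T in *. lra.
Qed.

(** * Flatness and separation of the scales alpha *)

Definition flat_at (alpha : R) (f : R -> C) : Prop :=
  exists eps, 0 < eps /\ ev (fun x => Cmod (f x) <= exp (- eps * exp (alpha * x))).

Lemma FC10_flat (psi : C -> C) : FC10 psi -> flat_at 1 (fun t => psi (Cexp (RtoC t))).
Proof.
  intros [[eps [M [x0 [Heps H]]]] _]. exists (eps / 2). split; [lra|].
  assert (Z := ev_dexp_const M (- eps) (- (eps / 2)) ltac:(lra)).
  assert (Y := ev_exp_scale _ (ev_ge x0)).
  apply (ev_mono _ _ (ev_and _ _ Y Z)). intros t [X1 X2]. rewrite Cexp_RtoC, Rmult_1_l.
  eapply Rle_trans; [apply H, X1|exact X2].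
Qed.

Lemma flat_at_le (a b : R) (f : R -> C) : a <= b -> flat_at b f -> flat_at a f.
Proof.
  intros L [e [He H]]. exists e. split; [exact He|].
  apply (ev_mono _ _ (ev_and _ _ (ev_ge 0) H)). intros x [X1 X2].
  eapply Rle_trans; [exact X2|]. apply exp_mono.
  assert (exp (a * x) <= exp (b * x)) by (apply exp_mono; nra). nra.
Qed.

Lemma flat_at_ext (a : R) (f g : R -> C) : ev (fun x => f x = g x) -> flat_at a f -> flat_at a g.
Proof.
  intros E [e [He H]]. exists e. split; [exact He|].
  apply (ev_mono _ _ (ev_and _ _ E H)). intros x [X1 X2]. rewrite <- X1. exact X2.
Qed.

Lemma flat_at_plus (a : R) (f g : R -> C) : 0 < a ->
  flat_at a f -> flat_at a g -> flat_at a (fun x => f x + g x)%C.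
Proof.
  intros Ha [e1 [He1 H1]] [e2 [He2 H2]]. set (e := Rmin e1 e2).
  assert (A1 := Rmin_l e1 e2). assert (A2 := Rmin_r e1 e2). fold e in A1, A2.
  assert (Pe : 0 < e) by (apply Rmin_pos; assumption).
  exists (e / 2). split; [lra|].
  assert (Z := ev_scale _ a Ha (ev_dexp_const 2 (- e) (- (e / 2)) ltac:(lra))).
  apply (ev_mono _ _ (ev_and _ _ H1 (ev_and _ _ H2 Z))). intros x [X1 [X2 X3]].
  eapply Rle_trans; [apply Cmod_triangle|]. eapply Rle_trans; [|exact X3].
  assert (P := exp_pos (a * x)).
  assert (exp (- e1 * exp (a * x)) <= exp (- e * exp (a * x))) by (apply exp_mono; nra).
  assert (exp (- e2 * exp (a * x)) <= exp (- e * exp (a * x))) by (apply exp_mono; nra).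
  lra.
Qed.

Lemma flat_at_opp (a : R) (f : R -> C) : flat_at a f -> flat_at a (fun x => - f x)%C.
Proof.
  intros [e [He H]]. exists e. split; [exact He|].
  apply (ev_mono _ _ H). intros x Hx. rewrite Cmod_opp. exact Hx.
Qed.

Lemma flat_at_minus (a : R) (f g : R -> C) : 0 < a ->
  flat_at a f -> flat_at a g -> flat_at a (fun x => f x - g x)%C.
Proof.
  intros Ha Hf Hg. apply (flat_at_plus a f (fun x => - g x)%C Ha Hf). apply flat_at_opp, Hg.
Qed.

Lemma flat_at_scale (a : R) (f : R -> C) : 0 < a ->
  flat_at 1 f -> flat_at a (fun x => f (a * x)).
Proof.
  intros Ha [e [He H]]. exists e. split; [exact He|].
  apply (ev_mono _ _ (ev_scale _ a Ha H)). intros x Hx. rewrite Rmult_1_l in Hx. exact Hx.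
Qed.

Definition scaled_sum (l : list ((R -> C) * R)) (x : R) : C :=
  fold_right (fun p acc => fst p (snd p * x)%R + acc)%C (RtoC 0) l.

(** The minimum of finitely many scales, all above b, is still strictly above b. The cap g allows
    comparison with functions flat at g. *)
Lemma flat_at_scaled_sum (b g : R) (l : list ((R -> C) * R)) : 0 <= b < g ->
  (forall p, In p l -> flat_at 1 (fst p) /\ b < snd p) ->
  exists b', b < b' <= g /\ flat_at b' (scaled_sum l).
Proof.
  intros Hb. induction l as [|p l IH]; intros H.
  - exists g. split; [lra|]. exists 1. split; [lra|]. exists 0. intros x _. simpl.
    rewrite Cmod_0. left; apply exp_pos.
  - destruct IH as [b1 [Hb1 F1]]; [intros q Hq; apply H; simpl; auto|].
    destruct (H p (or_introl eq_refl)) as [Fp Hp].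
    exists (Rmin b1 (snd p)). assert (A1 := Rmin_l b1 (snd p)). assert (A2 := Rmin_r b1 (snd p)).
    assert (A3 : b < Rmin b1 (snd p)) by (apply Rmin_glb_lt; lra).
    split; [lra|]. simpl.
    apply (flat_at_plus _ (fun x => fst p (snd p * x)) (scaled_sum l)); [lra| |].
    + apply (flat_at_le _ (snd p)); [exact A2|]. apply flat_at_scale; [lra|exact Fp].
    + apply (flat_at_le _ b1); assumption.
Qed.

Lemma filter_length_lt (A : Type) (f : A -> bool) (l : list A) (p : A) :
  In p l -> f p = false -> (length (filter f l) < length l)%nat.
Proof.
  induction l as [|a l IH]; intros Hp Hf; [destruct Hp|]. simpl.
  destruct Hp as [<-|Hp].
  - rewrite Hf. assert (L := filter_length_le f l). lia.
  - specialize (IH Hp Hf). destruct (f a); simpl; lia.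
Qed.

Lemma scaled_sum_filter (f : (R -> C) * R -> bool) (l : list ((R -> C) * R)) (x : R) :
  scaled_sum l x = (scaled_sum (filter f l) x + scaled_sum (filter (fun p => negb (f p)) l) x)%C.
Proof.
  induction l as [|p l IH]; [simpl; ring|].
  simpl. rewrite IH. destruct (f p); simpl; ring.
Qed.

Lemma list_min_exists (l : list ((R -> C) * R)) : l <> nil ->
  exists p, In p l /\ forall q, In q l -> snd p <= snd q.
Proof.
  induction l as [|a l IH]; intros H; [congruence|].
  destruct l as [|b l].
  - exists a. split; [simpl; auto|]. intros q [<-|[]]. lra.
  - destruct IH as [p [Hp Hm]]; [congruence|].
    destruct (Rle_or_lt (snd a) (snd p)) as [L|L].
    + exists a. split; [simpl; auto|]. intros q [<-|Hq]; [lra|]. specialize (Hm q Hq). lra.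
    + exists p. split; [simpl; auto|]. intros q [<-|Hq]; [lra|]. auto.
Qed.

Lemma scaled_sum_group (b : R) (l : list ((R -> C) * R)) :
  (forall p, In p l -> snd p = b /\ graded (fst p)) ->
  exists S, graded S /\ forall x, scaled_sum l x = S (b * x).
Proof.
  induction l as [|p l IH]; intros H.
  - exists (fun _ => RtoC 0). split; [apply graded_zero|reflexivity].
  - destruct IH as [S [HS E]]; [intros q Hq; apply H; simpl; auto|].
    destruct (H p (or_introl eq_refl)) as [Eb G].
    exists (fun t => fst p t + S t)%C. split; [apply graded_plus; assumption|].
    intros x. simpl. rewrite E, Eb. reflexivity.
Qed.

(* The terms of smallest scale cannot be cancelled by the others, so they
   cancel among themselves; recursion on the rest. *)
Lemma scaled_sum_flat_zero (g : R) (n : nat) (l : list ((R -> C) * R)) :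
  (length l <= n)%nat ->
  (forall p, In p l -> graded (fst p) /\ flat_at 1 (fst p) /\ 0 < snd p < g) ->
  flat_at g (scaled_sum l) -> ev (fun x => scaled_sum l x = RtoC 0).
Proof.
  revert l. induction n as [|n IH]; intros l Hn H Hf.
  { destruct l; [|simpl in Hn; lia]. exists 0; reflexivity. }
  destruct (classic (l = nil)) as [->|Hl]; [exists 0; reflexivity|].
  destruct (list_min_exists l Hl) as [p0 [Hp0 Hmin]]. set (b := snd p0) in *.
  set (f := fun p : (R -> C) * R => if Rlt_dec b (snd p) then true else false).
  set (l2 := filter f l). set (l1 := filter (fun p => negb (f p)) l).
  assert (Hb : 0 < b < g) by (apply (H p0 Hp0)).
  destruct (flat_at_scaled_sum b g l2 ltac:(lra)) as [b' [Hb' F2]].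
  { intros p Hp. apply filter_In in Hp. destruct Hp as [Hp Hfp].
    split; [apply H, Hp|]. unfold f in Hfp. destruct (Rlt_dec b (snd p)); [assumption|discriminate]. }
  destruct (scaled_sum_group b l1) as [S [GS ES]].
  { intros p Hp. apply filter_In in Hp. destruct Hp as [Hp Hfp].
    split; [|apply H, Hp]. specialize (Hmin p Hp). unfold f in Hfp.
    destruct (Rlt_dec b (snd p)); [discriminate|lra]. }
  assert (Esum : forall x, scaled_sum l x = (scaled_sum l2 x + S (b * x)%R)%C).
  { intros x. rewrite <- ES. apply scaled_sum_filter. }
  assert (FS : flat_at b' (fun x => S (b * x))).
  { apply (flat_at_ext b' (fun x => scaled_sum l x - scaled_sum l2 x)%C).
    - exists 0. intros x _. rewrite Esum. ring.
    - apply flat_at_minus; [lra|apply (flat_at_le _ g); [lra|exact Hf]|exact F2]. }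
  assert (ZS : ev (fun x => S (b * x) = RtoC 0)).
  (* A lower bound e^{-K e^{bx}} contradicts flatness at the strictly larger scale b'. *)
  { destruct (graded_dichotomy S GS) as [Z|[K HK]].
    - apply (ev_scale (fun t => S t = RtoC 0) b ltac:(lra) Z).
    - exfalso. destruct FS as [e [He FS]].
      apply (ev_scale _ b ltac:(lra)) in HK.
      assert (D := ev_exp_dominated (e / 2) K b b' ltac:(lra) ltac:(lra)).
      destruct (ev_and _ _ FS (ev_and _ _ HK D)) as [X HX].
      destruct (HX X (Rle_refl _)) as [X1 [X2 X3]].
      assert (Q : exp (- K * exp (b * X)) <= exp (- e * exp (b' * X))) by lra.
      apply exp_mono_inv in Q. assert (P := exp_pos (b' * X)). nra. }
  assert (Z2 : ev (fun x => scaled_sum l2 x = RtoC 0)).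
  { apply IH.
    - assert (L : (length l2 < length l)%nat).
      { apply filter_length_lt with p0; [exact Hp0|]. unfold f, b. destruct (Rlt_dec (snd p0) (snd p0)); [lra|reflexivity]. }
      lia.
    - intros p Hp. apply filter_In in Hp. apply H, Hp.
    - apply (flat_at_ext g (scaled_sum l)); [|exact Hf].
      apply (ev_mono _ _ ZS). intros x Hx. rewrite Esum, Hx. ring. }
  apply (ev_mono _ _ (ev_and _ _ ZS Z2)). intros x [X1 X2]. rewrite Esum, X1, X2. ring.
Qed.

Lemma power_like_not_flat (f : R -> C) (b : R) : 0 < b -> power_like f -> flat_at b f -> False.
Proof.
  intros Hb [m [c1 [c2 [Hc1 [_ H]]]]] [e [He F]].
  assert (D := ev_affine_le_exp e b (- m) (1 - ln c1) He Hb).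
  destruct (ev_and _ _ H (ev_and _ _ F D)) as [X HX].
  destruct (HX X (Rle_refl _)) as [[X1 _] [X2 X3]].
  assert (Q : exp (ln c1 + m * X) <= exp (- e * exp (b * X))).
  { rewrite exp_plus, exp_ln by exact Hc1. lra. }
  apply exp_mono_inv in Q. lra.
Qed.

Lemma K11_leading_scale (g : R -> C) (a : R) : 0 < a -> flat_at a g -> K11 g ->
  exists H r c, graded H /\ a < c /\ flat_at c r /\ ev (fun x => g x = (H (a * x)%R + r x)%C).
Proof.
  intros Ha Fg [phi [N [psi [alpha [Hphi [Hpsi [x0 E]]]]]]].
  assert (L : exists l, (forall p, In p l -> graded (fst p) /\ flat_at 1 (fst p) /\ 0 < snd p) /\
    forall x, sum_n_m (fun q => psi q (RtoC (exp (m (alpha q) x)))) 1 N = scaled_sum l x).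
  { clear E. induction N as [|N IH].
    - exists nil. split; [intros p []|]. intros x. rewrite sum_n_m_zero by lia. reflexivity.
    - destruct IH as [l [Hl El]]; [intros q Hq; apply Hpsi; lia|].
      destruct (Hpsi (S N) ltac:(lia)) as [HF Hal].
      exists ((fun t => psi (S N) (Cexp (RtoC t)), alpha (S N)) :: l). split.
      + intros p [<-|Hp]; [|auto]. simpl. split; [apply FC10_graded, HF|split; [apply FC10_flat, HF|lra]].
      + intros x. rewrite sum_n_Sm, El by lia. change (plus ?u ?v) with (Cplus u v).
        simpl. rewrite Cexp_RtoC. unfold m. ring. }
  destruct L as [l [Hl El]].
  assert (E' : forall x, x0 <= x -> g x = (phi (RtoC x) + scaled_sum l x)%C).
  { intros x Hx. rewrite E by exact Hx. rewrite El. reflexivity. }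
  (* g and all terms of the sum are flat at some positive scale, whereas a nonvanishing [phi] is
     comparable to a single exponential e^{mx}. *)
  assert (Zphi : ev (fun x => phi (RtoC x) = RtoC 0)).
  { destruct (expandable_dichotomy phi (K10_expandable phi Hphi)) as [Z|Z]; [exact Z|exfalso].
    destruct (flat_at_scaled_sum 0 a l ltac:(lra)) as [b [Hb F]].
    { intros p Hp. split; apply (Hl p Hp). }
    apply (power_like_not_flat _ b ltac:(lra) Z).
    apply (flat_at_ext b (fun x => g x - scaled_sum l x)%C).
    - exists x0. intros x Hx. rewrite E' by exact Hx. ring.
    - apply flat_at_minus; [lra|apply (flat_at_le _ a); [lra|exact Fg]|exact F]. }
  set (f1 := fun p : (R -> C) * R => if Rlt_dec (snd p) a then true else false).
  set (f2 := fun p : (R -> C) * R => if Rlt_dec a (snd p) then true else false).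
  set (lt := filter f1 l). set (le := filter (fun p => negb (f1 p)) l).
  set (gt := filter f2 le). set (eq := filter (fun p => negb (f2 p)) le).
  destruct (scaled_sum_group a eq) as [H [GH EH]].
  { intros p Hp. apply filter_In in Hp. destruct Hp as [Hp Hf2].
    apply filter_In in Hp. destruct Hp as [Hp Hf1]. split; [|apply Hl, Hp].
    unfold f1 in Hf1. unfold f2 in Hf2.
    destruct (Rlt_dec (snd p) a); [discriminate|]. destruct (Rlt_dec a (snd p)); [discriminate|]. lra. }
  destruct (flat_at_scaled_sum a (a + 1) gt ltac:(lra)) as [c [Hc Fc]].
  { intros p Hp. apply filter_In in Hp. destruct Hp as [Hp Hf2].
    apply filter_In in Hp. destruct Hp as [Hp _]. split; [apply Hl, Hp|].
    unfold f2 in Hf2. destruct (Rlt_dec a (snd p)); [assumption|discriminate]. }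
  assert (Es : forall x, scaled_sum l x = (scaled_sum lt x + (scaled_sum gt x + H (a * x)%R))%C).
  { intros x. rewrite <- EH. rewrite (scaled_sum_filter f1 l). f_equal. apply scaled_sum_filter. }
  assert (Feq : flat_at a (fun x => H (a * x))).
  { apply (flat_at_ext a (scaled_sum eq)); [exists 0; intros x _; apply EH|].
    assert (G : forall p, In p eq -> flat_at 1 (fst p) /\ snd p = a).
    { intros p Hp. apply filter_In in Hp. destruct Hp as [Hp Hf2].
      apply filter_In in Hp. destruct Hp as [Hp Hf1]. split; [apply Hl, Hp|].
      unfold f1 in Hf1. unfold f2 in Hf2.
      destruct (Rlt_dec (snd p) a); [discriminate|]. destruct (Rlt_dec a (snd p)); [discriminate|]. lra. }
    clear - G Ha. induction eq as [|p eq IH].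
    - exists 1. split; [lra|]. exists 0. intros x _. simpl. rewrite Cmod_0. left; apply exp_pos.
    - destruct (G p (or_introl eq_refl)) as [F Ep].
      simpl. apply (flat_at_plus a (fun x => fst p (snd p * x)) (scaled_sum eq) Ha).
      + rewrite Ep. apply flat_at_scale; assumption.
      + apply IH. intros q Hq. apply G; simpl; auto. }
  (* The slower part equals g minus the parts at scale a and above, hence is itself flat at a and
     must vanish. *)
  assert (Zlt : ev (fun x => scaled_sum lt x = RtoC 0)).
  { apply (scaled_sum_flat_zero a (length lt)); [lia| |].
    - intros p Hp. apply filter_In in Hp. destruct Hp as [Hp Hf].
      destruct (Hl p Hp) as [G1 [G2 G3]]. split; [exact G1|split; [exact G2|split; [exact G3|]]].
      unfold f1 in Hf. destruct (Rlt_dec (snd p) a); [assumption|discriminate].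
    - apply (flat_at_ext a (fun x => (g x - scaled_sum gt x) - H (a * x)%R)%C).
      + apply (ev_mono _ _ (ev_and _ _ (ev_ge x0) Zphi)). intros x [X1 X2].
        rewrite E' by exact X1. rewrite X2, Es. ring.
      + apply (flat_at_minus a (fun x => g x - scaled_sum gt x)%C (fun x => H (a * x)) Ha); [|exact Feq].
        apply flat_at_minus; [exact Ha|exact Fg|]. apply (flat_at_le _ c); [lra|exact Fc]. }
  exists H, (scaled_sum gt), c. split; [exact GH|split; [lra|split; [exact Fc|]]].
  apply (ev_mono _ _ (ev_and _ _ (ev_ge x0) (ev_and _ _ Zphi Zlt))). intros x [X1 [X2 X3]].
  rewrite E' by exact X1. rewrite X2, Es, X3. ring.
Qed.

(** * Finite sums of items against infinite expansions *)

Lemma nonzero_ev_pos (a : item) : nonzero a -> ev (fun x => 0 < Cmod (ival a x)).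
Proof.
  intros [m [c1 [c2 [Hc1 [_ H]]]]]. apply (ev_mono _ _ H). intros x [X _]. rewrite Cmod_ival.
  assert (P1 := exp_pos (m * x)). assert (P2 := exp_pos (fst a x)).
  apply Rmult_lt_0_compat; [|exact P2]. nra.
Qed.

(** Rank r itself is excluded: r is the number of terms already matched. *)
Definition term_range (T : nat -> item) (r R0 : nat) : list item := map T (seq (S r) (R0 - r)).

(* Each [T n] has to be cancelled by an item of [l] with the same label, which is
   thereby used up. *)
Lemma no_infinite_expansion (T : nat -> item) (l : list item) (r : nat) :
  (forall n, (1 <= n)%nat -> valid (T n) /\ nonzero (T n)) -> normal l ->
  (forall N a, (r <= N)%nat -> nonzero a -> fst a = fst (T N) ->
     forall e, 0 < e -> ev (fun t => Cmod (isum l t - isum (term_range T r N) t)%C <= e * Cmod (ival a t))) ->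
  False.
Proof.
  intros HT. revert r. induction l as [|a l IH]; intros r Nl H.
  - destruct (HT (S r) ltac:(lia)) as [_ NT].
    assert (G := H (S r) (T (S r)) ltac:(lia) NT eq_refl (1 / 2) ltac:(lra)).
    destruct (ev_and _ _ G (nonzero_ev_pos _ NT)) as [X HX].
    destruct (HX X (Rle_refl _)) as [X1 X2].
    unfold term_range in X1. replace (S r - r)%nat with 1%nat in X1 by lia. simpl in X1.
    replace (RtoC 0 - (ival (T (S r)) X + RtoC 0))%C with (- ival (T (S r)) X)%C in X1 by ring.
    rewrite Cmod_opp in X1. lra.
  - destruct (HT (S r) ltac:(lia)) as [VT NT].
    assert (One : forall t, isum (term_range T r (S r)) t = ival (T (S r)) t).
    { intros t. unfold term_range. replace (S r - r)%nat with 1%nat by lia. simpl. ring. }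
    assert (G := H (S r) (T (S r)) ltac:(lia) NT eq_refl (1 / 4) ltac:(lra)).
    assert (PT := nonzero_ev_pos _ NT).
    assert (LB := normal_lower_bound a l Nl).
    destruct Nl as [Hs [Hv Hn]].
    inversion Hs as [|? ? Hs1 Hs2]; subst. inversion Hv as [|? ? Hv1 Hv2]; subst.
    inversion Hn as [|? ? Hn1 Hn2]; subst.
    (* If the labels differ, the larger of the two leading terms has no counterpart. If they agree,
       the coefficients must cancel near infinity, as otherwise their difference would lead the
       remaining sum. *)
    destruct (label_trichotomy (fst a) (fst (T (S r))) (proj1 Hv1) (proj1 VT)) as [E|[Gt|Gt]].
    + set (K := fun z => (snd a z + esum ((- RtoC 1, 0)%C :: nil) z * snd (T (S r)) z)%C).
      assert (EK : forall t, ival (fst a, K) t = (ival a t - ival (T (S r)) t)%C).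
      { intros t. unfold ival, K. rewrite <- E. simpl. rewrite Cmult_0_l, Cexp_0. ring. }
      assert (XK : expandable K).
      { apply expandable_plus; [apply Hv1|]. apply expandable_mult; [apply expandable_esum|apply VT]. }
      destruct (expandable_dichotomy K XK) as [ZK|ZK].
      * apply (IH (S r)); [split; auto|]. intros N b HN Hb Eb e He.
        assert (Q := H N b ltac:(lia) Hb Eb e He).
        apply (ev_mono _ _ (ev_and _ _ ZK Q)). intros t [X1 X2].
        assert (Y : ival a t = ival (T (S r)) t).
        { assert (Y := EK t). unfold ival at 1 in Y. simpl snd in Y. rewrite X1, Cmult_0_l in Y.
          replace (ival a t) with (ival a t - ival (T (S r)) t + ival (T (S r)) t)%C by ring. rewrite <- Y. ring. }
        eapply Rle_trans; [|exact X2]. right. f_equal. unfold term_range.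
        replace (N - r)%nat with (S (N - S r)) by lia. simpl. rewrite Y. ring.
      * assert (Nl' : normal ((fst a, K) :: l)).
        { split; [|split]; constructor; auto. split; [apply Hv1|exact XK]. }
        assert (LB' := normal_lower_bound _ _ Nl').
        (* The difference K may be smaller than the coefficient of [T (S r)] by an exponential
           factor e^{mx}; for this reason the hypothesis covers every nonzero coefficient with that
           label. *)
        assert (Q := H (S r) (fst a, K) ltac:(lia) ZK E (1 / 4) ltac:(lra)).
        assert (PK := nonzero_ev_pos (fst a, K) ZK).
        destruct (ev_and _ _ LB' (ev_and _ _ Q PK)) as [X HX].
        destruct (HX X (Rle_refl _)) as [X1 [X2 X3]].
        rewrite One in X2. simpl isum in X1, X2. rewrite EK in X1 at 2.
        replace (ival a X - ival (T (S r)) X + isum l X)%C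
          with (ival a X + isum l X - ival (T (S r)) X)%C in X1 by ring. lra.
    + assert (D := item_dominated a (T (S r)) (1 / 4) Gt Hn1 VT ltac:(lra)).
      destruct (ev_and _ _ G (ev_and _ _ PT (ev_and _ _ LB D))) as [X HX].
      destruct (HX X (Rle_refl _)) as [X1 [X2 [X3 X4]]]. rewrite One in X1.
      assert (Y := Cmod_minus_lower (isum (a :: l) X) (ival (T (S r)) X)). lra.
    + assert (D := item_dominated (T (S r)) a (1 / 4) Gt NT Hv1 ltac:(lra)).
      assert (D2 := isum_tail_small a l 1 Hs2 Hv2 Hn1 ltac:(lra)).
      destruct (ev_and _ _ G (ev_and _ _ PT (ev_and _ _ D2 D))) as [X HX].
      destruct (HX X (Rle_refl _)) as [X1 [X2 [X3 X4]]]. rewrite One in X1.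
      rewrite Cmod_minus_sym in X1.
      assert (Y := Cmod_minus_lower (ival (T (S r)) X) (isum (a :: l) X)).
      simpl in Y, X1. assert (Y2 := Cmod_triangle (ival a X) (isum l X)). lra.
Qed.

(** * The expansion of [ln (1 - s ln (1 + q))] in powers of [q] *)

Definition log_coef (n : nat) : R :=
  match n with O => 0 | S j => (-1) ^ j / INR (S j) end.

(** The recursion b_{r+1} = s (l_1 b_r + ... + l_{r+1} b_0), with l_i the coefficients of ln (1 +
    q), refers to all lower ranks; [n] is a bound on the rank that serves as structural argument. *)
Fixpoint inv_coef_upto (n : nat) (s : C) : nat -> C :=
  match n with
  | O => fun _ => RtoC 1
  | S n' => fun r =>
      match r with
      | O => RtoC 1
      | S r' => (s * csum (fun i => RtoC (log_coef (S i)) * inv_coef_upto n' s (r' - i)) (S r'))%C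
      end
  end.

(* Coefficient of [q ^ r] in [1 / (1 - s ln (1 + q))]. *)
Definition inv_coef (r : nat) (s : C) : C := inv_coef_upto r s r.

(* Coefficient of [q ^ r] in [ln (1 - s ln (1 + q))]. *)
Definition G_coef (r : nat) (s : C) : C :=
  match r with
  | O => RtoC 0
  | S j => (RtoC (- / INR (S j)) * (s * csum (fun i => RtoC ((-1) ^ (j - i)) * inv_coef i s) (S j)))%C
  end.

Lemma inv_coef_upto_stable (s : C) (r n : nat) : (r <= n)%nat -> inv_coef_upto n s r = inv_coef r s.
Proof.
  assert (H : forall N r n, (r <= N)%nat -> (r <= n)%nat -> inv_coef_upto n s r = inv_coef r s).
  { induction N as [|N IH]; intros r' n' HN Hn.
    - assert (r' = 0)%nat by lia. subst r'. destruct n'; reflexivity.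
    - destruct r' as [|r']; [destruct n'; reflexivity|]. destruct n' as [|n']; [lia|].
      unfold inv_coef. cbn [inv_coef_upto]. f_equal. apply csum_ext. intros i Hi. f_equal.
      rewrite !IH by lia. reflexivity. }
  intros L. apply (H r); auto.
Qed.

Lemma inv_coef_S (s : C) (r : nat) :
  inv_coef (S r) s = (s * csum (fun i => RtoC (log_coef (S i)) * inv_coef (r - i) s) (S r))%C.
Proof.
  unfold inv_coef at 1. cbn [inv_coef_upto]. f_equal. apply csum_ext. intros i Hi. f_equal.
  apply inv_coef_upto_stable. lia.
Qed.

Lemma csum_rev_pow2_bound (f : nat -> C) (n : nat) (B : R) :
  (forall k, (k < n)%nat -> Cmod (f k) <= B * 2 ^ (n - S k)) -> Cmod (csum f n) <= B * (2 ^ n - 1).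
Proof.
  revert f. induction n as [|n IH]; intros f H.
  - simpl. rewrite Cmod_0. lra.
  - rewrite csum_S_l. eapply Rle_trans; [apply Cmod_triangle|].
    assert (Hz := H O ltac:(lia)). replace (S n - 1)%nat with n in Hz by lia.
    assert (H1 := IH (fun k => f (S k))). simpl in *.
    assert (Cmod (csum (fun k => f (S k)) n) <= B * (2 ^ n - 1)).
    { apply H1. intros k Hk. apply (H (S k)). lia. }
    lra.
Qed.

Lemma Cmod_log_coef (i : nat) : Cmod (RtoC (log_coef (S i))) <= 1.
Proof.
  rewrite Cmod_R. unfold log_coef, Rdiv. rewrite Rabs_mult, pow_1_abs, Rmult_1_l.
  assert (P := pos_INR i). rewrite S_INR. rewrite Rabs_pos_eq.
  - rewrite <- Rinv_1. apply Rinv_le_contravar; lra.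
  - left. apply Rinv_0_lt_compat. lra.
Qed.

(** With |s| <= 1 and log coefficients at most 1, the recursion sums 2^r + ... + 1 = 2^{r+1} - 1, so
    the bound reproduces itself. *)
Lemma inv_coef_bound_aux (s : C) (N r : nat) : Cmod s <= 1 -> (r <= N)%nat ->
  Cmod (inv_coef r s) <= 2 ^ r.
Proof.
  intros Hs. revert r. induction N as [|N IH]; intros r HN.
  - assert (r = 0)%nat by lia. subst r. unfold inv_coef. simpl. rewrite Cmod_1. lra.
  - destruct r as [|r]; [apply IH; lia|].
    rewrite inv_coef_S, Cmod_mult.
    assert (B : Cmod (csum (fun i => RtoC (log_coef (S i)) * inv_coef (r - i) s)%C (S r)) <= 1 * (2 ^ S r - 1)).
    { apply csum_rev_pow2_bound. intros k Hk. rewrite Cmod_mult, Rmult_1_l.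
      assert (A1 := Cmod_log_coef k). assert (A2 := IH (r - k)%nat ltac:(lia)).
      replace (S r - S k)%nat with (r - k)%nat by lia.
      rewrite <- (Rmult_1_l (2 ^ (r - k))). apply Rmult_le_compat; auto using Cmod_ge_0. }
    rewrite <- (Rmult_1_l (2 ^ S r)). apply Rmult_le_compat; auto using Cmod_ge_0. lra.
Qed.

Lemma inv_coef_bound (s : C) (r : nat) : Cmod s <= 1 -> Cmod (inv_coef r s) <= 2 ^ r.
Proof. intros Hs. apply (inv_coef_bound_aux s r); auto. Qed.

Lemma inv_coef_small (s : C) (r : nat) : Cmod s <= 1 -> Cmod (inv_coef (S r) s) <= 2 ^ S r * Cmod s.
Proof.
  intros Hs. rewrite inv_coef_S, Cmod_mult, Rmult_comm.
  apply Rmult_le_compat_r; [apply Cmod_ge_0|].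
  assert (B : Cmod (csum (fun i => RtoC (log_coef (S i)) * inv_coef (r - i) s)%C (S r)) <= 1 * (2 ^ S r - 1)).
  { apply csum_rev_pow2_bound. intros k Hk. rewrite Cmod_mult, Rmult_1_l.
    assert (A1 := Cmod_log_coef k). assert (A2 := inv_coef_bound s (r - k) Hs).
    replace (S r - S k)%nat with (r - k)%nat by lia.
    rewrite <- (Rmult_1_l (2 ^ (r - k))). apply Rmult_le_compat; auto using Cmod_ge_0. }
  lra.
Qed.

Lemma csum_pow2_bound (f : nat -> C) (B : R) (n : nat) :
  (forall k, (k < n)%nat -> Cmod (f k) <= B * 2 ^ k) -> Cmod (csum f n) <= B * (2 ^ n - 1).
Proof.
  induction n as [|n IH]; intros H.
  - simpl. rewrite Cmod_0. lra.
  - simpl csum. eapply Rle_trans; [apply Cmod_triangle|].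
    assert (Cmod (csum f n) <= B * (2 ^ n - 1)) by (apply IH; intros; apply H; lia).
    assert (Hn := H n ltac:(lia)). simpl. lra.
Qed.

(** Origin of [G_coef]: the derivative in q of ln (1 - s ln (1 + q)) is -s/((1 + q)(1 - s ln (1 +
    q))), a Cauchy product of the series of [inv_coef] with the alternating series. *)
Lemma scaled_G_coef (s : C) (r : nat) :
  (RtoC (INR (S r)) * G_coef (S r) s)%C =
  (- (s * csum (fun i => RtoC ((-1) ^ (r - i)) * inv_coef i s) (S r)))%C.
Proof.
  unfold G_coef. rewrite Cmult_assoc, <- RtoC_mult.
  replace (INR (S r) * - / INR (S r)) with (Ropp 1).
  - rewrite RtoC_opp. ring.
  - field. apply not_0_INR. lia.
Qed.

Lemma scaled_G_coef_bound (s : C) (r : nat) : Cmod s <= 1 ->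
  Cmod (RtoC (INR r) * G_coef r s)%C <= 2 ^ r * Cmod s.
Proof.
  intros Hs. destruct r as [|r].
  - simpl. rewrite Cmult_0_l, Cmod_0. assert (P := Cmod_ge_0 s). lra.
  - rewrite scaled_G_coef, Cmod_opp, Cmod_mult, Rmult_comm. apply Rmult_le_compat_r; [apply Cmod_ge_0|].
    assert (B := csum_pow2_bound (fun i => RtoC ((-1) ^ (r - i)) * inv_coef i s)%C 1 (S r)).
    assert (Q : Cmod (csum (fun i => RtoC ((-1) ^ (r - i)) * inv_coef i s)%C (S r)) <= 1 * (2 ^ S r - 1)).
    { apply B. intros k Hk. rewrite Cmod_mult, Cmod_R, pow_1_abs. apply Rmult_le_compat_l; [lra|].
      apply inv_coef_bound, Hs. }
    lra.
Qed.

Lemma G_coef_bound (s : C) (r : nat) : Cmod s <= 1 -> Cmod (G_coef r s) <= 2 ^ r * Cmod s.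
Proof.
  intros Hs. eapply Rle_trans; [|apply scaled_G_coef_bound, Hs].
  destruct r as [|r]; [simpl; rewrite Cmult_0_l; lra|].
  rewrite Cmod_mult, Cmod_R, Rabs_pos_eq by apply pos_INR.
  rewrite <- (Rmult_1_l (Cmod (G_coef (S r) s))) at 1. apply Rmult_le_compat_r; [apply Cmod_ge_0|].
  rewrite S_INR. assert (P := pos_INR r). lra.
Qed.

(** Only the summand i = 0 is of first order in s, because [inv_coef] of positive rank is itself
    O(s). This first-order term is what keeps the coefficients of the bracket from vanishing. *)
Lemma G_coef_leading (s : C) (r : nat) : Cmod s <= 1 ->
  Cmod (G_coef (S r) s + RtoC ((-1) ^ r / INR (S r)) * s)%C <= 2 ^ S r * Cmod s * Cmod s.
Proof.
  intros Hs.
  replace (G_coef (S r) s + RtoC ((-1) ^ r / INR (S r)) * s)%C with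
    (RtoC (- / INR (S r)) * (s * csum (fun i => RtoC ((-1) ^ (r - S i)) * inv_coef (S i) s) r))%C.
  - rewrite !Cmod_mult, Cmod_R, Rabs_Ropp, Rabs_pos_eq.
    2:{ left; apply Rinv_0_lt_compat. rewrite S_INR. assert (P := pos_INR r). lra. }
    assert (B : Cmod (csum (fun i => RtoC ((-1) ^ (r - S i)) * inv_coef (S i) s)%C r) <= (2 * Cmod s) * (2 ^ r - 1)).
    { apply csum_pow2_bound. intros k Hk. rewrite Cmod_mult, Cmod_R, pow_1_abs, Rmult_1_l.
      eapply Rle_trans; [apply inv_coef_small, Hs|]. simpl. lra. }
    assert (I1 : / INR (S r) <= 1).
    { rewrite <- Rinv_1. apply Rinv_le_contravar; [lra|]. rewrite S_INR. assert (P := pos_INR r). lra. }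
    assert (I0 : 0 < / INR (S r)) by (apply Rinv_0_lt_compat; rewrite S_INR; assert (P := pos_INR r); lra).
    set (X := Cmod (csum _ r)) in *. assert (X0 : 0 <= X) by apply Cmod_ge_0.
    assert (S0 := Cmod_ge_0 s). assert (P2 : 0 < 2 ^ r) by (apply pow_lt; lra).
    apply Rle_trans with (1 * (Cmod s * X)).
    + apply Rmult_le_compat_r; [apply Rmult_le_pos; assumption|exact I1].
    + rewrite Rmult_1_l. replace (2 ^ S r * Cmod s * Cmod s) with (Cmod s * (2 * Cmod s * 2 ^ r)) by (simpl; ring).
      apply Rmult_le_compat_l; [exact S0|]. nra.
  - unfold G_coef. rewrite csum_S_l. rewrite Nat.sub_0_r.
    change (inv_coef 0 s) with (RtoC 1). unfold Rdiv. rewrite RtoC_mult, RtoC_opp. ring.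
Qed.

(** The coefficients are complex functions because [psi] is; on real arguments they are real, and
    reading them there gives access to the theory of real power series. *)
Definition real_coef (c : C -> C) (s : R) : R := Re (c (RtoC s)).

Lemma csum_RtoC (f : nat -> R) (n : nat) :
  csum (fun k => RtoC (f k)) (S n) = RtoC (sum_f_R0 f n).
Proof.
  induction n as [|n IH]; [simpl; ring|].
  change (csum (fun k => RtoC (f k)) (S (S n))) with (csum (fun k => RtoC (f k)) (S n) + RtoC (f (S n)))%C.
  rewrite IH, <- RtoC_plus. reflexivity.
Qed.

Lemma eq_RtoC_Re (z : C) (x : R) : z = RtoC x -> z = RtoC (Re z).
Proof. intros ->. reflexivity. Qed.

Lemma inv_coef_real (s : R) (r : nat) : inv_coef r (RtoC s) = RtoC (real_coef (inv_coef r) s).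
Proof.
  assert (H : forall N r, (r <= N)%nat -> inv_coef r (RtoC s) = RtoC (real_coef (inv_coef r) s)).
  { induction N as [|N IH]; intros r' HN.
    - assert (r' = 0)%nat by lia. subst r'. reflexivity.
    - destruct r' as [|r']; [reflexivity|]. unfold real_coef.
      apply eq_RtoC_Re with (s * sum_f_R0 (fun i => log_coef (S i) * real_coef (inv_coef (r' - i)) s) r').
      rewrite inv_coef_S, RtoC_mult. f_equal. rewrite <- csum_RtoC. apply csum_ext. intros i Hi.
      rewrite IH by lia. rewrite RtoC_mult. reflexivity. }
  apply (H r); auto.
Qed.

Lemma G_coef_real (s : R) (r : nat) : G_coef r (RtoC s) = RtoC (real_coef (G_coef r) s).
Proof.
  destruct r as [|r]; [reflexivity|]. unfold real_coef.
  apply eq_RtoC_Re with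
    (- / INR (S r) * (s * sum_f_R0 (fun i => (-1) ^ (r - i) * real_coef (inv_coef i) s) r)).
  unfold G_coef. rewrite !RtoC_mult. do 2 f_equal. rewrite <- csum_RtoC. apply csum_ext. intros i Hi.
  rewrite inv_coef_real, RtoC_mult. reflexivity.
Qed.

Definition geometric_coefs (a : nat -> R) : Prop := exists B, forall n, Rabs (a n) <= B * 2 ^ n.

Lemma geometric_radius (a : nat -> R) (x : R) : geometric_coefs a -> Rabs x <= 1 / 4 ->
  Rbar_lt (Rabs x) (CV_radius a).
Proof.
  intros [B H] Hx. destruct (CV_radius_bounded a) as [U _].
  assert (G : Rbar_le (Finite (1 / 2)) (CV_radius a)).
  { apply U. exists B. intros n. rewrite Rabs_mult, (Rabs_pos_eq ((1 / 2) ^ n)) by (apply pow_le; lra).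
    apply Rmult_le_reg_r with (2 ^ n); [apply pow_lt; lra|].
    rewrite Rmult_assoc, <- Rpow_mult_distr.
    replace (1 / 2 * 2) with 1 by field. rewrite pow1, Rmult_1_r. apply H. }
  eapply Rbar_lt_le_trans; [|exact G]. simpl. lra.
Qed.

Lemma real_coef_geometric (c : nat -> C -> C) (s : R) :
  (forall n, Cmod (c n (RtoC s)) <= 2 ^ n) -> geometric_coefs (fun n => real_coef (c n) s).
Proof.
  intros H. exists 1. intros n. rewrite Rmult_1_l. eapply Rle_trans; [apply re_le_Cmod|apply H].
Qed.

Lemma inv_coefs_geometric (s : R) : 0 <= s <= 1 -> geometric_coefs (fun n => real_coef (inv_coef n) s).
Proof.
  intros Hs. apply real_coef_geometric. intros n. apply inv_coef_bound.
  rewrite Cmod_R, Rabs_pos_eq; lra.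
Qed.

Lemma G_coefs_geometric (s : R) : 0 <= s <= 1 -> geometric_coefs (fun n => real_coef (G_coef n) s).
Proof.
  intros Hs. apply real_coef_geometric. intros n.
  assert (E : Cmod (RtoC s) = s) by (rewrite Cmod_R, Rabs_pos_eq; lra).
  eapply Rle_trans; [apply G_coef_bound; lra|]. rewrite E.
  assert (P : 0 < 2 ^ n) by (apply pow_lt; lra). nra.
Qed.

Definition alternating (n : nat) : R := (-1) ^ n.

Lemma alternating_geometric : geometric_coefs alternating.
Proof.
  exists 1. intros n. unfold alternating. rewrite pow_1_abs, Rmult_1_l. apply pow_R1_Rle. lra.
Qed.

Lemma log_coef_geometric : geometric_coefs log_coef.
Proof.
  exists 1. intros [|n].
  - simpl. rewrite Rabs_R0. lra.
  - rewrite <- Cmod_R. eapply Rle_trans; [apply Cmod_log_coef|]. rewrite Rmult_1_l. apply pow_R1_Rle. lra.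
Qed.

Lemma PSeries_alternating (q : R) : 0 <= q <= 1 / 4 -> PSeries alternating q = / (1 + q).
Proof.
  intros Hq. apply is_pseries_unique, is_pseries_R.
  apply (is_series_ext (fun n => (- q) ^ n)).
  - intros n. unfold alternating. rewrite <- Rpow_mult_distr. f_equal. ring.
  - replace (1 + q) with (1 - - q) by ring. apply is_series_geom. rewrite Rabs_Ropp, Rabs_pos_eq; lra.
Qed.

(** The difference of both sides has zero derivative on [0, q] and vanishes at 0. The bound 1/4 lies
    inside the radius 1/2 that [geometric_coefs] guarantees. *)
Lemma PSeries_integrate (a : nat -> R) (F f : R -> R) (q : R) :
  geometric_coefs a -> 0 <= q <= 1 / 4 ->
  (forall x, 0 <= x <= 1 / 4 -> PSeries (PS_derive a) x = f x) ->
  (forall x, 0 <= x <= 1 / 4 -> is_derive F x (f x)) ->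
  F 0 = a O -> PSeries a q = F q.
Proof.
  intros Ha Hq Hf HF H0.
  destruct (Rle_lt_or_eq_dec 0 q ltac:(lra)) as [Lq|<-]; [|rewrite PSeries_0; auto].
  assert (E := eq_is_derive (fun x => PSeries a x - F x) 0 q).
  cbv beta in E. rewrite PSeries_0, H0 in E.
  assert (Q : a O - a O = PSeries a q - F q); [|lra].
  apply E; [|exact Lq]. intros x Hx.
  replace (@zero R_NormedModule) with (PSeries (PS_derive a) x - f x).
  - apply (is_derive_minus (K := R_AbsRing) (V := R_NormedModule)).
    + apply is_derive_PSeries. apply geometric_radius; [exact Ha|]. rewrite Rabs_pos_eq; lra.
    + apply HF. lra.
  - rewrite Hf by lra. change (@zero R_NormedModule) with 0. ring.
Qed.

Lemma PSeries_log (q : R) : 0 <= q <= 1 / 4 -> PSeries log_coef q = ln (1 + q).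
Proof.
  intros Hq. apply (PSeries_integrate log_coef (fun x => ln (1 + x)) (fun x => / (1 + x))); auto.
  - apply log_coef_geometric.
  - intros x Hx. rewrite <- PSeries_alternating by exact Hx. apply PSeries_ext. intros n.
    unfold PS_derive, log_coef, alternating. field. apply not_0_INR. lia.
  - intros x Hx. auto_derive; [lra|]. field. lra.
  - rewrite Rplus_0_r, ln_1. reflexivity.
Qed.

Lemma ln_1_plus_bound (q : R) : 0 <= q -> 0 <= ln (1 + q) <= q.
Proof.
  intros Hq. split.
  - rewrite <- ln_1. destruct Hq as [Hq|<-]; [left; apply ln_increasing; lra|rewrite Rplus_0_r; lra].
  - apply exp_mono_inv. rewrite exp_ln by lra. apply exp_ineq1_le.
Qed.

Lemma one_minus_pos (s q : R) : 0 <= s <= 1 -> 0 <= q <= 1 / 4 -> 3 / 4 <= 1 - s * ln (1 + q).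
Proof. intros Hs Hq. assert (B := ln_1_plus_bound q ltac:(lra)). nra. Qed.

(** The recursion defining [inv_coef] is the identity b = 1 + s L b of power series, L being that of
    ln (1 + q). Summation turns it into a linear equation for the value of b. *)
Lemma PSeries_inv (s q : R) : 0 <= s <= 1 -> 0 <= q <= 1 / 4 ->
  PSeries (fun n => real_coef (inv_coef n) s) q = / (1 - s * ln (1 + q)).
Proof.
  intros Hs Hq. set (b := fun n => real_coef (inv_coef n) s).
  assert (Hb : Rbar_lt (Rabs q) (CV_radius b)).
  { apply geometric_radius; [apply inv_coefs_geometric, Hs|rewrite Rabs_pos_eq; lra]. }
  assert (Hl : Rbar_lt (Rabs q) (CV_radius log_coef)).
  { apply geometric_radius; [apply log_coef_geometric|rewrite Rabs_pos_eq; lra]. }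
  assert (E : forall n, b (S n) = s * PS_mult log_coef b (S n)).
  { intros n. unfold b at 1, real_coef. rewrite inv_coef_S.
    rewrite (csum_ext _ (fun i => RtoC (log_coef (S i) * b (n - i)%nat))).
    - rewrite csum_RtoC, <- RtoC_mult. simpl Re. f_equal. unfold PS_mult.
      rewrite (decomp_sum _ (S n)) by lia. cbn [Nat.pred]. change (log_coef 0) with 0. rewrite Rmult_0_l, Rplus_0_l.
      apply sum_eq. intros i Hi. f_equal.
    - intros i Hi. rewrite inv_coef_real, RtoC_mult. reflexivity. }
  assert (P := one_minus_pos s q Hs Hq).
  assert (F : PSeries b q = 1 + s * (ln (1 + q) * PSeries b q)).
  { rewrite <- PSeries_log at 1 by exact Hq. rewrite <- PSeries_mult by assumption.
    rewrite <- PSeries_scal.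
    set (d := fun n : nat => match n with O => 1 | _ => 0 end).
    assert (X : is_pseries b q (1 + PSeries (PS_scal s (PS_mult log_coef b)) q)).
    { apply is_pseries_ext with (PS_plus d (PS_scal s (PS_mult log_coef b))).
      - intros [|n].
        + unfold PS_plus, PS_scal, d, PS_mult. simpl. change (plus ?u ?v) with (u + v).
          change (scal ?u ?v) with (u * v). unfold b, real_coef, inv_coef. simpl. eqR. ring.
        + rewrite E. unfold PS_plus, PS_scal, d. change (plus ?u ?v) with (u + v).
          change (scal ?u ?v) with (u * v). eqR. ring.
      - apply (is_pseries_plus (K := R_AbsRing) (V := R_NormedModule)).
        + apply is_pseries_R. apply is_series_Reals. intros e He. exists O. intros n _.
          rewrite (sum_eq _ (fun i => match i with O => 1 | _ => 0 end)).
          * replace (sum_f_R0 _ n) with 1; [unfold Rdist; rewrite Rminus_diag, Rabs_R0; exact He|].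
            clear. induction n as [|n IH]; [reflexivity|]. simpl. rewrite <- IH. ring.
          * intros [|i] _; unfold d; simpl; ring.
        + apply PSeries_correct. apply CV_radius_inside.
          destruct (Req_dec s 0) as [->|Hs0].
          * apply geometric_radius; [|rewrite Rabs_pos_eq; lra]. exists 0. intros n.
            unfold PS_scal. change (scal ?u ?v) with (u * v). rewrite !Rmult_0_l, Rabs_R0. lra.
          * apply geometric_radius; [|rewrite Rabs_pos_eq; lra].
            destruct (inv_coefs_geometric s Hs) as [B HB]. exists B. intros [|n].
            -- unfold PS_scal, PS_mult. change (scal ?u ?v) with (u * v). simpl.
               rewrite Rmult_0_l, Rmult_0_r, Rabs_R0. specialize (HB O). simpl in HB.
               assert (Q := Rabs_pos (real_coef (inv_coef 0) s)). lra.
            -- unfold PS_scal. change (scal ?u ?v) with (u * v). rewrite <- E. apply HB. }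
    apply is_pseries_unique in X. exact X. }
  apply Rmult_eq_reg_r with (1 - s * ln (1 + q)); [|lra].
  rewrite Rinv_l by lra. lra.
Qed.

Lemma PS_derive_G (s : R) (n : nat) :
  PS_derive (fun n => real_coef (G_coef n) s) n =
  PS_scal (- s) (PS_mult (fun n => real_coef (inv_coef n) s) alternating) n.
Proof.
  unfold PS_derive, PS_scal, PS_mult. change (scal ?u ?v) with (u * v).
  assert (E := scaled_G_coef (RtoC s) n). rewrite G_coef_real, <- RtoC_mult in E.
  rewrite (csum_ext _ (fun i => RtoC (real_coef (inv_coef i) s * alternating (n - i)))) in E.
  - rewrite csum_RtoC, <- RtoC_mult, <- RtoC_opp in E. apply RtoC_inj in E. rewrite E. ring.
  - intros i Hi. rewrite inv_coef_real, RtoC_mult. unfold alternating. ring.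
Qed.

Lemma PSeries_derive_G (s q : R) : 0 <= s <= 1 -> 0 <= q <= 1 / 4 ->
  PSeries (PS_derive (fun n => real_coef (G_coef n) s)) q = - s / ((1 + q) * (1 - s * ln (1 + q))).
Proof.
  intros Hs Hq. assert (P := one_minus_pos s q Hs Hq).
  rewrite (PSeries_ext _ _ q (PS_derive_G s)), PSeries_scal, PSeries_mult.
  - rewrite PSeries_inv, PSeries_alternating by assumption. field. lra.
  - apply geometric_radius; [apply inv_coefs_geometric, Hs|rewrite Rabs_pos_eq; lra].
  - apply geometric_radius; [apply alternating_geometric|rewrite Rabs_pos_eq; lra].
Qed.

Lemma PSeries_G (s q : R) : 0 <= s <= 1 -> 0 <= q <= 1 / 4 ->
  PSeries (fun n => real_coef (G_coef n) s) q = ln (1 - s * ln (1 + q)).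
Proof.
  intros Hs Hq.
  apply (PSeries_integrate _ (fun x => ln (1 - s * ln (1 + x))) (fun x => - s / ((1 + x) * (1 - s * ln (1 + x))))); auto.
  - apply G_coefs_geometric, Hs.
  - intros x Hx. apply PSeries_derive_G; assumption.
  - intros x Hx. assert (P := one_minus_pos s x Hs Hx). auto_derive; [lra|]. field. lra.
  - rewrite Rplus_0_r, ln_1, Rmult_0_r, Rminus_0_r, ln_1. reflexivity.
Qed.

Lemma PSeries_tail (a : nat -> R) (B q : R) (N : nat) :
  0 <= B -> (forall n, Rabs (a n) <= B * 2 ^ n) -> 0 <= q <= 1 / 4 ->
  Cmod (RtoC (PSeries a q) - csum (fun n => RtoC (a n * q ^ n)%R) N)%C <= 2 * B * (2 * q) ^ N.
Proof.
  intros HB Ha Hq.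
  assert (X : is_pseries a q (PSeries a q)).
  { apply PSeries_correct, CV_radius_inside, geometric_radius; [exists B; exact Ha|rewrite Rabs_pos_eq; lra]. }
  apply is_pseries_R, is_series_Reals in X.
  apply le_epsilon. intros e He. destruct (X e He) as [n Hn]. specialize (Hn (N + n)%nat ltac:(lia)).
  unfold Rdist in Hn.
  assert (T := csum_geometric_tail (fun n => RtoC (a n * q ^ n)) B (2 * q) N (S n) HB ltac:(lra)).
  replace (N + S n)%nat with (S (N + n)) in T by lia. rewrite csum_RtoC in T.
  assert (T' : Cmod (RtoC (sum_f_R0 (fun n => a n * q ^ n)%R (N + n)) - csum (fun n => RtoC (a n * q ^ n)%R) N)%C <= 2 * B * (2 * q) ^ N).
  { apply T. intros k. rewrite Cmod_R, Rabs_mult, Rpow_mult_distr, (Rabs_pos_eq (q ^ k)) by (apply pow_le; lra).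
    rewrite <- Rmult_assoc. apply Rmult_le_compat_r; [apply pow_le; lra|apply Ha]. }
  set (Y := csum (fun n => RtoC (a n * q ^ n)) N) in *.
  replace (RtoC (PSeries a q) - Y)%C with
    ((RtoC (sum_f_R0 (fun n => a n * q ^ n)%R (N + n)) - Y) -
     RtoC (sum_f_R0 (fun n => a n * q ^ n)%R (N + n) - PSeries a q))%C by (rewrite RtoC_minus; ring).
  eapply Rle_trans; [apply Cmod_minus_triangle|]. rewrite Cmod_R. lra.
Qed.

(** * Membership of the two functions in K11 *)

Definition function_ring (P : (C -> C) -> Prop) : Prop :=
  (forall x : R, P (fun _ => RtoC x)) /\
  (forall f g, P f -> P g -> P (fun z => f z + g z)%C) /\
  (forall f g, P f -> P g -> P (fun z => f z * g z)%C) /\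
  (forall f g, (forall z, f z = g z) -> P f -> P g).

Lemma function_ring_csum (P : (C -> C) -> Prop) (f : nat -> C -> C) (n : nat) :
  function_ring P -> (forall k, (k < n)%nat -> P (f k)) -> P (fun z => csum (fun k => f k z) n).
Proof.
  intros [Hc [Hp [Hm He]]] H. induction n as [|n IH]; [apply (Hc 0)|].
  simpl. apply Hp; [apply IH; auto|apply H; lia].
Qed.

(** [inv_coef r] is a polynomial with real coefficients in its argument, so it preserves any ring of
    functions containing the real constants. One induction thus serves analyticity, with [uapprox],
    and the exponential sums needed for [K10]. *)
Lemma function_ring_inv_coef (P : (C -> C) -> Prop) (s : C -> C) (r : nat) :
  function_ring P -> P s -> P (fun z => inv_coef r (s z)).
Proof.
  intros HP Hs. assert (HP' := HP). destruct HP' as [Hc [Hp [Hm He]]].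
  assert (H : forall N r, (r <= N)%nat -> P (fun z => inv_coef r (s z))).
  { induction N as [|N IH]; intros r' HN.
    - assert (r' = 0)%nat by lia. subst r'. exact (Hc 1).
    - destruct r' as [|r']; [exact (Hc 1)|].
      apply (He (fun z => s z * csum (fun i => RtoC (log_coef (S i)) * inv_coef (r' - i) (s z)) (S r'))%C).
      + intros z. symmetry. apply inv_coef_S.
      + apply Hm; [exact Hs|].
        apply (function_ring_csum P (fun i z => RtoC (log_coef (S i)) * inv_coef (r' - i) (s z))%C _ HP).
        intros k Hk. apply Hm; [apply Hc|]. apply IH. lia. }
  apply (H r); auto.
Qed.

Lemma function_ring_G_coef (P : (C -> C) -> Prop) (s : C -> C) (r : nat) :
  function_ring P -> P s -> P (fun z => G_coef r (s z)).
Proof.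
  intros HP Hs. assert (HP' := HP). destruct HP' as [Hc [Hp [Hm He]]].
  destruct r as [|r]; [exact (Hc 0)|]. unfold G_coef.
  apply Hm; [apply Hc|]. apply Hm; [exact Hs|].
  apply (function_ring_csum P (fun i z => RtoC ((-1) ^ (r - i)) * inv_coef i (s z))%C _ HP).
  intros k Hk. apply Hm; [apply Hc|]. apply function_ring_inv_coef; assumption.
Qed.

Lemma uapprox_ring (z0 : C) (r : R) : 0 <= r -> function_ring (fun f => uapprox f z0 r).
Proof.
  intros Hr. split; [|split; [|split]].
  - intros x. apply uapprox_const.
  - intros f g. apply uapprox_plus.
  - intros f g. apply uapprox_mult, Hr.
  - intros f g E H e He. destruct (H e He) as [l Hl]. exists l. intros h Hh. rewrite <- E. apply Hl, Hh.
Qed.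

(** Coefficients are kept real because [FC0] demands real b_q. *)
Definition real_exp_sum (f : C -> C) : Prop :=
  exists l, forall z, f z = esum (complexify l) z.

Lemma complexify_emul (l l' : list (R * R)) : exists l2, complexify l2 = emul (complexify l) (complexify l').
Proof.
  exists (flat_map (fun p => map (fun q => (fst p * fst q, snd p + snd q)) l') l).
  unfold emul, complexify. induction l as [|p l IH]; [reflexivity|].
  simpl. rewrite map_app, IH. f_equal. rewrite !map_map. apply map_ext. intros q. simpl.
  rewrite RtoC_mult. reflexivity.
Qed.

Lemma real_exp_sum_ring : function_ring real_exp_sum.
Proof.
  split; [|split; [|split]].
  - intros x. exists ((x, 0) :: nil). intros z. simpl. rewrite Cmult_0_l, Cexp_0. ring.
  - intros f g [l Hl] [l' Hl']. exists (l ++ l'). intros z. unfold complexify. rewrite map_app, esum_app.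
    rewrite Hl, Hl'. reflexivity.
  - intros f g [l Hl] [l' Hl']. destruct (complexify_emul l l') as [l2 E]. exists l2. intros z.
    rewrite E, esum_emul, Hl, Hl'. reflexivity.
  - intros f g E [l Hl]. exists l. intros z. rewrite <- E. apply Hl.
Qed.

Lemma real_exp_sum_Cexp (k : R) : real_exp_sum (fun z => Cexp (RtoC k * z)).
Proof. exists ((1, k) :: nil). intros z. simpl. ring. Qed.

Lemma real_exp_sum_expandable (f : C -> C) : real_exp_sum f -> expandable f.
Proof.
  intros [l Hl]. apply (expandable_ext (esum (complexify l)) f 0); [|apply expandable_esum].
  intros z _. symmetry. apply Hl.
Qed.

Lemma exponent_sequence_shift (c : R) : 0 < c -> exponent_sequence (fun q => c + INR q).
Proof.
  intros Hc. split; [|split].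
  - intros q. assert (P := pos_INR q). lra.
  - intros q. rewrite S_INR. lra.
  - apply (is_lim_seq_plus (fun _ => c) INR c p_infty); [apply is_lim_seq_const|apply is_lim_seq_INR|reflexivity].
Qed.

Lemma analytic_on_uapprox (D : C -> Prop) (f : C -> C) :
  (forall z, D z -> uapprox f z 1) -> analytic_on D f.
Proof. intros H z Hz. apply uapprox_analytic with 1; [lra|apply H, Hz]. Qed.

Lemma uapprox_linear_Cexp (k : R) (z0 : C) (r : R) : 0 <= r -> uapprox (fun z => Cexp (RtoC k * z)%C) z0 r.
Proof.
  intros Hr. apply uapprox_Cexp; [exact Hr|].
  apply uapprox_mult; [exact Hr|apply uapprox_const|apply uapprox_id].
Qed.

Lemma FC0_monomial (b c : R) : 0 < c -> FC0 (fun z => RtoC b * Cexp (RtoC (- c) * z))%C.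
Proof.
  intros Hc. exists (fun q => match q with O => b | _ => 0 end), (fun q => c + INR q), 0.
  split; [apply exponent_sequence_shift, Hc|split; [lra|split]].
  - apply analytic_on_uapprox. intros z _. apply uapprox_mult; [lra|apply uapprox_const|].
    apply uapprox_linear_Cexp. lra.
  - intros z N eps _ _ _.
    replace (sum_n _ N) with (RtoC b * Cexp (RtoC (- c) * z))%C.
    + unfold Cminus. rewrite Cplus_opp_r, Cmod_0. left; apply exp_pos.
    + induction N as [|N IH].
      * rewrite sum_O. simpl INR. rewrite Rplus_0_r. reflexivity.
      * rewrite sum_Sn, <- IH. change (plus ?u ?v) with (Cplus u v). simpl. ring.
Qed.

Lemma K10_ext (f g : C -> C) : (forall z, f z = g z) -> K10 f -> K10 g.
Proof.
  intros E [n [phi [lam [H [a [Ha Hk]]]]]]. exists n, phi, lam. split; [exact H|].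
  exists a. split; [exact Ha|]. intros z Hz. rewrite <- E. apply Hk, Hz.
Qed.

Lemma K10_zero : K10 (fun _ => RtoC 0).
Proof.
  exists O, (fun _ _ => RtoC 0), (fun _ => 1). split; [intros i Hi; lia|].
  exists 0. split; [lra|]. intros z _. rewrite sum_n_m_zero by lia. reflexivity.
Qed.

Lemma K10_plus_monomial (k : C -> C) (b mu : R) : K10 k ->
  K10 (fun z => RtoC b * Cexp (RtoC mu * z) + k z)%C.
Proof.
  intros [n [phi [lam [H [a [Ha Hk]]]]]].
  (* The monomial is written as (b e^{-cz}) e^{(mu+c)z}: this c makes both the decay rate of the
     [FC0] factor and the exponent lambda = mu + c positive. *)
  set (c := Rabs mu + 1). assert (Hc : 0 < c) by (unfold c; assert (P := Rabs_pos mu); lra).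
  assert (Hl : 0 < mu + c) by (unfold c; assert (P := Rabs_maj2 mu); lra).
  exists (S n), (fun i => if Nat.eq_dec i (S n) then (fun z => RtoC b * Cexp (RtoC (- c) * z))%C else phi i),
    (fun i => if Nat.eq_dec i (S n) then mu + c else lam i).
  split.
  - intros i Hi. destruct (Nat.eq_dec i (S n)); [split; [apply FC0_monomial, Hc|exact Hl]|apply H; lia].
  - exists a. split; [exact Ha|]. intros z Hz. rewrite Hk by exact Hz.
    rewrite sum_n_Sm by lia. change (plus ?u ?v) with (Cplus u v).
    destruct (Nat.eq_dec (S n) (S n)); [|congruence].
    rewrite Cplus_comm. f_equal.
    + apply sum_n_m_ext_loc. intros i Hi. destruct (Nat.eq_dec i (S n)); [lia|reflexivity].
    + rewrite <- Cmult_assoc, <- Cexp_plus. do 2 f_equal. rewrite RtoC_plus, RtoC_opp. ring.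
Qed.

Lemma K10_real_exp_sum (f : C -> C) : real_exp_sum f -> K10 f.
Proof.
  intros [l Hl]. apply (K10_ext (esum (complexify l))); [intros z; symmetry; apply Hl|]. clear Hl.
  induction l as [|p l IH]; [apply K10_zero|].
  apply (K10_ext (fun z => RtoC (fst p) * Cexp (RtoC (snd p) * z) + esum (complexify l) z)%C); [reflexivity|].
  apply K10_plus_monomial, IH.
Qed.

Lemma E1_multiple_of_exp (nu : R) : E1 (fun z => RtoC nu * Cexp z)%C nu.
Proof.
  exists (fun _ => 0), (fun q => 1 + INR q), 0.
  split; [apply exponent_sequence_shift; lra|split; [lra|split]].
  - apply analytic_on_uapprox. intros z _. apply uapprox_mult; [lra|apply uapprox_const|].
    apply uapprox_Cexp; [lra|apply uapprox_id].
  - intros z N eps _ _ _.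
    replace (sum_n _ N) with (RtoC 0).
    + replace (RtoC nu * Cexp z - RtoC nu * Cexp z - RtoC 0)%C with (RtoC 0) by ring.
      rewrite Cmod_0. left; apply exp_pos.
    + induction N as [|N IH].
      * rewrite sum_O. ring.
      * rewrite sum_Sn, <- IH. change (plus ?u ?v) with (Cplus u v). ring.
Qed.

(** A total function by way of [Lim_seq]; its value is meaningful under the geometric bound of
    [Cseries_tail]. *)
Definition Cseries (a : nat -> C) : C :=
  (real (Lim_seq (fun n => Re (csum a n))), real (Lim_seq (fun n => Im (csum a n)))).

Lemma im_le_Cmod (z : C) : Rabs (Im z) <= Cmod z.
Proof. eapply Rle_trans; [apply Rmax_r|apply Rmax_Cmod]. Qed.

Lemma Cseries_tail (a : nat -> C) (B q : R) (N : nat) : 0 <= B -> 0 <= q <= 1 / 2 ->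
  (forall k, Cmod (a k) <= B * q ^ k) -> Cmod (Cseries a - csum a N)%C <= 4 * B * q ^ N.
Proof.
  intros HB Hq H.
  assert (L0 : is_lim_seq (fun n => 2 * B * q ^ n) 0).
  { replace (Finite 0) with (Rbar_mult (2 * B) 0) by (simpl; f_equal; ring).
    apply is_lim_seq_scal_l, is_lim_seq_geom. rewrite Rabs_pos_eq; lra. }
  destruct (C_limit_of_cauchy (csum a) (fun n => 2 * B * q ^ n) L0) as [u Hu].
  { intros n k L. rewrite Cmod_minus_sym. replace k with (n + (k - n))%nat by lia.
    apply csum_geometric_tail; assumption. }
  assert (L1 : is_lim_seq (fun n => 2 * (2 * B * q ^ n)) 0).
  { replace (Finite 0) with (Rbar_mult 2 0) by (simpl; f_equal; ring). apply is_lim_seq_scal_l, L0. }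
  assert (G : forall (f : nat -> R) (x : R), (forall n, Rabs (x - f n) <= 2 * (2 * B * q ^ n)) -> real (Lim_seq f) = x).
  { intros f x Hf. rewrite (is_lim_seq_unique f x); [reflexivity|].
    apply is_lim_seq_spec. intros e. apply is_lim_seq_spec in L1. destruct (L1 e) as [n0 Hn0].
    exists n0. intros n Hn. specialize (Hn0 n Hn). specialize (Hf n). rewrite Rminus_0_r in Hn0.
    rewrite Rabs_minus_sym. eapply Rle_lt_trans; [exact Hf|]. eapply Rle_lt_trans; [apply Rle_abs|exact Hn0]. }
  replace (Cseries a) with u; [specialize (Hu N); lra|].
  unfold Cseries. rewrite (G _ (Re u)), (G _ (Im u)); [destruct u; reflexivity| |]; intros n.
  - eapply Rle_trans; [|apply Hu]. replace (Im u - Im (csum a n)) with (Im (u - csum a n)%C)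
      by (destruct u, (csum a n); reflexivity). apply im_le_Cmod.
  - eapply Rle_trans; [|apply Hu]. replace (Re u - Re (csum a n)) with (Re (u - csum a n)%C)
      by (destruct u, (csum a n); reflexivity). apply re_le_Cmod.
Qed.

(* Analytic continuation of [ln (1 - ln (1 + e^{-y}) / y)]. *)
Definition psi_term (z : C) (r : nat) : C := (G_coef r (/ z) * Cexp (RtoC (- INR r) * z))%C.

Definition psi (z : C) : C := Cseries (psi_term z).

Lemma exp_ge_numeric : 4 <= exp 2 /\ 8 <= exp 3.
Proof.
  assert (A : 2 <= exp 1) by (assert (Q := exp_ineq1_le 1); lra).
  assert (B : 4 <= exp 2) by (replace 2 with (1 + 1) by ring; rewrite exp_plus; nra).
  split; [exact B|]. replace 3 with (2 + 1) by ring. rewrite exp_plus. nra.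
Qed.

Lemma exp_neg_le (y : R) : 2 <= y -> 0 < exp (- y) <= 1 / 4.
Proof.
  intros Hy. split; [apply exp_pos|]. destruct exp_ge_numeric as [A _].
  apply Rle_trans with (exp (Ropp 2)); [apply exp_mono; lra|]. rewrite exp_Ropp.
  replace (1 / 4) with (/ 4) by field. apply Rinv_le_contravar; lra.
Qed.

Lemma Cmod_inv_le_1 (z : C) : 1 <= Re z -> Cmod (/ z)%C <= 1.
Proof.
  intros H. assert (A := re_le_Cmod z). assert (B := Rle_abs (Re z)).
  rewrite Cmod_inv.
  - rewrite <- Rinv_1. apply Rinv_le_contravar; lra.
  - intros E. rewrite E in H. simpl in H. lra.
Qed.

Lemma exp_neg_INR (n : nat) (y : R) : exp (- INR n * y) = exp (- y) ^ n.
Proof.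
  induction n as [|n IH]; [simpl; replace (- 0 * y) with 0 by ring; apply exp_0|].
  rewrite S_INR. simpl. rewrite <- IH, <- exp_plus. f_equal. ring.
Qed.

Lemma psi_tail (z : C) (N : nat) : 2 <= Re z ->
  Cmod (psi z - csum (psi_term z) N)%C <= 4 * (2 * exp (- Re z)) ^ N.
Proof.
  intros Hz. assert (E := exp_neg_le _ Hz).
  rewrite <- (Rmult_1_r 4) at 1. apply Cseries_tail; [lra|lra|].
  intros k. unfold psi_term. rewrite Cmod_mult, Cmod_Cexp, Rmult_1_l, Rpow_mult_distr.
  assert (I := Cmod_inv_le_1 z ltac:(lra)).
  replace (Re (RtoC (- INR k) * z)%C) with (- INR k * Re z) by (destruct z; simpl; ring).
  rewrite exp_neg_INR. apply Rmult_le_compat_r; [apply pow_le; lra|].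
  eapply Rle_trans; [apply G_coef_bound, I|]. assert (P : 0 < 2 ^ k) by (apply pow_lt; lra). nra.
Qed.

(** Partial sums converge uniformly for Re z >= 2 by [psi_tail]; starting at Re z >= 3 keeps the
    unit discs inside that region. *)
Lemma psi_analytic : analytic_on (halfplane 3) psi.
Proof.
  apply analytic_on_uapprox. intros z0 Hz0. unfold halfplane in Hz0.
  assert (M : 3 <= Cmod z0) by (assert (A := re_le_Cmod z0); assert (B := Rle_abs (Re z0)); lra).
  assert (Inv : uapprox Cinv z0 1).
  { apply (uapprox_weaken _ _ (Cmod z0 / 2)); [lra|]. apply uapprox_inv.
    intros E. rewrite E, Cmod_0 in M. lra. }
  apply uapprox_limit. intros e He. destruct (half_pow_small 4 e He) as [N HN].
  exists (fun z => csum (psi_term z) N). split.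
  - apply (function_ring_csum _ (fun r z => psi_term z r) N (uapprox_ring z0 1 ltac:(lra))).
    intros k _. unfold psi_term. apply uapprox_mult; [lra| |apply uapprox_linear_Cexp; lra].
    apply (function_ring_G_coef (fun f => uapprox f z0 1) Cinv k (uapprox_ring z0 1 ltac:(lra)) Inv).
  - intros h Hh.
    assert (R1 : 2 <= Re (z0 + h)%C).
    { assert (A := re_le_Cmod h). apply Rle_trans with (r3 := 1) in A; [|lra].
      apply Rabs_le_between in A. replace (Re (z0 + h)%C) with (Re z0 + Re h) by (destruct z0, h; reflexivity). lra. }
    eapply Rle_trans; [apply psi_tail, R1|]. eapply Rle_trans; [|exact HN].
    apply Rmult_le_compat_l; [lra|]. apply pow_incr. assert (E := exp_neg_le _ R1). lra.
Qed.

Lemma sum_n_csum (a : nat -> C) (n : nat) : sum_n a n = csum a (S n).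
Proof.
  induction n as [|n IH]; [rewrite sum_O; simpl; ring|]. rewrite sum_Sn, IH. reflexivity.
Qed.

Lemma ln_halfplane_real_inv (a x : R) : ln_halfplane a (RtoC x) -> a <= exp x.
Proof.
  intros [w [Hw [H0 E]]]. apply (f_equal fst) in E. simpl in E. rewrite E.
  rewrite exp_ln by (apply Cmod_gt_0, H0). unfold halfplane in Hw.
  assert (A := re_le_Cmod w). assert (B := Rle_abs (Re w)). lra.
Qed.

Lemma psi_FC10 : FC10 psi.
Proof.
  split.
  - exists 1, 8, 2. split; [lra|]. intros x Hx.
    assert (T := psi_tail (RtoC x) 1 Hx).
    replace (psi (RtoC x)) with (psi (RtoC x) - csum (psi_term (RtoC x)) 1)%C.
    + eapply Rle_trans; [exact T|]. simpl Re. replace (Ropp 1 * x) with (- x) by ring. lra.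
    + simpl csum. unfold psi_term, G_coef. ring.
  (* After composition with the exponential, 1/z becomes e^{-z} and e^{-qz} becomes exp (-q e^z):
     the coefficients are polynomials in e^{-z} and the principal exponents are -q. *)
  - exists 3, (fun q z => G_coef q (Cexp (RtoC (-1) * z))), (fun q z => RtoC (- INR q) * Cexp z)%C, (fun q => - INR q).
    split; [lra|split; [apply psi_analytic|]].
    split; [|split; [|split; [|split]]].
    + intros q. split.
      * apply K10_real_exp_sum.
        apply (function_ring_G_coef real_exp_sum (fun z => Cexp (RtoC (-1) * z)) q real_exp_sum_ring).
        apply real_exp_sum_Cexp.
      * apply analytic_on_uapprox. intros z _.
        apply (function_ring_G_coef (fun f => uapprox f z 1) (fun z => Cexp (RtoC (-1) * z)) q (uapprox_ring z 1 ltac:(lra))).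
        apply uapprox_linear_Cexp. lra.
    + intros q. split; [apply E1_multiple_of_exp|].
      apply analytic_on_uapprox. intros z _. apply uapprox_mult; [lra|apply uapprox_const|].
      apply uapprox_Cexp; [lra|apply uapprox_id].
    + intros q. rewrite S_INR. lra.
    + apply (is_lim_seq_opp INR p_infty), is_lim_seq_INR.
    (* From 2 e^{-y} <= e^{-y/2}, N0 > 2 lam + 2 gives the rate lam + 1; the spare factor e^{-y}
       absorbs the constant 4, since y >= 3. *)
    + intros lam Hlam. destruct (INR_unbounded (2 * lam + 2)) as [N0 HN0].
      exists N0. intros N HN x Hx. apply ln_halfplane_real_inv in Hx. set (y := exp x) in *.
      rewrite sum_n_csum, Cexp_RtoC. fold y.
      rewrite (csum_ext _ (psi_term (RtoC y))).
      * eapply Rle_lt_trans; [apply psi_tail; simpl; lra|]. simpl Re.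
        destruct exp_ge_numeric as [_ A].
        assert (Q : 2 * exp (- y) <= exp (- y / 2)).
        { replace (- y) with (- y / 2 + - y / 2) at 1 by field. rewrite exp_plus.
          assert (P := exp_pos (- y / 2)).
          assert (2 * exp (- y / 2) <= 1); [|nra].
          replace (- y / 2) with (- (y / 2)) by field. rewrite exp_Ropp.
          assert (2 <= exp (y / 2)) by (assert (Q := exp_ineq1_le (y / 2)); lra).
          apply Rmult_le_reg_r with (exp (y / 2)); [lra|]. rewrite Rmult_assoc, Rinv_l; lra. }
        assert (Q2 : (2 * exp (- y)) ^ S N <= exp (- (lam + 1) * y)).
        { apply Rle_trans with (exp (- y / 2) ^ S N).
          - apply pow_incr. split; [|exact Q]. assert (P := exp_pos (- y)). lra.
          - replace (- y / 2) with (- (y / 2)) by field. rewrite <- exp_neg_INR. apply exp_mono.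
            assert (N0 <= S N)%nat by lia. apply le_INR in H.
            nra. }
        apply Rle_lt_trans with (4 * exp (- (lam + 1) * y)); [lra|].
        replace (- (lam + 1) * y) with (- lam * y + - y) by ring. rewrite exp_plus, (exp_Ropp y).
        assert (P1 := exp_pos (- lam * y)).
        assert (P2 : 8 <= exp y) by (eapply Rle_trans; [exact A|apply exp_mono, Hx]).
        assert (P3 : 4 * / exp y < 1).
        { apply Rmult_lt_reg_r with (exp y); [lra|]. rewrite Rmult_assoc, Rinv_l; lra. }
        nra.
      * intros k _. unfold psi_term. f_equal. f_equal.
        replace (RtoC (-1) * RtoC x)%C with (RtoC (- x)) by (rewrite <- RtoC_mult; f_equal; ring).
        rewrite Cexp_RtoC, exp_Ropp. fold y. rewrite RtoC_inv; [reflexivity|]. unfold y. assert (P := exp_pos x). lra.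
Qed.

Definition G (y : R) : R := ln (1 - / y * ln (1 + exp (- y))).

Lemma G_real_term (y : R) (r : nat) : 0 < y ->
  psi_term (RtoC y) r = RtoC (real_coef (G_coef r) (/ y) * exp (- y) ^ r).
Proof.
  intros Hy. unfold psi_term. rewrite <- RtoC_inv by lra.
  rewrite G_coef_real, <- RtoC_mult, Cexp_RtoC, <- RtoC_mult, exp_neg_INR. reflexivity.
Qed.

Lemma inv_unit_interval (y : R) : 1 <= y -> 0 <= / y <= 1.
Proof.
  intros Hy. split; [left; apply Rinv_0_lt_compat; lra|].
  rewrite <- Rinv_1. apply Rinv_le_contravar; lra.
Qed.

Lemma G_coef_bound_real (s : R) (n : nat) : 0 <= s <= 1 -> Rabs (real_coef (G_coef n) s) <= 1 * 2 ^ n.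
Proof.
  intros Hs. rewrite Rmult_1_l. eapply Rle_trans; [apply re_le_Cmod|].
  assert (E : Cmod (RtoC s) = s) by (rewrite Cmod_R, Rabs_pos_eq; lra).
  eapply Rle_trans; [apply G_coef_bound; lra|]. rewrite E.
  assert (P : 0 < 2 ^ n) by (apply pow_lt; lra). nra.
Qed.

Lemma G_tail (y : R) (N : nat) : 2 <= y ->
  Cmod (RtoC (G y) - csum (fun n => RtoC (real_coef (G_coef n) (/ y) * exp (- y) ^ n)%R) N)%C
    <= 2 * (2 * exp (- y)) ^ N.
Proof.
  intros Hy. assert (E := exp_neg_le _ Hy). assert (I := inv_unit_interval y ltac:(lra)).
  unfold G. rewrite <- (PSeries_G (/ y) (exp (- y)) I ltac:(lra)).
  rewrite <- (Rmult_1_r 2) at 1. apply PSeries_tail; [lra| |lra].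
  intros n. apply G_coef_bound_real, I.
Qed.

Lemma psi_real (y : R) : 2 <= y -> psi (RtoC y) = RtoC (G y).
Proof.
  intros Hy. assert (E := exp_neg_le _ Hy).
  assert (Z : (psi (RtoC y) - RtoC (G y))%C = RtoC 0).
  { apply Cmod_eq_0. apply Rle_antisym; [|apply Cmod_ge_0]. apply le_epsilon. intros e He.
    destruct (half_pow_small 6 e He) as [N HN].
    assert (T1 := psi_tail (RtoC y) N Hy). assert (T2 := G_tail y N Hy). simpl Re in T1.
    rewrite (csum_ext _ (fun n => RtoC (real_coef (G_coef n) (/ y) * exp (- y) ^ n)%R)) in T1
      by (intros k _; apply G_real_term; lra).
    set (X := csum _ N) in *.
    replace (psi (RtoC y) - RtoC (G y))%C with ((psi (RtoC y) - X) - (RtoC (G y) - X))%C by ring.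
    eapply Rle_trans; [apply Cmod_minus_triangle|].
    assert ((2 * exp (- y)) ^ N <= (1 / 2) ^ N) by (apply pow_incr; lra). lra. }
  replace (psi (RtoC y)) with (psi (RtoC y) - RtoC (G y) + RtoC (G y))%C by ring. rewrite Z. ring.
Qed.

Definition log_conjugate (u : R) : R :=
  ln (- ln (exp (- exp u) + exp (- exp u) ^ 2)).

(** With q = e^{-y} and y = e^u, f(q) = q (1 + q), so -ln f(q) = y (1 - ln (1 + q)/y), and its
    logarithm splits as u + G y. *)
Lemma log_conjugate_eq (u : R) : 2 <= u -> log_conjugate u - u = G (exp u).
Proof.
  intros Hu. destruct exp_ge_numeric as [A _].
  assert (Hy : 4 <= exp u) by (eapply Rle_trans; [exact A|apply exp_mono, Hu]).
  unfold log_conjugate, G. set (y := exp u) in *.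
  assert (E := exp_neg_le y ltac:(lra)). assert (I := inv_unit_interval y ltac:(lra)).
  assert (P := one_minus_pos (/ y) (exp (- y)) I ltac:(lra)).
  replace (- ln (exp (- y) + exp (- y) ^ 2)) with (exp u * (1 - / y * ln (1 + exp (- y)))).
  - rewrite ln_mult by (fold y; lra). rewrite ln_exp. ring.
  - replace (exp (- y) + exp (- y) ^ 2) with (exp (- y) * (1 + exp (- y))) by ring.
    rewrite ln_mult by lra. rewrite ln_exp. fold y. field. lra.
Qed.

Lemma K11_log_conjugate (alpha : R) : 0 < alpha < 1 ->
  K11 (fun x => RtoC (log_conjugate (m alpha x) - m alpha x)).
Proof.
  intros Ha. exists (fun _ => RtoC 0), 1%nat, (fun _ => psi), (fun _ => alpha).
  split; [apply K10_zero|split].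
  - intros q _. split; [apply psi_FC10|exact Ha].
  - exists (2 / alpha). intros x Hx.
    assert (Hm : 2 <= m alpha x).
    { unfold m. apply Rmult_le_compat_l with (r := alpha) in Hx; [|lra].
      replace (alpha * (2 / alpha)) with 2 in Hx by (field; lra). exact Hx. }
    rewrite sum_n_n, log_conjugate_eq, psi_real by
      (first [exact Hm|assert (Q := exp_ineq1_le (m alpha x)); lra]). ring.
Qed.

(** * The derivative of G and the expansion of the bracket *)

Definition G' (y : R) : R :=
  / y * (/ (1 - / y * ln (1 + exp (- y))) - 1)
  + exp (- y) * / y / ((1 + exp (- y)) * (1 - / y * ln (1 + exp (- y)))).

Lemma G_derive (y : R) : 2 <= y -> is_derive G y (G' y).
Proof.
  intros Hy. assert (E := exp_neg_le y Hy). assert (I := inv_unit_interval y ltac:(lra)).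
  assert (P := one_minus_pos (/ y) (exp (- y)) I ltac:(lra)).
  unfold G, G'. auto_derive; [repeat split; lra|].
  rewrite Rinv_mult. set (s := / y) in *. set (L := ln (1 + exp (- y))) in *. field. lra.
Qed.

(* Coefficient of [q ^ n] in the expansion of [G'], with [s = 1 / y] and [q = e^{-y}]. *)
Definition G'_coef (n : nat) (s : C) : C :=
  match n with
  | O => RtoC 0
  | S _ => (s * inv_coef n s + RtoC (-1) * (RtoC (INR n) * G_coef n s))%C
  end.

Lemma G'_coef_bound (s : C) (n : nat) : Cmod s <= 1 -> Cmod (G'_coef n s) <= 2 * 2 ^ n * Cmod s.
Proof.
  intros Hs. assert (S0 := Cmod_ge_0 s). assert (P : 0 < 2 ^ n) by (apply pow_lt; lra).
  destruct n as [|n]; [simpl; rewrite Cmod_0; lra|]. unfold G'_coef.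
  eapply Rle_trans; [apply Cmod_triangle|]. rewrite !Cmod_mult, <- (Cmod_mult (RtoC (INR (S n)))).
  assert (A := scaled_G_coef_bound s (S n) Hs). assert (B := inv_coef_bound s (S n) Hs).
  assert (M : Cmod (RtoC (-1)) = 1) by (rewrite Cmod_R, Rabs_left; lra). rewrite M.
  assert (Cmod s * Cmod (inv_coef (S n) s) <= Cmod s * 2 ^ S n) by (apply Rmult_le_compat_l; assumption).
  lra.
Qed.

Lemma G'_coef_real (s : R) (n : nat) : G'_coef n (RtoC s) = RtoC (real_coef (G'_coef n) s).
Proof.
  destruct n as [|n]; [reflexivity|]. unfold real_coef.
  apply eq_RtoC_Re with
    (s * real_coef (inv_coef (S n)) s + (-1) * (INR (S n) * real_coef (G_coef (S n)) s)).
  unfold G'_coef. rewrite inv_coef_real, G_coef_real, <- !RtoC_mult, <- RtoC_plus. reflexivity.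
Qed.

Lemma G'_coef_bound_real (s : R) (n : nat) : 0 <= s <= 1 -> Rabs (real_coef (G'_coef n) s) <= 2 * 2 ^ n.
Proof.
  intros Hs. eapply Rle_trans; [apply re_le_Cmod|].
  assert (E : Cmod (RtoC s) = s) by (rewrite Cmod_R, Rabs_pos_eq; lra).
  eapply Rle_trans; [apply G'_coef_bound; lra|]. rewrite E.
  assert (P : 0 < 2 ^ n) by (apply pow_lt; lra). nra.
Qed.

(** Chain rule through s = 1/y and q = e^{-y}, with L = ln (1 + q). The s-part s^2 L/(1 - sL) equals
    s (1/(1 - sL) - 1), whence s times [inv_coef] without its constant term; the q-part is -q times
    the q-derivative, whence -n [G_coef n]. *)
Lemma PSeries_G' (y : R) : 2 <= y ->
  PSeries (fun n => real_coef (G'_coef n) (/ y)) (exp (- y)) = G' y.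
Proof.
  intros Hy. assert (E := exp_neg_le y Hy). assert (I := inv_unit_interval y ltac:(lra)).
  set (s := / y) in *. set (q := exp (- y)) in *.
  assert (P := one_minus_pos s q I ltac:(lra)).
  assert (Hq : Rabs q <= 1 / 4) by (rewrite Rabs_pos_eq; lra).
  set (a := fun n => real_coef (G_coef n) s). set (b := fun n => real_coef (inv_coef n) s).
  set (d := fun n : nat => match n with O => 1 | _ => 0 end).
  assert (Xb : ex_pseries b q) by (apply CV_radius_inside, geometric_radius; [apply inv_coefs_geometric, I|exact Hq]).
  assert (Xa : ex_pseries (PS_derive a) q).
  { apply ex_pseries_derive, geometric_radius; [apply G_coefs_geometric, I|exact Hq]. }
  assert (Xd : is_pseries d q 1).
  { apply is_pseries_R. apply is_series_Reals. intros e He. exists O. intros n _.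
    rewrite (sum_eq _ d).
    - replace (sum_f_R0 d n) with 1; [unfold Rdist; rewrite Rminus_diag, Rabs_R0; exact He|].
      clear. induction n as [|n IH]; [reflexivity|]. simpl. rewrite <- IH. ring.
    - intros [|i] _; unfold d; simpl; ring. }
  apply PSeries_correct in Xb. apply PSeries_correct in Xa.
  assert (Ea := PSeries_derive_G s q I ltac:(lra)). fold a in Ea. rewrite Ea in Xa.
  unfold b in Xb. rewrite PSeries_inv in Xb by lra. fold b in Xb.
  apply is_pseries_R in Xa. apply is_pseries_R in Xb. apply is_pseries_R in Xd.
  apply is_pseries_unique, is_pseries_R.
  assert (Y : is_series (fun n => s * (b n * q ^ n) + - s * (d n * q ^ n)) (s * / (1 - s * ln (1 + q)) + - s * 1)).
  { apply (is_series_plus (fun n => s * (b n * q ^ n)) (fun n => - s * (d n * q ^ n))).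
    - apply (is_series_scal_l s (fun n => b n * q ^ n)), Xb.
    - apply (is_series_scal_l (- s) (fun n => d n * q ^ n)), Xd. }
  assert (Z : is_series (fun n => match n with O => 0 | S k => - q * (PS_derive a k * q ^ k) end)
     (- q * (- s / ((1 + q) * (1 - s * ln (1 + q)))))).
  { assert (Z0 := is_series_scal_l (- q) (fun n => PS_derive a n * q ^ n) _ Xa).
    apply is_series_decr_1. change (plus ?u (opp ?v)) with (u + - v). rewrite Ropp_0, Rplus_0_r. exact Z0. }
  assert (W := is_series_plus _ _ _ _ Y Z). change (plus ?u ?v) with (u + v) in W.
  assert (F : s * / (1 - s * ln (1 + q)) + - s * 1 + - q * (- s / ((1 + q) * (1 - s * ln (1 + q)))) = G' y).
  { unfold G'. fold s q. field. lra. }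
  rewrite <- F. apply (is_series_ext (fun n => (s * (b n * q ^ n) + - s * (d n * q ^ n)) +
      match n with O => 0 | S k => - q * (PS_derive a k * q ^ k) end)); [|exact W].
  intros [|n].
  - unfold b, d, real_coef, inv_coef. simpl. ring.
  - unfold d, PS_derive. unfold real_coef at 1. unfold G'_coef.
    rewrite inv_coef_real, G_coef_real, <- !RtoC_mult, <- RtoC_plus. 
    change (s * (b (S n) * q ^ S n) + - s * (0 * q ^ S n) + - q * (INR (S n) * a (S n) * q ^ n)
      = (s * b (S n) + (-1) * (INR (S n) * a (S n))) * q ^ S n).
    cbn [pow]. ring.
Qed.

Lemma G'_tail (y : R) (N : nat) : 2 <= y ->
  Cmod (RtoC (G' y) - csum (fun n => RtoC (real_coef (G'_coef n) (/ y) * exp (- y) ^ n)%R) N)%C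
    <= 4 * (2 * exp (- y)) ^ N.
Proof.
  intros Hy. assert (E := exp_neg_le _ Hy). assert (I := inv_unit_interval y ltac:(lra)).
  rewrite <- (PSeries_G' y Hy). replace 4 with (2 * 2) by ring. apply PSeries_tail; [lra| |lra].
  intros n. apply G'_coef_bound_real, I.
Qed.

Lemma log_conjugate_derive (alpha x : R) : 0 < alpha -> 2 < alpha * x ->
  Derive (fun x => log_conjugate (m alpha x) - m alpha x) x
    = alpha * (exp (alpha * x) * G' (exp (alpha * x))).
Proof.
  intros Ha Hx. apply is_derive_unique.
  apply (is_derive_ext_loc (fun x => G (exp (alpha * x)))).
  - assert (Pe : 0 < x - 2 / alpha).
    { apply Rmult_lt_reg_l with alpha; [exact Ha|]. replace (alpha * (x - 2 / alpha)) with (alpha * x - 2) by (field; lra). lra. }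
    exists (mkposreal _ Pe). intros t Ht. symmetry. apply log_conjugate_eq. unfold m.
    change (Rabs (t - x) < x - 2 / alpha) in Ht. apply Rabs_lt_between in Ht.
    apply Rmult_le_reg_l with (/ alpha); [apply Rinv_0_lt_compat, Ha|].
    rewrite <- Rmult_assoc, Rinv_l, Rmult_1_l by lra. unfold Rdiv in Ht. lra.
  - assert (Y : 2 <= exp (alpha * x)) by (assert (Q := exp_ineq1_le (alpha * x)); lra).
    replace (alpha * (exp (alpha * x) * G' (exp (alpha * x))))
      with (scal (alpha * exp (alpha * x)) (G' (exp (alpha * x)))) by (change (scal ?u ?v) with (u * v); eqR; ring).
    apply (is_derive_comp G (fun x => exp (alpha * x))).
    + apply G_derive, Y.
    + auto_derive; auto. ring.
Qed.

(* [k2' k1 - k1' k2] at [x = 2 t]. *)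
Definition bracket (t : R) : R :=
  let y := exp t in let v := exp (2 / 3 * t) in
  1 / 3 * (v * G' v) * G y - 1 / 2 * (y * G' y) * G v.

(** Obtained by keeping the first terms G(y) ~ -e^{-y}/y and G'(y) ~ (1/y + 1/y^2) e^{-y}. With v/y
    = e^{-t/3}, the bracket becomes e^{-y} (-(1/3) e^{-t/3} G'(v) - (1/2)(1 + e^{-t}) G(v)) plus
    smaller terms, and this is expanded in powers of e^{-v} with s = 1/v. *)
Definition bracket_coef (n : nat) (z : C) : C :=
  let s := Cexp (RtoC (- (2 / 3)) * z) in
  (RtoC (- (1 / 3)) * (Cexp (RtoC (- (1 / 3)) * z) * G'_coef n s)
   + RtoC (- (1 / 2)) * ((RtoC 1 + Cexp (RtoC (-1) * z)) * G_coef n s))%C.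

Definition bracket_item (n : nat) : item :=
  (fun t => - exp t - INR n * exp (2 / 3 * t), bracket_coef n).

Lemma bracket_item_valid (n : nat) : valid (bracket_item n).
Proof.
  split.
  - exists ((-1, 1) :: (- INR n, 2 / 3) :: nil). split.
    + intros q [<-|[<-|[]]]; simpl; lra.
    + intros x. simpl. rewrite Rmult_1_l. ring.
  - apply real_exp_sum_expandable. assert (HR := real_exp_sum_ring). destruct HR as [Hc [Hp [Hm He]]].
    assert (Hs := real_exp_sum_Cexp (- (2 / 3))).
    apply Hp; apply Hm; auto; apply Hm.
    + apply real_exp_sum_Cexp.
    + destruct n as [|n]; [exact (Hc 0)|]. unfold bracket_item, G'_coef. simpl snd.
      apply Hp; apply Hm; auto.
      * apply (function_ring_inv_coef _ _ (S n) real_exp_sum_ring Hs).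
      * apply Hm; auto. apply (function_ring_G_coef _ _ (S n) real_exp_sum_ring Hs).
    + apply Hp; [apply Hc|apply real_exp_sum_Cexp].
    + apply (function_ring_G_coef _ _ n real_exp_sum_ring Hs).
Qed.

Lemma Cexp_real_mult (k t : R) : Cexp (RtoC k * RtoC t) = RtoC (exp (k * t)).
Proof. rewrite <- RtoC_mult. apply Cexp_RtoC. Qed.

(** By [G_coef_leading] the coefficient is c s/2 up to O(s e^{-t/3}), where c = (-1)^n/(n+1): the
    term with G' carries the factor e^{-t/3}, and the other corrections a factor s = e^{-2t/3} or
    e^{-t}. *)
Lemma bracket_item_nonzero (n : nat) : nonzero (bracket_item (S n)).
Proof.
  destruct (expandable_dichotomy _ (proj2 (bracket_item_valid (S n)))) as [Z|Z]; [exfalso|exact Z].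
  set (c := (-1) ^ n / INR (S n)).
  assert (Hc : 0 < Rabs c).
  { apply Rabs_pos_lt. unfold c. apply Rmult_integral_contrapositive_currified.
    - apply pow_nonzero. lra.
    - apply Rinv_neq_0_compat, not_0_INR. lia. }
  set (P := 2 ^ S n). assert (HP : 0 < P) by (apply pow_lt; lra).
  (* Vanishing would force |c| <= 4 P w, while this point is chosen with 12 P w <= |c|. *)
  assert (D := ev_exp_dominated (Rabs c / 4) (3 * P) (- (1 / 3)) 0 ltac:(lra) ltac:(lra)).
  destruct (ev_and _ _ Z (ev_and _ _ D (ev_ge 0))) as [X HX].
  destruct (HX X (Rle_refl _)) as [X1 [X2 X3]]. clear HX Z D.
  rewrite Rmult_0_l, exp_0 in X2. unfold bracket_item in X1. simpl snd in X1. unfold bracket_coef in X1.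
  rewrite !Cexp_real_mult in X1.
  set (w := exp (- (1 / 3) * X)) in *. set (s := exp (- (2 / 3) * X)) in *. set (u := exp (-1 * X)) in *.
  assert (W0 : 0 < w) by apply exp_pos. assert (S0 : 0 < s) by apply exp_pos.
  assert (U0 : 0 < u) by apply exp_pos.
  assert (W1 : w <= 1) by (rewrite <- exp_0; apply exp_mono; lra).
  assert (S1 : s <= w) by (apply exp_mono; lra).
  assert (U1 : u <= w) by (apply exp_mono; lra).
  assert (Es : Cmod (RtoC s) = s) by (rewrite Cmod_R, Rabs_pos_eq; lra).
  assert (B1 := G'_coef_bound (RtoC s) (S n) ltac:(lra)). assert (B2 := G_coef_bound (RtoC s) (S n) ltac:(lra)).
  assert (B3 := G_coef_leading (RtoC s) n ltac:(lra)). rewrite Es in B1, B2, B3. fold P in B1, B2, B3. fold c in B3.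
  set (g := G_coef (S n) (RtoC s)) in *. set (g' := G'_coef (S n) (RtoC s)) in *.
  assert (E : (RtoC (1 / 2) * (RtoC c * RtoC s))%C =
    (RtoC (1 / 3) * (RtoC w * g') + (RtoC (1 / 2) * (RtoC u * g) + RtoC (1 / 2) * (g + RtoC c * RtoC s)))%C).
  { transitivity (RtoC (1 / 2) * (RtoC c * RtoC s) - RtoC 0)%C; [ring|]. rewrite <- X1.
    rewrite !RtoC_opp. ring. }
  apply (f_equal Cmod) in E.
  assert (T : Cmod (RtoC (1 / 2) * (RtoC c * RtoC s))%C <= 1 / 3 * (w * (2 * P * s)) + (1 / 2 * (u * (P * s)) + 1 / 2 * (P * s * s))).
  { rewrite E. eapply Rle_trans; [apply Cmod_triangle|]. apply Rplus_le_compat.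
    - rewrite !Cmod_mult, !Cmod_R, !Rabs_pos_eq by lra.
      apply Rmult_le_compat_l; [lra|]. apply Rmult_le_compat_l; lra.
    - eapply Rle_trans; [apply Cmod_triangle|]. apply Rplus_le_compat.
      + rewrite !Cmod_mult, !Cmod_R, !Rabs_pos_eq by lra.
        apply Rmult_le_compat_l; [lra|]. apply Rmult_le_compat_l; lra.
      + rewrite !Cmod_mult, !Cmod_R, !Rabs_pos_eq by lra. apply Rmult_le_compat_l; lra. }
  rewrite !Cmod_mult, !Cmod_R, (Rabs_pos_eq (1 / 2)), (Rabs_pos_eq s) in T by lra.
  assert (PS : 0 < P * s) by (apply Rmult_lt_0_compat; assumption).
  assert (T2 : 1 / 2 * (Rabs c * s) <= 2 * (P * s) * w) by nra.
  assert (T3 : Rabs c <= 4 * P * w).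
  { apply Rmult_le_reg_r with s; [exact S0|]. lra. }
  lra.
Qed.

(** Rank 0 contributes nothing, as both coefficient families vanish there; hence N items against
    sums with [S N] terms. *)
Lemma isum_bracket_items (N : nat) (t : R) :
  isum (term_range bracket_item 0 N) t =
  (RtoC (exp (- exp t)) *
   (RtoC (- (1 / 3) * exp (- (1 / 3) * t)) *
      csum (fun n => RtoC (real_coef (G'_coef n) (/ exp (2 / 3 * t)) * exp (- exp (2 / 3 * t)) ^ n)%R) (S N)
    + RtoC (- (1 / 2) * (1 + exp (- t))) *
      csum (fun n => RtoC (real_coef (G_coef n) (/ exp (2 / 3 * t)) * exp (- exp (2 / 3 * t)) ^ n)%R) (S N)))%C.
Proof.
  unfold term_range. rewrite Nat.sub_0_r.
  assert (Es : / exp (2 / 3 * t) = exp (- (2 / 3) * t)).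
  { rewrite <- exp_Ropp. f_equal. ring. }
  rewrite Es. induction N as [|N IH].
  - simpl. change (G'_coef 0) with (fun _ : C => RtoC 0). change (G_coef 0) with (fun _ : C => RtoC 0).
    unfold real_coef. simpl. rewrite !Rmult_0_l. ring.
  - rewrite seq_S, map_app, isum_app, IH. clear IH.
    set (A := csum _ (S N)). set (B := csum _ (S N)).
    change (csum (fun n => RtoC (real_coef (G'_coef n) (exp (- (2 / 3) * t)) * exp (- exp (2 / 3 * t)) ^ n)%R) (S (S N)))
      with (A + RtoC (real_coef (G'_coef (S N)) (exp (- (2 / 3) * t)) * exp (- exp (2 / 3 * t)) ^ S N)%R)%C.
    change (csum (fun n => RtoC (real_coef (G_coef n) (exp (- (2 / 3) * t)) * exp (- exp (2 / 3 * t)) ^ n)%R) (S (S N)))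
      with (B + RtoC (real_coef (G_coef (S N)) (exp (- (2 / 3) * t)) * exp (- exp (2 / 3 * t)) ^ S N)%R)%C.
    simpl map. simpl isum. unfold ival, bracket_item. cbn [fst snd]. unfold bracket_coef.
    rewrite !Cexp_real_mult, G'_coef_real, G_coef_real.
    replace (exp (- exp t - INR (S N) * exp (2 / 3 * t))) with (exp (- exp t) * exp (- exp (2 / 3 * t)) ^ S N).
    2:{ rewrite <- exp_neg_INR, <- exp_plus. f_equal. ring. }
    replace (exp (-1 * t)) with (exp (- t)) by (f_equal; ring).
    rewrite !RtoC_mult, RtoC_plus. ring.
Qed.

Lemma bracket_expansion (N : nat) :
  ev (fun t => Cmod (RtoC (bracket t) - isum (term_range bracket_item 0 N) t)%C <=
    6 * 2 ^ S N * exp (- exp t - INR (S N) * exp (2 / 3 * t)) + 48 * exp (t + -2 * exp t)).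
Proof.
  exists 3. intros t Ht.
  set (y := exp t). set (v := exp (2 / 3 * t)).
  assert (Hv : 2 <= v) by (assert (Q := exp_ineq1_le (2 / 3 * t)); unfold v; lra).
  assert (Hvy : v <= y) by (apply exp_mono; lra).
  assert (Dv := G'_tail v (S N) Hv). assert (Gv := G_tail v (S N) Hv).
  assert (Dv0 := G'_tail v 0 Hv). assert (Gv0 := G_tail v 0 Hv).
  assert (Dy := G'_tail y 2 ltac:(lra)). assert (Gy := G_tail y 2 ltac:(lra)).
  rewrite isum_bracket_items. fold y v.
  set (SD := csum (fun n => RtoC (real_coef (G'_coef n) (/ v) * exp (- v) ^ n)%R) (S N)) in *.
  set (SG := csum (fun n => RtoC (real_coef (G_coef n) (/ v) * exp (- v) ^ n)%R) (S N)) in *.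
  simpl pow in Dv0, Gv0. simpl csum in Dv0, Gv0.
  replace (RtoC (G' v) - RtoC 0)%C with (RtoC (G' v)) in Dv0 by ring.
  replace (RtoC (G v) - RtoC 0)%C with (RtoC (G v)) in Gv0 by ring.
  assert (c1 : real_coef (G_coef 1) (/ y) = - / y).
  { unfold real_coef, G_coef. simpl. unfold inv_coef. simpl. field. lra. }
  assert (c2 : real_coef (G'_coef 1) (/ y) = / y + / y * / y).
  { unfold real_coef, G'_coef. rewrite inv_coef_S. unfold G_coef. simpl. unfold inv_coef. simpl. field. lra. }
  simpl csum in Dy, Gy. rewrite c1 in Gy. rewrite c2 in Dy.
  replace (real_coef (G'_coef 0) (/ y)) with 0 in Dy by reflexivity.
  replace (real_coef (G_coef 0) (/ y)) with 0 in Gy by reflexivity.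
  set (e := exp (- y)) in *. set (q := exp (- v)) in *.
  assert (He : 0 < e) by apply exp_pos. assert (Hq : 0 < q) by apply exp_pos.
  (* [r1] and [r4] are truncation errors at v and keep the factor e^{-y}; [r2] and [r3] are what
     remains at y beyond the first term, of order e^{-2y}. The two groups give the two error terms
     of the statement. *)
  set (r1 := (RtoC (G' v) - SD)%C) in *. set (r4 := (RtoC (G v) - SG)%C) in *.
  set (r2 := RtoC (G y + / y * e)). set (r3 := RtoC (G' y - (/ y + / y * / y) * e)).
  assert (R2 : Cmod r2 <= 8 * (e * e)).
  { replace r2 with (RtoC (G y) - (RtoC 0 + RtoC (0 * e ^ 0) + RtoC (- / y * e ^ 1)))%C.
    - eapply Rle_trans; [exact Gy|]. right. ring.
    - unfold r2. rewrite <- !RtoC_plus, <- RtoC_minus. f_equal. ring. }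
  assert (R3 : Cmod r3 <= 16 * (e * e)).
  { replace r3 with (RtoC (G' y) - (RtoC 0 + RtoC (0 * e ^ 0) + RtoC ((/ y + / y * / y) * e ^ 1)))%C.
    - eapply Rle_trans; [exact Dy|]. right. ring.
    - unfold r3. rewrite <- !RtoC_plus, <- RtoC_minus. f_equal. ring. }
  assert (Ew : exp (- (1 / 3) * t) = v * / y).
  { unfold v, y. rewrite <- exp_Ropp, <- exp_plus. f_equal. field. }
  assert (Eu : exp (- t) = / y) by (unfold y; apply exp_Ropp).
  rewrite Ew, Eu.
  assert (Iy := inv_unit_interval y ltac:(lra)).
  assert (Wv : 0 <= v * / y <= 1).
  { split; [apply Rmult_le_pos; lra|]. apply Rmult_le_reg_r with y; [lra|].
    rewrite Rmult_assoc, Rinv_l by lra. lra. }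
  replace (RtoC (bracket t) - _)%C with
    (RtoC (- (1 / 3) * (v * / y) * e) * r1 + RtoC (1 / 3 * v) * (RtoC (G' v) * r2)
     + (RtoC (- (1 / 2) * (1 + / y) * e) * r4 + RtoC (- (1 / 2) * y) * (RtoC (G v) * r3)))%C.
  2:{ unfold bracket. fold y v. unfold r1, r4, r2, r3.
      replace (RtoC (1 / 3 * (v * G' v) * G y - 1 / 2 * (y * G' y) * G v)) with
       (RtoC (1 / 3 * v) * RtoC (G' v) * RtoC (G y) - RtoC (1 / 2 * y) * RtoC (G' y) * RtoC (G v))%C
       by (rewrite <- !RtoC_mult, <- RtoC_minus; f_equal; ring).
      replace (RtoC (- (1 / 2) * y)) with (- RtoC (1 / 2 * y))%C by (rewrite <- RtoC_opp; f_equal; ring).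
      replace (RtoC (G' y - (/ y + / y * / y) * e)) with (RtoC (G' y) - RtoC ((/ y + / y * / y) * e))%C by (rewrite <- RtoC_minus; reflexivity).
      replace (RtoC (G y + / y * e)) with (RtoC (G y) + RtoC (/ y * e))%C by (rewrite <- RtoC_plus; reflexivity).
      replace (RtoC (- (1 / 3) * (v * / y) * e)) with (- (RtoC (1 / 3 * v) * RtoC (/ y * e)))%C
        by (rewrite <- RtoC_mult, <- RtoC_opp; f_equal; ring).
      replace (RtoC (- (1 / 2) * (1 + / y) * e)) with (- (RtoC (1 / 2 * y) * RtoC ((/ y + / y * / y) * e)))%C
        by (rewrite <- RtoC_mult, <- RtoC_opp; f_equal; field; lra).
      replace (RtoC (- (1 / 3) * (v * / y))) with (- (RtoC (1 / 3 * v) * RtoC (/ y)))%C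
        by (rewrite <- RtoC_mult, <- RtoC_opp; f_equal; ring).
      replace (RtoC (- (1 / 2) * (1 + / y))) with (- (RtoC (1 / 2 * y) * RtoC (/ y + / y * / y)))%C
        by (rewrite <- RtoC_mult, <- RtoC_opp; f_equal; field; lra).
      rewrite !(RtoC_mult _ e). ring. }
  assert (Fin1 : exp (- y - INR (S N) * v) = e * q ^ S N).
  { unfold q. rewrite <- exp_neg_INR. unfold e. rewrite <- exp_plus. f_equal. ring. }
  assert (Fin2 : exp (t + -2 * y) = y * (e * e)).
  { unfold e. rewrite <- exp_plus. unfold y at 2. rewrite <- exp_plus. f_equal. ring. }
  rewrite Fin1, Fin2.
  replace (2 * 2 ^ S N) with (2 ^ S (S N)) in * by (simpl; ring).
  rewrite Rpow_mult_distr in Dv, Gv. set (Q := 2 ^ S N * q ^ S N) in *.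
  assert (HQ : 0 < Q) by (apply Rmult_lt_0_compat; apply pow_lt; lra).
  assert (He2 : 0 < e * e) by (apply Rmult_lt_0_compat; assumption).
  assert (T1 : Cmod (RtoC (- (1 / 3) * (v * / y) * e) * r1)%C <= 1 / 3 * e * (4 * Q)).
  { rewrite Cmod_mult. apply Rmult_le_compat; [apply Cmod_ge_0|apply Cmod_ge_0| |exact Dv].
    rewrite Cmod_R, Rabs_left1 by nra. nra. }
  assert (T2 : Cmod (RtoC (1 / 3 * v) * (RtoC (G' v) * r2))%C <= 1 / 3 * y * (4 * (8 * (e * e)))).
  { rewrite !Cmod_mult. apply Rmult_le_compat; [apply Cmod_ge_0|apply Rmult_le_pos; apply Cmod_ge_0| |].
    - rewrite Cmod_R, Rabs_pos_eq by lra. lra.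
    - apply Rmult_le_compat; try apply Cmod_ge_0; [lra|exact R2]. }
  assert (T3 : Cmod (RtoC (- (1 / 2) * (1 + / y) * e) * r4)%C <= e * (2 * Q)).
  { rewrite Cmod_mult. apply Rmult_le_compat; [apply Cmod_ge_0|apply Cmod_ge_0| |exact Gv].
    rewrite Cmod_R, Rabs_left1 by nra. nra. }
  assert (T4 : Cmod (RtoC (- (1 / 2) * y) * (RtoC (G v) * r3))%C <= 1 / 2 * y * (2 * (16 * (e * e)))).
  { rewrite !Cmod_mult. apply Rmult_le_compat; [apply Cmod_ge_0|apply Rmult_le_pos; apply Cmod_ge_0| |].
    - rewrite Cmod_R, Rabs_left1 by lra. lra.
    - apply Rmult_le_compat; try apply Cmod_ge_0; [lra|exact R3]. }
  eapply Rle_trans; [apply Cmod_triangle|].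
  eapply Rle_trans; [apply Rplus_le_compat; apply Cmod_triangle|].
  replace (6 * 2 ^ S N * (e * q ^ S N)) with (6 * (e * Q)) by (unfold Q; ring).
  assert (0 < e * Q) by (apply Rmult_lt_0_compat; assumption).
  assert (0 < y * (e * e)) by (apply Rmult_lt_0_compat; lra). lra.
Qed.

Lemma expandable_const (c : R) : expandable (fun _ => RtoC c).
Proof. apply real_exp_sum_expandable, real_exp_sum_ring. Qed.

Lemma bracket_flat : flat_at 1 (fun t => RtoC (bracket t)).
Proof.
  exists (1 / 2). split; [lra|].
  assert (Z1 := ev_dexp_const 60 (-1) (- (1 / 2)) ltac:(lra)).
  assert (Z2 := ev_dexp 1 0 (-2) (-1) ltac:(lra)).
  apply (ev_mono _ _ (ev_and _ _ (bracket_expansion 0) (ev_and _ _ Z1 Z2))). intros t [X1 [X2 X3]].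
  unfold term_range in X1. simpl isum in X1. unfold Cminus in X1. rewrite Copp_0, Cplus_0_r in X1.
  rewrite Rmult_1_l. eapply Rle_trans; [exact X1|].
  assert (Y1 : exp (- exp t - INR 1 * exp (2 / 3 * t)) <= exp (-1 * exp t)).
  { apply exp_mono. simpl INR. assert (P := exp_pos (2 / 3 * t)). lra. }
  assert (Y2 : exp (t + -2 * exp t) <= exp (-1 * exp t)).
  { eapply Rle_trans; [|exact X3]. right. rewrite <- exp_plus. f_equal. ring. }
  simpl pow. lra.
Qed.

Lemma bracket_not_K11 (W : R -> R) :
  ev (fun t => W (2 * t) = bracket t) -> ~ K11 (fun x => RtoC (W x)).
Proof.
  intros EW HK.
  assert (FW : flat_at (1 / 2) (fun x => RtoC (W x))).
  { destruct bracket_flat as [e [He F]]. exists e. split; [exact He|].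
    apply (ev_unscale _ 2); [lra|].
    apply (ev_mono _ _ (ev_and _ _ EW F)). intros t [X1 X2]. rewrite X1.
    replace (1 / 2 * (2 * t)) with (1 * t) by field. exact X2. }
  destruct (K11_leading_scale _ (1 / 2) ltac:(lra) FW HK) as [H [r [c [GH [Hc [[er [Her Fr]] EH]]]]]].
  apply (ev_scale _ 2 ltac:(lra)) in EH. apply (ev_scale _ 2 ltac:(lra)) in Fr.
  (* Any rate above 2 would do: with r negligible because 2c > 1, accuracy e^{-3y} leaves a total
     error e^{-2y}, below every item of the bracket. *)
  destruct GH as [a [B [HB HG]]]. destruct (HG 3 ltac:(lra)) as [mu0 Hmu].
  destruct (Hmu (Rmax mu0 1) (Rmax_l _ _)) as [F [l [eta [_ [V [_ [_ [EF [UF _]]]]]]]]].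
  { assert (Q := Rmax_r mu0 1). lra. }
  destruct (item_normal_form l V) as [l' [Nl [_ El]]].
  assert (Close : ev (fun t => Cmod (RtoC (bracket t) - isum l' t)%C <= exp (-2 * exp t))).
  { assert (D1 := ev_exp_dominated er 3 1 (c * 2) Her ltac:(lra)).
    assert (D2 := ev_dexp_const (1 + B) (-3) (-2) ltac:(lra)).
    apply (ev_mono _ _ (ev_and _ _ EW (ev_and _ _ EH (ev_and _ _ Fr (ev_and _ _ EF (ev_and _ _ El
      (ev_and _ _ (ev_ge a) (ev_and _ _ D1 D2)))))))).
    intros t [X1 [X2 [X3 [X4 [X5 [X6 [X7 X8]]]]]]].
    rewrite X1 in X2. rewrite X2, X5, <- X4.
    replace (1 / 2 * (2 * t)) with t by field.
    replace (H t + r (2 * t)%R - F (RtoC t))%C with ((H t - F (RtoC t)) + r (2 * t)%R)%C by ring.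
    eapply Rle_trans; [apply Cmod_triangle|]. specialize (UF t X6).
    assert (Y : exp (- er * exp (c * (2 * t))) <= exp (-3 * exp t)).
    { apply exp_mono. rewrite Rmult_1_l in X7. replace (c * (2 * t)) with (c * 2 * t) by ring. lra. }
    change (- (3)) with (-3) in UF. lra. }
  apply (no_infinite_expansion bracket_item l' 0).
  - intros [|n] Hn; [lia|]. split; [apply bracket_item_valid|apply bracket_item_nonzero].
  - exact Nl.
  - intros N b _ Hb Eb e He.
    (* The error of the finite sum and the two errors of [bracket_expansion] are recast as items, so
       that [item_dominated] compares each with b. *)
    set (b0 := (fun t => -2 * exp t, fun _ => RtoC 1) : item).
    set (b1 := (fun t => - exp t - INR (S N) * exp (2 / 3 * t), fun _ => RtoC (6 * 2 ^ S N)) : item).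
    set (b2 := (fun t => -2 * exp t, (fun z => RtoC 48 * Cexp (RtoC 1 * z))%C) : item).
    assert (Lab2 : label (fun t => -2 * exp t)).
    { exists ((-2, 1) :: nil). split; [intros q [<-|[]]; simpl; lra|]. intros x. simpl. rewrite Rmult_1_l. ring. }
    assert (Gt2 : label_gt (fst b) (fun t => -2 * exp t)).
    { rewrite Eb. exists (1 / 2), 1. split; [lra|split; [lra|]].
      assert (D := ev_exp_dominated (1 / 2) (INR N) (2 / 3) 1 ltac:(lra) ltac:(lra)).
      apply (ev_mono _ _ D). intros t Ht. simpl. rewrite Rmult_1_l in *. lra. }
    assert (Gt1 : label_gt (fst b) (fst b1)).
    { rewrite Eb. exists 1, (2 / 3). split; [lra|split; [lra|]]. exists 0. intros t _.
      unfold b1, bracket_item. cbn [fst]. rewrite S_INR. lra. }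
    assert (V0 : valid b0) by (split; [exact Lab2|apply expandable_const]).
    assert (V1 : valid b1) by (split; [apply (proj1 (bracket_item_valid (S N)))|apply expandable_const]).
    assert (V2 : valid b2).
    { split; [exact Lab2|]. apply expandable_mult; [apply expandable_const|].
      apply real_exp_sum_expandable, real_exp_sum_Cexp. }
    assert (D0 := item_dominated b b0 (e / 3) Gt2 Hb V0 ltac:(lra)).
    assert (D1 := item_dominated b b1 (e / 3) Gt1 Hb V1 ltac:(lra)).
    assert (D2 := item_dominated b b2 (e / 3) Gt2 Hb V2 ltac:(lra)).
    apply (ev_mono _ _ (ev_and _ _ (bracket_expansion N) (ev_and _ _ Close (ev_and _ _ D0 (ev_and _ _ D1 D2))))).
    intros t [X1 [X2 [X3 [X4 X5]]]].
    rewrite Cmod_ival in X3, X4, X5. unfold b0, b1, b2 in X3, X4, X5. cbn [fst snd] in X3, X4, X5.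
    rewrite Cmod_1, Rmult_1_l in X3.
    rewrite Cmod_R, Rabs_pos_eq in X4 by (apply Rmult_le_pos; [lra|apply pow_le; lra]).
    rewrite Cmod_mult, Cexp_real_mult, !Cmod_R, !Rabs_pos_eq in X5 by (first [lra|left; apply exp_pos]).
    rewrite Rmult_assoc, <- exp_plus, Rmult_1_l in X5.
    replace (isum l' t - isum (term_range bracket_item 0 N) t)%C
      with ((RtoC (bracket t) - isum (term_range bracket_item 0 N) t) - (RtoC (bracket t) - isum l' t))%C by ring.
    eapply Rle_trans; [apply Cmod_minus_triangle|]. lra.
Qed.

Theorem mainTheorem1 :
  let f := fun z : R => z + z ^ 2 in
  let flog := fun x : R => - ln (f (exp (- x))) in
  let Aflog := fun x : R => ln (flog (exp x)) in
  let k1 := fun x : R => Aflog (m (1 / 2) x) - m (1 / 2) x in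
  let k2 := fun x : R => Aflog (m (1 / 3) x) - m (1 / 3) x in
  K11 (fun x => RtoC (k1 x)) /\
  K11 (fun x => RtoC (k2 x)) /\
  ~ K11 (fun x => RtoC (Derive k2 x * k1 x - Derive k1 x * k2 x)).
Proof.
  intros f flog Aflog k1 k2.
  split; [apply (K11_log_conjugate (1 / 2)); lra|].
  split; [apply (K11_log_conjugate (1 / 3)); lra|].
  (* t >= 4 makes both arguments t and 2t/3 exceed 2, where the formulas for [log_conjugate]
     hold. *)
  apply bracket_not_K11. exists 4. intros t Ht.
  assert (D1 := log_conjugate_derive (1 / 2) (2 * t) ltac:(lra) ltac:(lra)).
  assert (D2 := log_conjugate_derive (1 / 3) (2 * t) ltac:(lra) ltac:(lra)).
  assert (E1 := log_conjugate_eq (m (1 / 2) (2 * t)) ltac:(unfold m; lra)).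
  assert (E2 := log_conjugate_eq (m (1 / 3) (2 * t)) ltac:(unfold m; lra)).
  change (Derive k1 (2 * t) = 1 / 2 * (exp (1 / 2 * (2 * t)) * G' (exp (1 / 2 * (2 * t))))) in D1.
  change (Derive k2 (2 * t) = 1 / 3 * (exp (1 / 3 * (2 * t)) * G' (exp (1 / 3 * (2 * t))))) in D2.
  change (k1 (2 * t) = G (exp (1 / 2 * (2 * t)))) in E1.
  change (k2 (2 * t) = G (exp (1 / 3 * (2 * t)))) in E2.
  rewrite D1, D2, E1, E2. unfold bracket.
  replace (1 / 2 * (2 * t)) with t by field. replace (1 / 3 * (2 * t)) with (2 / 3 * t) by field.
  ring.
Qed.
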